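(* Let $\zeta$ be a primitive aperiodic substitution on an alphabet of $d\ge 2$ letters such that its substitution matrix $S=S_\zeta$ has a characteristic polynomial that is irreducible over $\mathbb{Q}$ and $S$ has no eigenvalues on the unit circle. Then either the system $(X_\zeta,T,\mu)$ has a non-trivial discrete component of the spectrum, or there exist constants $C_\zeta, r_0,\gamma>0$, depending only on $\zeta$, such that for every cylindrical function $f$ of level $0$ on $X_\zeta$ with $\int f\,d\mu=0$ and for all $\omega\in[0,1)$, $$\sigma_f(B_r(\omega))\le C_\zeta\,\|f\|_\infty^2\cdot(\log(1/r))^{-\gamma}\quad\text{for all } r\in(0,r_0).$$
   Context: Alphabet and substitution: $\mathcal{A}=\{0,\dots,d-1\}$, $d\ge2$; $\mathcal{A}^+$ is the set of nonempty finite words. A substitution is a map $\zeta:\mathcal{A}\to\mathcal{A}^+$, extended to words and sequences by concatenation. The substitution space $X_\zeta$ is the set of $x\in\mathcal{A}^{\mathbb{Z}}$ such that every finite word in $x$ is a subword of $\zeta^n(a)$ for some $a\in\mathcal{A}$, $n\in\mathbb{N}$. $T$ is the left shift on $X_\zeta$. The substitution matrix $S=S_\zeta$ is the $d\times d$ matrix whose entry $S(i,j)$ is the number of symbols $i$ in $\zeta(j)$. $\zeta$ is primitive if some power $S^n$ has all entries strictly positive; a primitive $\zeta$ is aperiodic (non-periodic) iff $X_\zeta$ is infinite. For primitive $\zeta$ the system is uniquely ergodic and $\mu$ denotes the unique $T$-invariant Borel probability measure. A cylindrical function of level $0$ is a function $f:X_\zeta\to\mathbb{C}$ depending only on $x_0$,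 i.e. $f=\sum_{j=0}^{d-1}b_j\mathbf{1}_{[j]}$ with $[j]=\{x\in X_\zeta: x_0=j\}$. For $f\in L^2(X_\zeta,\mu)$ the spectral measure $\sigma_f$ is the finite positive measure on $\mathbb{R}/\mathbb{Z}\cong[0,1)$ determined by $\int_0^1 e^{2\pi i k\omega}\,d\sigma_f(\omega)=\langle f\circ T^k,f\rangle_{L^2(\mu)}$, $k\in\mathbb{Z}$. $B_r(\omega)$ is the ball of radius $r$ centered at $\omega$ in $\mathbb{R}/\mathbb{Z}$. Having a non-trivial discrete component of the spectrum means that the unitary operator $f\mapsto f\circ T$ on $L^2(X_\zeta,\mu)$ has an eigenvalue $e^{2\pi i\omega}\neq1$ (i.e. a non-constant eigenfunction; the system is not weakly mixing). *)

(* Defs.v *)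
From HB Require Import structures.
From mathcomp Require Import all_boot all_order all_algebra.
From mathcomp Require Import complex.
From mathcomp Require Import all_classical all_reals all_analysis.

Set Implicit Arguments.
Unset Strict Implicit.
Unset Printing Implicit Defensive.

Import Order.TTheory GRing.Theory Num.Theory.
Import numFieldNormedType.Exports.

Local Open Scope classical_set_scope.
Local Open Scope complex_scope.
Local Open Scope ring_scope.

(* The alphabet {0, ..., d-1} is 'I_n.+1, i.e. d = n.+1: it has to be nonempty
   for the sequence space to carry a measurable structure.  The condition
   2 <= d is a separate hypothesis. *)
Section substitution.
Variable n : nat.
Local Notation letter := 'I_n.+1.
Implicit Types (zeta : letter -> seq letter) (x : int -> letter).

Definition is_substitution zeta := forall a, zeta a <> [::].

Definition subst_word zeta (w : seq letter) : seq letter :=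
  flatten [seq zeta a | a <- w].

(* The word x_k x_(k+1) ... x_(k+m-1). *)
Definition window x (k : int) (m : nat) : seq letter :=
  mkseq (fun i => x (k + i%:Z)) m.

Definition subst_matrix zeta : 'M[int]_n.+1 :=
  \matrix_(i, j) (count_mem i (zeta j))%:Z.

Definition primitive zeta :=
  exists m : nat, forall i j, 0 < (subst_matrix zeta ^+ m) i j.

Definition full_shift : Type :=
  prod_topology (fun _ : int => discrete_topology letter).

HB.instance Definition _ := Topological.copy full_shift
  (prod_topology (fun _ : int => discrete_topology letter)).
HB.instance Definition _ := isPointed.Build full_shift (fun=> ord0).

Definition subst_space zeta : set full_shift :=
  [set x | forall (k : int) (m : nat), exists (p : nat) (a : letter),
     infix (window x k m) (iter p (subst_word zeta) [:: a])].

Definition aperiodic zeta := infinite_set (subst_space zeta).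

Definition shift_seq (k : int) (x : full_shift) : full_shift :=
  fun i => x (i + k).

End substitution.

Notation borel_shift n := (g_sigma_algebraType (@open (full_shift n))).

Section spectral.
Variables (R : realType) (n : nat).

(* A Borel probability measure on the closed set subst_space zeta is encoded
   as a Borel probability measure on the full shift giving it full mass;
   correspondingly, functions on subst_space zeta are represented by functions
   on the full shift whose values off subst_space zeta are never used. *)
Definition invariant_probability (zeta : 'I_n.+1 -> seq 'I_n.+1)
    (mu : probability (borel_shift n) R) :=
  mu (subst_space zeta) = 1%E /\
  forall A : set (borel_shift n), measurable A -> mu (shift_seq 1 @^-1` A) = mu A.

Definition cintegral d (T : measurableType d)
    (mu : {measure set T -> \bar R}) (D : set T) (f : T -> R[i]) : R[i] :=
  Rintegral mu D (fun x => complex.Re (f x)) +i* Rintegral mu D (fun x => complex.Im (f x)).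

Definition square_integrable d (T : measurableType d)
    (mu : {measure set T -> \bar R}) (D : set T) (f : T -> R[i]) :=
  [/\ measurable_fun D (fun x => complex.Re (f x)),
      measurable_fun D (fun x => complex.Im (f x)) &
      (\int[mu]_(x in D) ((ComplexField.Normc.normc (f x)) ^+ 2)%:E < +oo)%E].

Definition expi2pi (t : R) : R[i] := cos (2 * pi * t) +i* sin (2 * pi * t).

Definition nontrivial_discrete_spectrum (zeta : 'I_n.+1 -> seq 'I_n.+1)
    (mu : probability (borel_shift n) R) :=
  let X := subst_space zeta in
  exists (w : R) (g : borel_shift n -> R[i]),
    [/\ expi2pi w <> 1,
        square_integrable mu X g,
        ~ {ae mu, forall x, X x -> g x = 0} &
        {ae mu, forall x, X x -> g (shift_seq 1 x) = expi2pi w * g x}].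

Definition cylindrical0 (zeta : 'I_n.+1 -> seq 'I_n.+1)
    (f : borel_shift n -> R[i]) :=
  exists b : 'I_n.+1 -> R[i], forall x, subst_space zeta x -> f x = b (x 0).

Definition sup_norm (zeta : 'I_n.+1 -> seq 'I_n.+1)
    (f : borel_shift n -> R[i]) : R :=
  sup [set ComplexField.Normc.normc (f x) | x in subst_space zeta].

(* A measure on R/Z is encoded as a Borel measure on the real line
   concentrated on [0, 1[. *)
Definition is_spectral_measure (zeta : 'I_n.+1 -> seq 'I_n.+1)
    (mu : probability (borel_shift n) R) (f : borel_shift n -> R[i])
    (sigma : {finite_measure set (measurableTypeR R) -> \bar R}) :=
  sigma (~` `[0, 1[) = 0%E /\
  forall k : int,
    cintegral sigma `[0, 1[ (fun t => expi2pi (k%:~R * t)) =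
    cintegral mu (subst_space zeta) (fun x => f (shift_seq k x) * (f x)^*).

(* The open ball of radius r around w in R/Z, represented inside [0, 1[. *)
Definition circle_ball (w r : R) : set (measurableTypeR R) :=
  [set t | 0 <= t < 1 /\ exists m : int, `|t - w + m%:~R| < r].

End spectral.

(* Main.v *)
Require Import Defs.
From HB Require Import structures.
From mathcomp Require Import all_boot all_order all_algebra.
From mathcomp Require Import complex mxtens.
From mathcomp Require Import all_classical all_reals all_analysis.
From mathcomp Require Import measurable_realfun.
From mathcomp Require Import zify ring lra.

Set Implicit Arguments.
Unset Strict Implicit.
Unset Printing Implicit Defensive.

Import Order.TTheory GRing.Theory Num.Theory.
Import numFieldNormedType.Exports.

Local Open Scope classical_set_scope.
Local Open Scope complex_scope.
Local Open Scope ring_scope.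

(* Fix a legal word x0 containing all legal pairs of letters.  Call alpha a
   quasi-period if alpha |zeta^k v| approaches the integers exponentially fast
   for every return word v of x0.

   Without nontrivial eigenvalues, quasi-periods are integers.  A quasi-period
   alpha yields phases for which the twisted counts of the occurrences of any
   word converge; a nonzero limit would be the absolute value of an
   eigenfunction, so the limits vanish.  Because the complexity is at most
   linear, some word occurs in few places inside the tiles zeta^k a, and a
   second moment then bounds the order of alpha in R/Z.  If 1/p is a
   quasi-period, irreducibility forces p to divide a power of S, so that all
   1/p^l are quasi-periods, against the bound.

   If w |zeta^k v| stays close to the integers for all v and all k in a window
   [k0, (B+1) k0], then the nearest integers satisfy the recurrence given by
   the characteristic polynomial of S, and Liouville's inequality applied to
   their components along the expanding eigenvalues shows that they are
   approximations of alpha |zeta^k v| for a quasi-period alpha very close to w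
   (the remaining eigenvalues are inside the unit disc).  Hence w is very close
   to an integer.  For any other w, each scale [q^t, q^(t+1)] contains a level
   at which the two equal letters delimiting some return word interfere, and
   the normalised twisted sums lose a fixed factor; for w very close to an
   integer they are small because f has mean zero.  At level q^t they are thus
   O(theta^t), and the spectral measure of an arc of length r is at most a
   constant times the square of such a sum over a window of length about 1/r,
   for which q^t is comparable to log(1/r). *)

(** * Words and inflation *)

(** The logarithm comes from the length of the windows. At level k0 the integers involved are
    exponentially large in k0, Liouville's inequality costs a fixed power of their size, and only
    the factor rho^L gained from the expanding eigenvalues over L levels pays for it. Hence L must
    be proportional to k0, and a loss is guaranteed only once per geometric block of levels. As
    tiles of level q^t have length exponential in q^t, theta^t turns into a power of log(1/r).
    Phases are attached to letters at each level, not to points of the space. They agree along legal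
    words and between successive levels only up to geometric errors; since these are summable, a
    phase can be carried from a tile to any of its descendants with an error that depends on the
    lower level alone. The bound on the order of a quasi-period must depend on the substitution
    alone, otherwise it could not be played against the family 1/p^l. This is why the second moment
    is normalised by the number of positions that a word may occupy, bounded independently of the
    level. *)

Section words.
Variables (n : nat) (zeta : 'I_n.+1 -> seq 'I_n.+1).
Local Notation letter := 'I_n.+1.
Implicit Types (a b c : letter) (u v w : seq letter).

Definition inflate k u := iter k (subst_word zeta) u.
Definition len k a := size (inflate k [:: a]).
Definition maxlen k := (\max_(a : letter) len k a)%N.
Definition legal u := exists p a, infix u (inflate p [:: a]).

Lemma subst_word_cat u v :
  subst_word zeta (u ++ v) = subst_word zeta u ++ subst_word zeta v.
Proof. by rewrite /subst_word map_cat flatten_cat. Qed.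

Lemma subst_word1 a : subst_word zeta [:: a] = zeta a.
Proof. by rewrite /subst_word /= cats0. Qed.

Lemma inflate_cat k u v : inflate k (u ++ v) = inflate k u ++ inflate k v.
Proof. by rewrite /inflate; elim: k => //= k ->; rewrite subst_word_cat. Qed.

Lemma inflate_nil k : inflate k [::] = [::].
Proof. by rewrite /inflate; elim: k => //= k ->. Qed.

Lemma inflate_cons k a u : inflate k (a :: u) = inflate k [:: a] ++ inflate k u.
Proof. by rewrite -cat1s inflate_cat. Qed.

Lemma inflateD k l u : inflate (k + l) u = inflate k (inflate l u).
Proof. exact: iterD. Qed.

Lemma inflateSr k a : inflate k.+1 [:: a] = inflate k (zeta a).
Proof. by rewrite /inflate iterSr subst_word1. Qed.

Lemma size_inflate k u : size (inflate k u) = (\sum_(a <- u) len k a)%N.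
Proof.
elim: u => [|a u IH]; first by rewrite inflate_nil big_nil.
by rewrite inflate_cons size_cat IH big_cons.
Qed.

Lemma len0 a : len 0 a = 1%N. Proof. by []. Qed.

Lemma lenD k l a : len (k + l) a = (\sum_(b <- inflate l [:: a]) len k b)%N.
Proof. by rewrite /len inflateD size_inflate. Qed.

Lemma lenS k a : len k.+1 a = (\sum_(b <- zeta a) len k b)%N.
Proof. by rewrite /len inflateSr size_inflate. Qed.

Lemma sumr_count (R : pzSemiRingType) (F : letter -> R) w :
  \sum_(j <- w) F j = \sum_l F l * (count_mem l w)%:R.
Proof.
elim: w => [|a w IH]; first by rewrite big_nil big1 // => l _; rewrite mulr0.
rewrite big_cons IH (bigD1 a) //= [RHS](bigD1 a) //= eqxx natrD mulrDr mulr1 addrA.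
congr (_ + _); apply: eq_bigr => l /negPf la.
by rewrite eq_sym la.
Qed.

Lemma count_inflate k i u :
  (count_mem i (inflate k u))%:Z = \sum_(j <- u) (subst_matrix zeta ^+ k) i j.
Proof.
elim: k u => [|k IH] u.
  rewrite expr0 /= sumr_count (bigD1 i) //= mxE eqxx mul1r big1 ?addr0 ?natz //.
  by move=> l /negPf li; rewrite mxE eq_sym li mul0r.
rewrite /inflate iterSr -/(inflate _ _) IH.
elim: u => [|a u IHu]; first by rewrite /subst_word /= !big_nil.
rewrite -cat1s subst_word_cat big_cat /= subst_word1 IHu big_cons.
congr (_ + _); rewrite exprSr mxE sumr_count.
by apply: eq_bigr => l _; rewrite mxE natz.
Qed.

Lemma sum_seq_const (T : Type) (s : seq T) k : (\sum_(b <- s) k = size s * k)%N.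
Proof. by rewrite big_const_seq count_predT iter_addn_0 mulnC. Qed.

Lemma maxlen_ge k a : (len k a <= maxlen k)%N.
Proof. exact: (leq_bigmax_cond (F := len k)). Qed.

Lemma maxlenP k : exists a, maxlen k = len k a.
Proof.
rewrite /maxlen; have [|a ->] := @bigop.eq_bigmax letter (len k); first by rewrite card_ord.
by exists a.
Qed.

Lemma drop_inflate k u i : exists s j,
  drop i (inflate k u) = s ++ inflate k (drop j u) /\ (size s <= maxlen k)%N.
Proof.
elim: u i => [|a u IH] i.
  by exists [::], 0%N; rewrite inflate_nil.
rewrite inflate_cons drop_cat; case: ifP => hi.
  exists (drop i (inflate k [:: a])), 1%N; rewrite /= drop0; split=> //.
  by rewrite size_drop (leq_trans (leq_subr _ _)) // maxlen_ge.
by have [s [j [-> hs]]] := IH (i - size (inflate k [:: a]))%N; exists s, j.+1.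
Qed.

Lemma take_inflate k u i : exists j t,
  take i (inflate k u) = inflate k (take j u) ++ t /\ (size t <= maxlen k)%N.
Proof.
elim: u i => [|a u IH] i.
  by exists 0%N, [::]; rewrite inflate_nil.
rewrite inflate_cons take_cat; case: ifP => hi.
  exists 0%N, (take i (inflate k [:: a])); rewrite inflate_nil; split=> //.
  by rewrite size_take hi ltnW // (leq_trans hi) // maxlen_ge.
have [j [t [-> ht]]] := IH (i - size (inflate k [:: a]))%N.
by exists j.+1, t; rewrite /= (inflate_cons k a (take j u)) catA.
Qed.

Lemma legal_infix u v : infix u v -> legal v -> legal u.
Proof. by move=> uv [p [a va]]; exists p, a; apply: infix_trans va. Qed.

Lemma legal_inflate p a : legal (inflate p [:: a]).
Proof. by exists p, a; exact: infix_refl. Qed.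

Lemma legal1 a : legal [:: a].
Proof. exact: (legal_inflate 0). Qed.

Lemma infix_inflate k u v : infix u v -> infix (inflate k u) (inflate k v).
Proof.
by move=> /infixP[p [q ->]]; rewrite !inflate_cat infix_infix.
Qed.

Hypothesis hsubst : is_substitution zeta.

Lemma len_gt0 k a : (0 < len k a)%N.
Proof.
elim: k a => [//|k IH] a; rewrite lenS.
case E: (zeta a) => [|b u]; first by have := hsubst E.
by rewrite big_cons addn_gt0 IH.
Qed.

Lemma size_le_inflate k u : (size u <= size (inflate k u))%N.
Proof.
rewrite size_inflate -sum1_size; apply: leq_sum => a _; exact: len_gt0.
Qed.

Lemma inflate_nnil k a : inflate k [:: a] != [::].
Proof. by rewrite -size_eq0 -lt0n len_gt0. Qed.

Lemma len_mono k l a : (k <= l)%N -> (len k a <= len l a)%N.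
Proof.
by move=> kl; rewrite -(subnK kl) /len inflateD; exact: size_le_inflate.
Qed.

Lemma maxlen_gt0 k : (0 < maxlen k)%N.
Proof. exact: leq_trans (len_gt0 k ord0) (maxlen_ge k ord0). Qed.

Lemma maxlen_mono k l : (k <= l)%N -> (maxlen k <= maxlen l)%N.
Proof.
move=> kl; have [a ->] := maxlenP k.
exact: leq_trans (len_mono a kl) (maxlen_ge l a).
Qed.

Lemma maxlenD k l : (maxlen (k + l) <= maxlen k * maxlen l)%N.
Proof.
have [a ->] := maxlenP (k + l); rewrite lenD.
apply: (@leq_trans (\sum_(b <- inflate l [:: a]) maxlen k)%N).
  by apply: leq_sum => b _; exact: maxlen_ge.
by rewrite sum_seq_const mulnC leq_mul // maxlen_ge.
Qed.

Lemma maxlen_exp k : (maxlen k <= maxlen 1 ^ k)%N.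
Proof.
elim: k => [|k IH].
  by apply/bigmax_leqP => a _; rewrite len0.
by rewrite -addn1 (leq_trans (maxlenD _ _)) // expnD expn1 leq_mul.
Qed.

(** A tile of level p >= k is a concatenation of tiles of level k, so cutting it where [w] starts
    leaves one incomplete tile [s] followed by complete ones. If p < k, then [w] is shorter than
    [maxlen k] and [s] can be [w] itself. *)
Lemma legal_parse k w : legal w -> exists s v,
  [/\ prefix w (s ++ inflate k v), (size s <= maxlen k)%N & legal v].
Proof.
move=> [p [a wa]]; case: (leqP k p) => [kp|pk].
  move: wa => /infixP[P [Q E]].
  have : drop (size P) (inflate k (inflate (p - k) [:: a])) = w ++ Q.
    by rewrite -inflateD subnKC // E drop_size_cat.
  have [s [j [-> hs]]] := drop_inflate k (inflate (p - k) [:: a]) (size P).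
  move=> {}E; exists s, (drop j (inflate (p - k) [:: a])); split=> //.
    by rewrite E prefix_prefix.
  exists (p - k)%N, a; apply/infixP; exists (take j (inflate (p - k) [:: a])), [::].
  by rewrite cats0 cat_take_drop.
exists w, [::]; rewrite inflate_nil cats0 prefix_refl; split=> //.
  apply: leq_trans (size_infix wa) _.
  exact: leq_trans (maxlen_ge p a) (maxlen_mono (ltnW pk)).
by apply: legal_infix (legal1 a); exact: infix0s.
Qed.

Variable m : nat.
Hypothesis mP : forall a b, a \in inflate m [:: b].

Lemma mem_inflate_ge q a b : (m <= q)%N -> a \in inflate q [:: b].
Proof.
move=> mq; rewrite -(subnKC mq) inflateD.
have := inflate_nnil (q - m) b; case: (inflate _ _) => // c u _.
by rewrite inflate_cons mem_cat mP.
Qed.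

Lemma mem_infix_inflate p a v : a \in v -> infix (inflate p [:: a]) (inflate p v).
Proof.
move=> /splitPr[v1 v2]; rewrite -cat1s; apply: infix_inflate; exact: infix_infix.
Qed.

Lemma legal_everywhere u : legal u ->
  exists P, forall Q b, (P <= Q)%N -> infix u (inflate Q [:: b]).
Proof.
move=> [p [a ua]]; exists (p + m)%N => Q b PQ.
apply: infix_trans ua _.
have -> : Q = (p + (Q - p))%N by lia.
by rewrite inflateD mem_infix_inflate // mem_inflate_ge //; lia.
Qed.

Lemma len_mem k a u : a \in u -> (len k a <= size (inflate k u))%N.
Proof. by move=> au; apply: size_infix; exact: mem_infix_inflate. Qed.

(** For k >= m both tiles split into tiles of level k - m. The tile of [b] contains the longest of
    these, and the tile of [a] consists of at most [maxlen m] of them. *)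
Lemma len_comparable k a b : (len k a <= maxlen m * len k b)%N.
Proof.
case: (leqP m k) => [mk|km]; last first.
  apply: (@leq_trans (maxlen m)); last by rewrite leq_pmulr // len_gt0.
  exact: leq_trans (maxlen_ge _ _) (maxlen_mono (ltnW km)).
have E c : len k c = size (inflate (k - m) (inflate m [:: c])).
  by rewrite -inflateD subnK.
have [c hc] := maxlenP (k - m).
rewrite !E; apply: (@leq_trans (maxlen m * len (k - m) c)).
  rewrite size_inflate -hc.
  apply: (@leq_trans (\sum_(d <- inflate m [:: a]) maxlen (k - m))%N).
    by apply: leq_sum => d _; exact: maxlen_ge.
  by rewrite sum_seq_const leq_mul // maxlen_ge.
by rewrite leq_mul2l len_mem ?orbT.
Qed.

Lemma maxlen_comparable k a : (maxlen k <= maxlen m * len k a)%N.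
Proof. by have [b ->] := maxlenP k; exact: len_comparable. Qed.

Hypothesis hd : (2 <= n.+1)%N.

Lemma len_m_ge2 a : (2 <= len m a)%N.
Proof.
have u2 : uniq [:: ord0; ord_max : letter].
  by rewrite /= inE -val_eqE /=; lia.
rewrite /len (uniq_leq_size u2) // => c _; exact: mP.
Qed.

Lemma len_growth k a : (2 ^ k <= len (k * m) a)%N.
Proof.
elim: k a => [|k IH] a; first by rewrite mul0n len0.
rewrite mulSnr lenD expnS mulnC.
apply: (@leq_trans (\sum_(b <- inflate m [:: a]) 2 ^ k)%N).
  by rewrite sum_seq_const mulnC leq_mul // len_m_ge2.
by apply: leq_sum => b _; exact: IH.
Qed.

(** There are finitely many pairs of letters, and by primitivity each legal one occurs in every tile
    of sufficiently high level; a single tile of level [M] therefore contains them all. Pairs that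
    are not legal get the level 0. *)
Lemma universal_word : exists (x0 : seq letter) (m' : nat),
  [/\ forall b c, legal [:: b; c] -> infix [:: b; c] x0,
      forall b, b \in x0 & forall b, infix x0 (inflate m' [:: b])].
Proof.
have /fin_all_exists[P hP] : forall bc : letter * letter, exists P,
    legal [:: bc.1; bc.2] ->
    forall Q d, (P <= Q)%N -> infix [:: bc.1; bc.2] (inflate Q [:: d]).
  move=> [b c]; case: (pselect (legal [:: b; c])) => h; last by exists 0%N.
  by have [P ?] := legal_everywhere h; exists P.
pose M := maxn m (\max_bc P bc).
exists (inflate M [:: ord0]), (M + m)%N; split.
- move=> b c h; apply: (hP (b, c) h).
  by rewrite leq_max (leq_bigmax_cond (F := P)) ?orbT.
- by move=> b; rewrite mem_inflate_ge // leq_maxl.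
- by move=> b; rewrite inflateD mem_infix_inflate // mP.
Qed.

End words.

Lemma primitive_mem (n : nat) (zeta : 'I_n.+1 -> seq 'I_n.+1) :
  primitive zeta -> exists m, forall a b, a \in inflate zeta m [:: b].
Proof.
move=> [m hm]; exists m => a b; rewrite -has_pred1 has_count.
have := count_inflate zeta m a [:: b]; rewrite big_seq1 => E.
by have := hm a b; rewrite -E.
Qed.

(** * Moduli and characters *)

Notation nc := ComplexField.Normc.normc.
Notation e2 := expi2pi.

Section complex_modulus.
Variable R : realType.
Implicit Types (x y z : R[i]) (t s : R).

Lemma nc_sqr z : nc z ^+ 2 = complex.Re z ^+ 2 + complex.Im z ^+ 2.
Proof. by case: z => a b /=; rewrite sqr_sqrtr ?addr_ge0 ?sqr_ge0. Qed.

Lemma nc_ge0 z : 0 <= nc z.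
Proof. by case: z => a b /=; exact: sqrtr_ge0. Qed.

Lemma ncD x y : nc (x + y) <= nc x + nc y.
Proof. exact: le_normcD. Qed.

Lemma ncN z : nc (- z) = nc z.
Proof. exact: normcN. Qed.

Lemma ncM x y : nc (x * y) = nc x * nc y.
Proof. exact: ComplexField.Normc.normcM. Qed.

Lemma nc0 : nc (0 : R[i]) = 0.
Proof. exact: ComplexField.Normc.normc0. Qed.

Lemma nc1 : nc (1 : R[i]) = 1.
Proof. exact: ComplexField.Normc.normc1. Qed.

Lemma ncB x y : nc (x - y) = nc (y - x).
Proof. by rewrite -ncN opprB. Qed.

Lemma ncT x y z : nc (x - z) <= nc (x - y) + nc (y - z).
Proof. by rewrite -[x - z](subrKA y) ncD. Qed.

Lemma nc_ler_sub x y : nc x <= nc y + nc (x - y).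
Proof. by rewrite -{1}[x](subrK y) addrC ncD. Qed.

Lemma ncX z k : nc (z ^+ k) = nc z ^+ k.
Proof. by elim: k => [|k IH]; rewrite ?expr0 ?nc1 // !exprS ncM IH. Qed.

Lemma nc_eq0 z : (nc z == 0) = (z == 0).
Proof.
apply/eqP/eqP => [|->]; last exact: nc0.
exact: ComplexField.Normc.eq0_normc.
Qed.

Lemma nc_real t : nc t%:C = `|t|.
Proof. by rewrite /= expr0n addr0 sqrtr_sqr. Qed.

Lemma nc_nat (k : nat) : nc (k%:R : R[i]) = k%:R.
Proof.
have -> : (k%:R : R[i]) = (k%:R : R)%:C by rewrite rmorph_nat.
by rewrite nc_real ger0_norm.
Qed.

Lemma nc_sum (I : Type) (r : seq I) (P : pred I) (F : I -> R[i]) :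
  nc (\sum_(i <- r | P i) F i) <= \sum_(i <- r | P i) nc (F i).
Proof.
elim/big_ind2: _ => [|x1 x2 y1 y2 h1 h2|//]; first by rewrite nc0.
by rewrite (le_trans (ncD _ _)) // lerD.
Qed.

Lemma nc_conj z : nc z^*%C = nc z.
Proof. by case: z => a b /=; rewrite sqrrN. Qed.

Lemma conj_mul_nc z : z * z^*%C = (nc z ^+ 2)%:C.
Proof. by rewrite nc_sqr; case: z => a b; simpc; congr (_ +i* _); ring. Qed.

Lemma Re_le_nc z : `|complex.Re z| <= nc z.
Proof.
rewrite -(@ler_pXn2r _ 2) ?nnegrE ?nc_ge0 // nc_sqr real_normK ?num_real //.
by rewrite lerDl sqr_ge0.
Qed.

Lemma Im_le_nc z : `|complex.Im z| <= nc z.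
Proof.
rewrite -(@ler_pXn2r _ 2) ?nnegrE ?nc_ge0 // nc_sqr real_normK ?num_real //.
by rewrite lerDr sqr_ge0.
Qed.

Lemma nc_le_ReIm z : nc z <= `|complex.Re z| + `|complex.Im z|.
Proof.
rewrite -(@ler_pXn2r _ 2) ?nnegrE ?nc_ge0 ?addr_ge0 // nc_sqr sqrrD.
rewrite !real_normK ?num_real // lerD2r lerDl.
by rewrite mulrn_wge0 // mulr_ge0.
Qed.

Lemma ReD x y : complex.Re (x + y) = complex.Re x + complex.Re y.
Proof. by case: x; case: y. Qed.

Lemma ImD x y : complex.Im (x + y) = complex.Im x + complex.Im y.
Proof. by case: x; case: y. Qed.

Lemma ReB x y : complex.Re (x - y) = complex.Re x - complex.Re y.
Proof. by case: x; case: y. Qed.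

Lemma ImB x y : complex.Im (x - y) = complex.Im x - complex.Im y.
Proof. by case: x; case: y. Qed.

Lemma Re_sum (I : Type) (r : seq I) (P : pred I) (F : I -> R[i]) :
  complex.Re (\sum_(i <- r | P i) F i) = \sum_(i <- r | P i) complex.Re (F i).
Proof. by elim/big_rec2: _ => // i y1 y2 _ <-; rewrite ReD. Qed.

Lemma Im_sum (I : Type) (r : seq I) (P : pred I) (F : I -> R[i]) :
  complex.Im (\sum_(i <- r | P i) F i) = \sum_(i <- r | P i) complex.Im (F i).
Proof. by elim/big_rec2: _ => // i y1 y2 _ <-; rewrite ImD. Qed.

Lemma e2D t s : e2 (t + s) = e2 t * e2 s.
Proof.
rewrite /e2 mulrDr cosD sinD; simpc; congr (_ +i* _).
by rewrite addrC [sin _ * cos _]mulrC addrC; congr (_ + _); rewrite mulrC.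
Qed.

Lemma e2_0 : e2 (0 : R) = 1.
Proof. by rewrite /e2 mulr0 cos0 sin0. Qed.

Lemma e2N t : e2 (- t) = (e2 t)^*%C.
Proof. by rewrite /e2 mulrN cosN sinN. Qed.

Lemma nc_e2 t : nc (e2 t) = 1.
Proof. by rewrite /e2 /= cos2Dsin2 sqrtr1. Qed.

Lemma e2_nat (k : nat) : e2 (k%:R : R) = 1.
Proof.
elim: k => [|k IH]; first exact: e2_0.
by rewrite -addn1 natrD e2D IH mul1r /e2 mulr1 mulr_natl cos2pi sin2pi.
Qed.

Lemma e2_int (k : int) : e2 (k%:~R : R) = 1.
Proof.
case: k => k; first by rewrite -pmulrn e2_nat.
by rewrite NegzE mulrNz e2N -pmulrn e2_nat conjc1.
Qed.

Lemma e2Dint t (k : int) : e2 (t + k%:~R) = e2 t.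
Proof. by rewrite e2D e2_int mulr1. Qed.

Lemma e2_mulrn t (k : nat) : e2 (t *+ k) = e2 t ^+ k.
Proof.
by elim: k => [|k IH]; rewrite ?mulr0n ?e2_0 ?expr0 // mulrS e2D IH exprS.
Qed.

Lemma sin_le t : 0 <= t -> sin t <= t.
Proof.
move=> t0.
have D (x : R) : x \in `]0, t[%R -> is_derive x 1 (fun x : R => x - sin x) (1 - cos x).
  by move=> _; apply: is_deriveB.
have Cn : {within `[0, t], continuous (fun x : R => x - sin x)}.
  apply: continuous_subspaceT => x; apply: continuousB; first exact: cvg_id.
  exact: continuous_sin.
have [c _] := MVT_segment t0 D Cn; rewrite sin0 !subr0 => E.
have : 0 <= t - sin t by rewrite E mulr_ge0 // subr_ge0 cos_le1.
by rewrite subr_ge0.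
Qed.

Lemma norm_sin_le t : `|sin t| <= `|t|.
Proof.
wlog t0 : t / 0 <= t.
  move=> H; case: (leP 0 t) => [/H //|t0].
  by rewrite -normrN -sinN -[leRHS]normrN; apply: H; lra.
rewrite (ger0_norm t0) ler_norml sin_le // andbT.
case: (leP t 2) => t2.
  case: (leP 2 t) => t2'.
    by have := sin_geN1 t; lra.
  case: (ltrP 0 t) => t0'; last first.
    have -> : t = 0 by apply/le_anti; rewrite t0 t0'.
    by rewrite sin0 oppr0.
  have : 0 < sin t by apply: sin2_gt0; rewrite t0' t2'.
  lra.
by have := sin_geN1 t; lra.
Qed.

Lemma cos_double t : cos (2 * t) = 1 - 2 * sin t ^+ 2.
Proof. by rewrite mulr_natl cos_mulr2n cos2sin2; ring. Qed.

Lemma nc_e2B1_sqr t : nc (e2 t - 1) ^+ 2 = 4 * sin (pi * t) ^+ 2.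
Proof.
rewrite nc_sqr /e2 ReB ImB /= -mulrA subr0.
have := cos2Dsin2 (2 * (pi * t)); have := cos_double (pi * t).
set c := cos _; set s := sin (2 * _); set s' := sin _ => -> /esym.
nra.
Qed.

Lemma pi_le4 : pi <= 4 :> R.
Proof. by have := pihalf_lt2 R; lra. Qed.

Lemma nc_e2B1 t : nc (e2 t - 1) <= 8 * `|t|.
Proof.
rewrite -(@ler_pXn2r _ 2) ?nnegrE ?nc_ge0 ?mulr_ge0 // nc_e2B1_sqr.
have := norm_sin_le (pi * t); rewrite normrM (ger0_norm (pi_ge0 R)) => h.
rewrite -[sin _ ^+ 2]real_normK ?num_real //.
have h2 : `|sin (pi * t)| <= 4 * `|t|.
  by rewrite (le_trans h) // ler_wpM2r // pi_le4.
by have := normr_ge0 (sin (pi * t)); have := normr_ge0 t; nra.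
Qed.

Lemma nc_e2B1_int t (k : int) : nc (e2 t - 1) <= 8 * `|t - k%:~R|.
Proof.
rewrite -{1}[t](subrK k%:~R) e2Dint; exact: nc_e2B1.
Qed.

Lemma e2_eq1 t : e2 t = 1 -> exists k : int, t = k%:~R.
Proof.
move=> et; exists (Num.floor t); apply/eqP; rewrite -subr_eq0.
have /andP[h0 h1] : (0 <= t - (Num.floor t)%:~R < 1).
  by have := floor_itv t; rewrite intrD /=; lra.
rewrite eq_le h0 andbT leNgt; apply/negP => h.
have : nc (e2 (t - (Num.floor t)%:~R) - 1) ^+ 2 = 0.
  by rewrite -intrN e2Dint et subrr nc0 expr0n.
rewrite nc_e2B1_sqr => /eqP.
rewrite mulf_eq0 pnatr_eq0 /= sqrf_eq0.
have /gt_eqF -> // : 0 < sin (pi * (t - (Num.floor t)%:~R)).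
apply: sin_gt0_pi; rewrite mulr_gt0 ?pi_gt0 //=.
by rewrite gtr_pMr ?pi_gt0.
Qed.

Lemma nc_1De2_sqr t : nc (1 + e2 t) ^+ 2 = 4 * cos (pi * t) ^+ 2.
Proof.
rewrite nc_sqr /e2 ReD ImD /= -mulrA add0r.
have := cos2Dsin2 (2 * (pi * t)).
have : cos (2 * (pi * t)) = 2 * cos (pi * t) ^+ 2 - 1.
  by rewrite mulr_natl cos_mulr2n; ring.
set c := cos (2 * _); set s := sin (2 * _); set s' := cos _ => -> /esym.
nra.
Qed.

Lemma nc_1De2_lt2 (d : R) : 0 < d -> exists2 d' : R, 0 < d' &
  forall t, (forall k : int, d <= `|t - k%:~R|) -> nc (1 + e2 t) <= 2 - d'.
Proof.
(* Since |1 + e(t)| = 2 |cos(pi t)| and t can be moved into [-1/2, 1/2), capping [d] at 1/2 keeps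
   all angles in the range where cos decreases and is nonnegative. *)
move=> d0; pose d1 := Num.min d (1/2).
have [d10 d11 d1d] : [/\ 0 < d1, d1 <= 1/2 & d1 <= d].
  split; first by rewrite lt_min d0 /=; lra.
    by rewrite ge_min lexx orbT.
  by rewrite ge_min lexx.
have pi0 := pi_gt0 R.
exists (2 - 2 * cos (pi * d1)).
  rewrite subr_gt0 -[ltRHS]mulr1 ltr_pM2l // -cos0 ltr_cos ?mulr_gt0 //.
    by rewrite in_itv /= lexx pi_ge0.
  rewrite in_itv /= mulr_ge0 ?pi_ge0 ?(ltW d10) //=.
  by rewrite ger_pMr //; lra.
move=> t ht; pose f := Num.floor (t + 1/2); pose s := t - f%:~R.
have /andP[h0 h1] : - (1/2) <= s < 1/2.
  by rewrite /s /f; have := floor_itv (t + 1/2); rewrite intrD /=; lra.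
have -> : e2 t = e2 s by rewrite /s -intrN e2Dint.
have hs : d1 <= `|s| by rewrite (le_trans d1d) // ht.
have hs2 : `|s| <= 1/2 by rewrite ler_norml h0 ltW.
have cs : cos (pi * s) = cos (pi * `|s|).
  by rewrite -cos_norm normrM (ger0_norm (ltW pi0)).
have c0 : 0 <= cos (pi * `|s|).
  by apply: cos_ge0_pihalf; have := normr_ge0 s; nra.
have ccd : cos (pi * `|s|) <= cos (pi * d1).
  rewrite leNgt ltr_cos ?in_itv /=.
  - by rewrite -leNgt ler_pM2l.
  - by rewrite mulr_ge0 ?(ltW pi0) //= ger_pMr //; lra.
  - by rewrite mulr_ge0 ?(ltW pi0) ?(ltW d10) //= ger_pMr //; lra.
have cd0 := le_trans c0 ccd.
have -> : 2 - (2 - 2 * cos (pi * d1)) = 2 * cos (pi * d1) :> R by ring.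
rewrite -(@ler_pXn2r _ 2) ?nnegrE ?nc_ge0 //; last by rewrite mulr_ge0.
rewrite nc_1De2_sqr cs; nra.
Qed.

Lemma cos_ge_half t : `|t| <= 1/8 -> 1/2 <= complex.Re (e2 t).
Proof.
move=> ht /=; have pi0 := pi_gt0 R.
have h1 : 0 <= cos (2 * (2 * pi * t)).
  apply: cos_ge0_pihalf; move: ht; rewrite ler_norml => /andP[? ?]; nra.
have h2 : 0 <= cos (2 * pi * t).
  apply: cos_ge0_pihalf; move: ht; rewrite ler_norml => /andP[? ?]; nra.
have : cos (2 * (2 * pi * t)) = 2 * cos (2 * pi * t) ^+ 2 - 1.
  by rewrite mulr_natl cos_mulr2n; ring.
move: h1 h2; set c := cos (2 * pi * t) => h1 h2 E; nra.
Qed.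

End complex_modulus.

(** * Convergence of normalised additive functions of tiles *)

Section geometric.
Variable R : realType.

Lemma bernoulli_lower (y : R) k : 0 <= y <= 1 -> 1 - k%:R * y <= (1 - y) ^+ k.
Proof.
move=> /andP[y0 y1]; elim: k => [|k IH]; first by rewrite expr0 mul0r subr0.
rewrite exprS -natr1; have := ler0n R k => k0.
have : (1 - y) * (1 - k%:R * y) <= (1 - y) * (1 - y) ^+ k.
  by rewrite ler_wpM2l // subr_ge0.
by apply: le_trans; nra.
Qed.

(** By Bernoulli's inequality the rate 1 - kappa/(2m) loses at most kappa/2 over m steps. The other
    half of kappa absorbs the inhomogeneous term, and the constant also dominates the m initial
    values. *)
Lemma geom_recurrence (x : nat -> R) m (kappa C rho : R) :
  (0 < m)%N -> 0 < kappa <= 1 -> 0 <= rho < 1 -> (forall k, 0 <= x k) ->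
  (forall k, x (k + m)%N <= (1 - kappa) * x k + C * rho ^+ k) ->
  exists C' rho', [/\ 0 <= C', 0 < rho' < 1 & forall k, x k <= C' * rho' ^+ k].
Proof.
move=> m0 /andP[k0 k1] /andP[r0 r1] x0 hx.
have m0R : 0 < m%:R :> R by rewrite ltr0n.
pose y := kappa / (2 * m%:R).
have m1R : 1 <= m%:R :> R by rewrite ler1n.
have y0 : 0 < y by rewrite divr_gt0 ?mulr_gt0.
have y1 : y < 1 by rewrite ltr_pdivrMr ?mulr_gt0 //; lra.
pose rho' := Num.max rho (1 - y).
have rr : rho <= rho' by rewrite le_max lexx.
have ry : 1 - y <= rho' by rewrite le_max lexx orbT.
have r'0 : 0 < rho' by lra.
have r'1 : rho' < 1 by rewrite gt_max r1; lra.
have hm : 1 - kappa / 2 <= rho' ^+ m.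
  have -> : kappa / 2 = m%:R * y by rewrite /y; field; rewrite gt_eqF.
  apply: (le_trans (@bernoulli_lower y m _)); first by rewrite !ltW.
  by rewrite lerXn2r // ?nnegrE; lra.
pose C' := \sum_(k < m) x k / rho' ^+ k + 2 * `|C| / kappa.
have S0 : 0 <= \sum_(k < m) x k / rho' ^+ k.
  by apply: sumr_ge0 => k _; rewrite divr_ge0 // exprn_ge0 // ltW.
have T0 : 0 <= 2 * `|C| / kappa by rewrite divr_ge0 ?mulr_ge0 // ltW.
have C'0 : 0 <= C' by rewrite addr_ge0.
exists C', rho'; rewrite r'0 r'1; split=> //.
elim/ltn_ind => k IH; case: (ltnP k m) => km.
  rewrite -ler_pdivrMr ?exprn_gt0 //.
  rewrite /C' (bigD1 (Ordinal km)) //= -addrA lerDl addr_ge0 //.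
  by apply: sumr_ge0 => j _; rewrite divr_ge0 // exprn_ge0 // ltW.
rewrite -(subnK km); set j := (k - m)%N.
have jk : (j < k)%N by rewrite ltn_subrL m0 (leq_trans m0 km).
apply: le_trans (hx j) _; rewrite exprD.
have h1 := IH j jk.
have P0 : 0 <= rho' ^+ j by rewrite exprn_ge0 // ltW.
have h2 : C * rho ^+ j <= kappa / 2 * C' * rho' ^+ j.
  apply: (@le_trans _ _ (`|C| * rho' ^+ j)).
    apply: (@le_trans _ _ (`|C| * rho ^+ j)).
      by rewrite ler_wpM2r ?exprn_ge0 // ler_norm.
    by rewrite ler_wpM2l // lerXn2r // nnegrE // ltW.
  rewrite ler_wpM2r //.
  have -> : `|C| = kappa / 2 * (2 * `|C| / kappa) by field; rewrite gt_eqF.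
  by rewrite ler_wpM2l ?divr_ge0 ?(ltW k0) // lerDr.
have h3 : (1 - kappa) * x j <= (1 - kappa) * (C' * rho' ^+ j).
  by rewrite ler_wpM2l // subr_ge0.
have h4 : (1 - kappa / 2) * (C' * rho' ^+ j) <= rho' ^+ m * (C' * rho' ^+ j).
  by rewrite ler_wpM2r // mulr_ge0.
lra.
Qed.

Lemma sumr_mem_le (T : eqType) (s : seq T) (F : T -> R) a :
  a \in s -> (forall b, 0 <= F b) -> F a <= \sum_(b <- s) F b.
Proof.
move=> + F0; elim: s => // b s IH; rewrite inE big_cons => /predU1P[->|/IH h].
  by rewrite lerDl sumr_ge0.
by rewrite (le_trans h) // lerDr.
Qed.

End geometric.

Section contraction.
Variables (R : realType) (n : nat) (zeta : 'I_n.+1 -> seq 'I_n.+1).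
Local Notation letter := 'I_n.+1.
Local Notation inflate := (inflate zeta).
Local Notation len := (len zeta).

Lemma sum_inflate (M : nmodType) (F : letter -> M) k u :
  \sum_(d <- inflate k u) F d = \sum_(c <- u) \sum_(d <- inflate k [:: c]) F d.
Proof.
elim: u => [|a u IH]; first by rewrite inflate_nil !big_nil.
by rewrite inflate_cons big_cat big_cons IH.
Qed.

Lemma lenS_R k b : (len k.+1 b)%:R = \sum_(c <- zeta b) (len k c)%:R :> R.
Proof. by rewrite lenS natr_sum. Qed.

Hypothesis hsubst : is_substitution zeta.
Variable m : nat.
Hypothesis mP : forall a b, a \in inflate m [:: b].
Hypothesis hd : (2 <= n.+1)%N.

Lemma m_gt0 : (0 < m)%N.
Proof.
have := len_m_ge2 mP hd ord0; case: m => //; by rewrite len0.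
Qed.

(** Up to a geometric error, the ratio [V / len] of a tile is the average of the ratios of its
    subtiles, weighted by length. Over [m] levels all letters enter with weights bounded below, so
    the oscillation over the letters contracts, and the ratios tend to a common limit at a geometric
    rate. *)
Lemma ratio_converges (V : nat -> letter -> R) (C rho : R) :
  0 <= C -> 0 <= rho < 1 ->
  (forall k b, `|V k.+1 b - \sum_(c <- zeta b) V k c|
     <= C * rho ^+ k * (len k.+1 b)%:R) ->
  exists c C' rho', [/\ 0 <= C', 0 < rho' < 1 &
    forall k b, `|V k b - c * (len k b)%:R| <= C' * rho' ^+ k * (len k b)%:R].
Proof.
move=> C0 /andP[r0 r1] hV.
have L0 k b : 0 < (len k b)%:R :> R by rewrite ltr0n len_gt0.
have rk0 k : 0 <= rho ^+ k by rewrite exprn_ge0.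
have Ck0 k : 0 <= C * rho ^+ k by rewrite mulr_ge0.
have step i k b : `|V (k + i)%N b - \sum_(c <- inflate i [:: b]) V k c|
    <= i%:R * (C * rho ^+ k) * (len (k + i) b)%:R.
  elim: i b => [|i IH] b.
    by rewrite addn0 big_seq1 subrr normr0 !mul0r.
  rewrite inflateSr sum_inflate addnS.
  rewrite -[X in `|X|](subrKA (\sum_(c <- zeta b) V (k + i)%N c)).
  apply: le_trans (ler_normD _ _) _.
  rewrite -natr1 mulrDl mulrDl mul1r addrC lerD //; last first.
    apply: le_trans (hV _ _) _; rewrite ler_wpM2r // ler_wpM2l //.
    by rewrite exprD ler_piMr // exprn_ile1 // ltW.
  rewrite -sumrB (le_trans (ler_norm_sum _ _ _)) // lenS_R mulr_sumr.
  by apply: ler_sum => c _; exact: IH.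
pose r k b := V k b / (len k b)%:R.
have Vr k b : V k b = r k b * (len k b)%:R by rewrite /r divfK ?gt_eqF.
have /choice[p hp] : forall k, exists a, forall b, r k b <= r k a.
  move=> k; have [a _ ha] := @arg_maxP _ _ letter ord0 xpredT (r k) isT.
  by exists a => b; exact: ha.
have /choice[q hq] : forall k, exists a, forall b, r k a <= r k b.
  move=> k; have [a _ ha] := @arg_minP _ _ letter ord0 xpredT (r k) isT.
  by exists a => b; exact: ha.
pose hi k := r k (p k); pose lo k := r k (q k).
have lohi k : lo k <= hi k by exact: hp.
have up k b : r k.+1 b <= hi k + C * rho ^+ k.
  rewrite ler_pdivrMr // mulrDl.
  have := hV k b; rewrite ler_norml => /andP[_]; rewrite lerBlDr => h.
  rewrite (le_trans h) // addrC lerD2r lenS_R mulr_sumr.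
  by apply: ler_sum => c _; rewrite Vr ler_wpM2r //; exact: hp.
have dn k b : lo k - C * rho ^+ k <= r k.+1 b.
  rewrite ler_pdivlMr // mulrBl.
  have := hV k b; rewrite ler_norml => /andP[+ _]; rewrite lerBrDr => h.
  rewrite (le_trans _ h) // addrC lerD2l lenS_R mulr_sumr.
  by apply: ler_sum => c _; rewrite Vr ler_wpM2r //; exact: hq.
pose K : R := (maxlen zeta m)%:R.
have K1 : 1 <= K by rewrite ler1n maxlen_gt0.
have K0 : 0 < K by lra.
(* Every tile of level k + m contains the tile of level k with the least ratio, which takes up at
   least 1/K^2 of its length: one factor K for the passage over m levels, one for comparing
   letters. *)
have upm k b : r (k + m)%N b <= hi k - (hi k - lo k) / K ^+ 2 + m%:R * (C * rho ^+ k).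
  rewrite ler_pdivrMr // mulrDl.
  have := step m k b; rewrite ler_norml => /andP[_]; rewrite lerBlDr => h.
  rewrite (le_trans h) // addrC lerD2r.
  have E : (len (k + m) b)%:R = \sum_(c <- inflate m [:: b]) (len k c)%:R :> R.
    by rewrite lenD natr_sum.
  have h1 : (hi k - lo k) * (len k (q k))%:R <=
      \sum_(c <- inflate m [:: b]) (hi k * (len k c)%:R - V k c).
    have -> : (hi k - lo k) * (len k (q k))%:R = hi k * (len k (q k))%:R - V k (q k).
      by rewrite Vr mulrBl.
    apply: (sumr_mem_le (mP (q k) b)) => c.
    by rewrite Vr -mulrBl mulr_ge0 // subr_ge0; exact: hp.
  rewrite sumrB -mulr_sumr -E in h1.
  have h2 : (hi k - lo k) / K ^+ 2 * (len (k + m) b)%:R <= (hi k - lo k) * (len k (q k))%:R.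
    rewrite -mulrA ler_wpM2l ?subr_ge0 // ler_pdivrMl ?exprn_gt0 //.
    rewrite -natrX -natrM ler_nat expnS expn1.
    apply: leq_trans (maxlen_ge zeta (k + m) b) _.
    apply: leq_trans (maxlenD _ k m) _.
    by rewrite mulnC -mulnA leq_mul // maxlen_comparable.
  lra.
have dnm k b : lo k - m%:R * (C * rho ^+ k) <= r (k + m)%N b.
  rewrite ler_pdivlMr // mulrBl.
  have := step m k b; rewrite ler_norml => /andP[+ _]; rewrite lerBrDr => h.
  rewrite (le_trans _ h) // addrC lerD2l lenD natr_sum mulr_sumr.
  by apply: ler_sum => c _; rewrite Vr ler_wpM2r //; exact: hq.
have [||||C1 [rho1 [C10 r1P hosc]]] :=
    @geom_recurrence R (fun k => hi k - lo k) m (K ^- 2) (2 * m%:R * C) rho m_gt0.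
- by rewrite invr_gt0 exprn_gt0 //= invf_le1 ?exprn_gt0 // expr_ge1.
- by rewrite r0 r1.
- by move=> k; rewrite subr_ge0.
- move=> k; have := upm k (p (k + m)%N); have := dnm k (q (k + m)%N).
  rewrite -/(hi _) -/(lo _) => h1 h2; rewrite mulrBl mul1r.
  have -> : K ^- 2 * (hi k - lo k) = (hi k - lo k) / K ^+ 2 by rewrite mulrC.
  lra.
have r1' : 0 < 1 - rho by lra.
(* The tail of the error series: [lo - T] increases and [hi + T] decreases, so the limit can be
   taken to be the supremum of [lo - T]. *)
pose T k := C * rho ^+ k / (1 - rho).
have TS k : T k = C * rho ^+ k + T k.+1.
  by rewrite /T exprS; field; rewrite gt_eqF.
have T0 k : 0 <= T k by rewrite divr_ge0 // ltW.
have lomono j k : (j <= k)%N -> lo j - T j <= lo k - T k.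
  move=> jk; rewrite -(subnKC jk); elim: (k - j)%N => [|i IH]; first by rewrite addn0.
  rewrite addnS (le_trans IH) //.
  by have := dn (j + i)%N (q (j + i).+1); rewrite -/(lo _) (TS (j + i)%N); lra.
have himono j k : (j <= k)%N -> hi k + T k <= hi j + T j.
  move=> jk; rewrite -(subnKC jk); elim: (k - j)%N => [|i IH]; first by rewrite addn0.
  rewrite addnS (le_trans _ IH) //.
  by have := up (j + i)%N (p (j + i).+1); rewrite -/(hi _) (TS (j + i)%N); lra.
have lohi' j k : lo j - T j <= hi k + T k.
  apply: le_trans (lomono j (maxn j k) (leq_maxl _ _)) _.
  apply: le_trans (himono k (maxn j k) (leq_maxr _ _)).
  by have := lohi (maxn j k); have := T0 (maxn j k); lra.
pose A := [set lo k - T k | k in [set: nat]].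
have A0 : A !=set0 by exists (lo 0%N - T 0%N), 0%N.
have clo k : lo k - T k <= sup A.
  apply: ub_le_sup; last by exists k.
  by exists (hi 0%N + T 0%N) => _ [j _ <-].
have chi k : sup A <= hi k + T k.
  by apply: ge_sup => // _ [j _ <-].
pose rho2 := Num.max rho rho1.
have rr : rho <= rho2 by rewrite le_max lexx.
have rr1 : rho1 <= rho2 by rewrite le_max lexx orbT.
case/andP: r1P => r10 r11.
exists (sup A), (C1 + 2 * C / (1 - rho)), rho2; split.
- by rewrite addr_ge0 // divr_ge0 ?mulr_ge0 // ltW.
- by rewrite (lt_le_trans r10) //= gt_max r1.
move=> k b; rewrite Vr -mulrBl normrM (ger0_norm (ltW (L0 k b))) ler_wpM2r //.
apply: (@le_trans _ _ (hi k - lo k + 2 * T k)).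
  have h1 := clo k; have h2 := chi k; have h3 := T0 k.
  have h4 : r k b <= hi k by exact: hp.
  have h5 : lo k <= r k b by exact: hq.
  by rewrite ler_norml; apply/andP; split; lra.
rewrite [leRHS]mulrDl lerD //.
  apply: le_trans (hosc k) _; rewrite ler_wpM2l // lerXn2r // nnegrE ltW //.
  by rewrite (lt_le_trans r10).
rewrite /T [X in X <= _](_ : _ = 2 * C / (1 - rho) * rho ^+ k); last by ring.
rewrite ler_wpM2l ?divr_ge0 ?mulr_ge0 ?(ltW r1') // lerXn2r // nnegrE //.
by rewrite (le_trans r0).
Qed.

End contraction.

(** * Phases and twisted means *)

Section exponential_decay.
Variable R : realType.
Implicit Types f g : nat -> R.

(** The rate is existential, as rates for finitely many letters or words can be merged. It is
    positive so that finitely many initial values can be absorbed by dividing by its powers. *)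
Definition exp_small f := exists C rho : R,
  [/\ 0 <= C, 0 < rho < 1 & forall k, f k <= C * rho ^+ k].

Lemma exp_smallD f g : exp_small f -> exp_small g ->
  exp_small (fun k => f k + g k).
Proof.
move=> [C [r [C0 /andP[r0 r1] hf]]] [D [s [D0 /andP[s0 s1] hg]]].
exists (C + D), (Num.max r s); split; first by rewrite addr_ge0.
  by rewrite lt_max r0 gt_max r1.
move=> k; rewrite mulrDl lerD //.
  apply: le_trans (hf k) _; apply: ler_wpM2l => //.
  by apply: lerXn2r; rewrite ?nnegrE ?le_max ?lexx ?(ltW r0).
apply: le_trans (hg k) _; apply: ler_wpM2l => //.
by apply: lerXn2r; rewrite ?nnegrE ?le_max ?lexx ?(ltW r0) ?(ltW s0) ?orbT.
Qed.

Lemma exp_smallM (C : R) f : 0 <= C -> exp_small f ->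
  exp_small (fun k => C * f k).
Proof.
move=> C0 [D [r [D0 rP h]]]; exists (C * D), r; split=> //.
  by rewrite mulr_ge0.
by move=> k; rewrite -mulrA ler_wpM2l.
Qed.

Lemma exp_small_geom (C r : R) : 0 <= C -> 0 < r < 1 ->
  exp_small (fun k => C * r ^+ k).
Proof. by move=> C0 rP; exists C, r. Qed.

Lemma geom_dominate (C D r s : R) :
  0 <= C -> 0 <= D -> 0 < r < 1 -> 0 < s < 1 ->
  exists E t, [/\ 0 <= E, 0 < t < 1, forall k, C * r ^+ k <= E * t ^+ k &
    forall k, D * s ^+ k <= E * t ^+ k].
Proof.
move=> C0 D0 rP sP; have [E [t [E0 tP h]]] :=
  exp_smallD (exp_small_geom C0 rP) (exp_small_geom D0 sP).
exists E, t; split=> // k; apply: le_trans (h k).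
  by rewrite lerDl mulr_ge0 // exprn_ge0 //; case/andP: sP => /ltW.
by rewrite lerDr mulr_ge0 // exprn_ge0 //; case/andP: rP => /ltW.
Qed.

Lemma exp_small_seq (I : eqType) (r : seq I) (F : I -> nat -> R) :
  (forall i, exp_small (F i)) -> exists C rho : R,
  [/\ 0 <= C, 0 < rho < 1 & forall i, i \in r -> forall k, F i k <= C * rho ^+ k].
Proof.
move=> hF; elim: r => [|i r [C [rho [C0 rP IH]]]].
  by exists 0, (1/2); split=> //; lra.
have [D [s [D0 sP hD]]] := hF i.
have [E [t [E0 tP h1 h2]]] := geom_dominate C0 D0 rP sP.
exists E, t; split=> // j; rewrite inE => /predU1P[->|/IH h] k.
  exact: le_trans (hD k) (h2 k).
exact: le_trans (h k) (h1 k).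
Qed.

Lemma exp_small_lt f (e : R) : exp_small f -> 0 < e ->
  exists K, forall k, (K <= k)%N -> f k < e.
Proof.
move=> [C [r [C0 /andP[r0 r1] h]]] e0.
have r1n : `|r| < 1 by rewrite gtr0_norm.
have /cvgrPdist_lt/(_ (e / (C + 1))) : (fun k => r ^+ k) @ \oo --> (0 : R).
  exact: cvg_expr.
have C1 : 0 < C + 1 by rewrite ltr_wpDl.
case; first by rewrite divr_gt0.
move=> K _ hK; exists K => k Kk; apply: le_lt_trans (h k) _.
have := hK k Kk; rewrite /= sub0r normrN gtr0_norm ?exprn_gt0 //.
rewrite ltr_pdivlMr // => hk; apply: le_lt_trans hk.
by rewrite mulrC ler_wpM2l ?exprn_ge0 ?(ltW r0) // lerDl.
Qed.

End exponential_decay.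

Section locate.
Variables (n : nat) (zeta : 'I_n.+1 -> seq 'I_n.+1).

Lemma locate k w q : (q < size (inflate zeta k w))%N -> exists w1 g w2 r,
  [/\ w = w1 ++ g :: w2, (r < len zeta k g)%N,
      take q (inflate zeta k w) = inflate zeta k w1 ++ take r (inflate zeta k [:: g]) &
      drop q (inflate zeta k w) = drop r (inflate zeta k [:: g]) ++ inflate zeta k w2].
Proof.
elim: w q => [|a w IH] q; first by rewrite inflate_nil.
rewrite inflate_cons size_cat take_cat drop_cat -/(len _ _ _) => hq.
case: ifP => h.
  by exists [::], a, w, q; rewrite inflate_nil.
have [|w1 [g [w2 [r [-> hr -> ->]]]]] := IH (q - len zeta k a)%N.
  by move: h => /negbT; lia.
exists (a :: w1), g, w2, r; split=> //.
by rewrite (inflate_cons _ _ a w1) catA.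
Qed.

End locate.

Section phases.
Variables (R : realType) (n : nat) (zeta : 'I_n.+1 -> seq 'I_n.+1).
Local Notation letter := 'I_n.+1.
Local Notation inflate := (inflate zeta).
Local Notation len := (len zeta).
Local Notation legal := (legal zeta).
Local Notation maxlen := (maxlen zeta).
Hypothesis hsubst : is_substitution zeta.
Variable m : nat.
Hypothesis mP : forall a b, a \in inflate m [:: b].
Hypothesis hd : (2 <= n.+1)%N.

Lemma growth_rate : exp_small (fun k => \big[Num.max/0]_(b : letter) ((len k b)%:R^-1 : R)).
Proof.
have m0 := m_gt0 mP hd.
have m0R : 1 <= m%:R :> R by rewrite ler1n.
(* Lengths at least double every [m] levels, while [s ^+ m] is at least 1/2 by Bernoulli's
   inequality, so powers of [s] decay no faster than the inverse lengths. *)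
pose y : R := (2 * m%:R)^-1; pose s := 1 - y.
have y0 : 0 < y by rewrite invr_gt0; lra.
have y1 : y <= 1/2 by rewrite /y -[1/2]/(1 / 2) div1r lef_pV2 ?posrE; lra.
have sm : 1 / 2 <= s ^+ m.
  apply: le_trans (@bernoulli_lower R y m _); last by rewrite ltW //=; lra.
  by rewrite /y invfM mulrCA divff ?gt_eqF //; lra.
have s0 : 0 < s by rewrite /s; lra.
have s1 : s < 1 by rewrite /s; lra.
exists 2, s; split=> //; first by rewrite s0.
move=> k; apply: bigmax_le; first by rewrite mulr_ge0 // exprn_ge0 // ltW.
move=> b _.
rewrite -div1r ler_pdivrMr ?ltr0n ?len_gt0 //.
pose q := (k %/ m)%N.
have hq : (2 ^ q <= len k b)%N.
  apply: leq_trans (len_growth mP hd q b) _.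
  by apply: len_mono => //; exact: leq_divM.
apply: (@le_trans _ _ (2 * s ^+ k * (2 ^ q)%:R)); last first.
  by rewrite ler_wpM2l ?ler_nat // mulr_ge0 // exprn_ge0 // ltW.
have kle : (k <= q.+1 * m)%N by rewrite ltnW // ltn_ceil.
apply: (@le_trans _ _ (2 * s ^+ (q.+1 * m) * (2 ^ q)%:R)); last first.
  rewrite ler_wpM2r // ler_wpM2l // ler_wiXn2l //; first exact: ltW.
  exact: ltW.
rewrite mulnC exprM natrX mulrAC -exprS -exprMn exprn_ege1 //; lra.
Qed.

Lemma growth : exists sg : nat -> R, [/\ exp_small sg, forall k, 0 <= sg k &
  forall k u, (size u)%:R <= sg k * (size (inflate k u))%:R].
Proof.
exists (fun k => \big[Num.max/0]_(b : letter) (len k b)%:R^-1); split.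
- exact: growth_rate.
- by move=> k; rewrite bigmax_idl le_max lexx.
move=> k u; rewrite size_inflate natr_sum mulr_sumr -sum1_size natr_sum.
apply: ler_sum => b _; rewrite -ler_pdivrMr ?ltr0n ?len_gt0 // div1r.
exact: (le_bigmax_cond _ (fun b : letter => (len k b)%:R^-1 : R)).
Qed.

Variable alpha : R.
Local Notation ph k u := (e2 (- (alpha * (size (inflate k u))%:R))).
(** [y k b] is the phase at the left end of a tile of level [k] and type [b]. By [hy2], passing over
    a tile to its right neighbour multiplies the phase by the character of its length; by [hy3], a
    tile has the phase of its first subtile. Both hold up to geometric errors. *)
Variables (y : nat -> letter -> R[i]) (C rho : R).
Hypotheses (C0 : 0 <= C) (rP : 0 < rho < 1).
Hypothesis hy1 : forall k b, nc (y k b) = 1.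
Hypothesis hy2 : forall k b b', legal [:: b; b'] ->
  nc (ph k [:: b] * y k b - y k b') <= C * rho ^+ k.
Hypothesis hy3 : forall k b, nc (y k.+1 b - y k (head b (zeta b))) <= C * rho ^+ k.

Lemma ph_cat k u v : ph k (u ++ v) = ph k u * ph k v.
Proof. by rewrite inflate_cat size_cat natrD mulrDr opprD e2D. Qed.

Lemma phase_path k u b : legal (u ++ [:: b]) ->
  nc (ph k u * y k (head b u) - y k b) <= (size u)%:R * (C * rho ^+ k).
Proof.
elim: u => [|a u IH] h.
  by rewrite inflate_nil /= mulr0 oppr0 e2_0 mul1r subrr nc0 mul0r.
rewrite -cat1s ph_cat /= -natr1 mulrDl mul1r.
have h2 : legal [:: a; head b u].
  apply: legal_infix h; case: u {IH} => [|c u]; first exact: infix_refl.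
  exact: (prefix_infix [:: a; c]).
have h1 : legal (u ++ [:: b]).
  by apply: legal_infix h; exact: (infix_cons (u ++ [:: b]) a).
apply: le_trans (_ : _ <= nc (ph k u * (ph k [:: a] * y k a - y k (head b u)))
   + nc (ph k u * y k (head b u) - y k b)) _.
  apply: le_trans (ncD _ _); rewrite le_eqVlt; apply/orP; left; apply/eqP.
  by congr nc; ring.
by rewrite ncM nc_e2 mul1r addrC lerD // ?IH // hy2.
Qed.

(** The sum over all levels l >= k of C rho^l (1 + [maxlen 1]): one use of [hy3] and at most
    [maxlen 1] uses of [hy2] on each level. *)
Definition phase_err k : R := C * (1 + (maxlen 1)%:R) / (1 - rho) * rho ^+ k.

Lemma phase_err_ge0 k : 0 <= phase_err k.
Proof.
case/andP: rP => r0 r1; have r1' : 0 <= 1 - rho by rewrite subr_ge0 ltW.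
by rewrite mulr_ge0 ?exprn_ge0 ?(ltW r0) // divr_ge0 // mulr_ge0 // addr_ge0.
Qed.

Lemma phase_errS k : phase_err k.+1 + C * rho ^+ k * (1 + (maxlen 1)%:R) = phase_err k.
Proof.
rewrite /phase_err exprS; field; rewrite gt_eqF // subr_gt0; by case/andP: rP.
Qed.

(** The tile [g] is reached through its ancestors, not along the word [w1]: on each level one goes
    to the first child and then to the right past a bounded number of siblings. The errors sum over
    the levels, so the bound is independent of [p] and of the size of [w1]. *)
Lemma phase_root p k a w1 g w2 : inflate p [:: a] = w1 ++ g :: w2 ->
  nc (ph k w1 * y (k + p) a - y k g) <= phase_err k.
Proof.
elim: p k w1 g w2 => [|p IH] k w1 g w2 E.
  have E' : inflate 0 [:: a] = [:: a] by [].
  rewrite E' in E; case: w1 E => [[<-] _|b [|] //].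
  rewrite inflate_nil /= mulr0 oppr0 e2_0 mul1r addn0 subrr nc0; exact: phase_err_ge0.
have E2 : inflate p.+1 [:: a] = inflate 1 (inflate p [:: a]) by [].
rewrite E2 in E.
have /locate : (size w1 < size (inflate 1 (inflate p [:: a])))%N.
  by rewrite E size_cat /=; lia.
rewrite E take_size_cat // drop_size_cat //.
move=> [v1 [h [v2 [r [Ev hr Et Ed]]]]].
have zh : inflate 1 [:: h] = zeta h by exact: subst_word1.
rewrite zh in Et Ed; rewrite /len zh in hr.
have [d Edr] : exists d, drop r (zeta h) = g :: d.
  have : (0 < size (drop r (zeta h)))%N by rewrite size_drop subn_gt0.
  by case: (drop r _) Ed => // c d [-> _] _; exists d.
have Ez : zeta h = take r (zeta h) ++ g :: d by rewrite -Edr cat_take_drop.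
have lg : legal (take r (zeta h) ++ [:: g]).
  exists 1%N, h; rewrite zh.
  have : infix (take r (zeta h) ++ [:: g]) (take r (zeta h) ++ g :: d).
    have -> : take r (zeta h) ++ g :: d = (take r (zeta h) ++ [:: g]) ++ d.
      by rewrite -catA.
    exact: prefix_infix.
  by rewrite -Ez.
have hh : head g (take r (zeta h)) = head h (zeta h).
  by rewrite [in RHS]Ez; case: (take r _).
set u := take r (zeta h) in Et lg hh.
have hp := phase_path k lg.
have su : (size u)%:R <= (maxlen 1)%:R :> R.
  rewrite ler_nat /u size_take hr (leq_trans (ltnW hr)) //.
  by rewrite -zh maxlen_ge.
have IHk := IH k.+1 _ _ _ Ev.
have Epv : ph k w1 = ph k.+1 v1 * ph k u.
  by rewrite Et ph_cat -inflateD addn1.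
rewrite Epv -phase_errS -addSnnS.
set Y := y (k.+1 + p) a in IHk *.
rewrite hh in hp.
apply: le_trans (_ : _ <= nc (ph k u * (ph k.+1 v1 * Y - y k.+1 h))
   + nc (ph k u * (y k.+1 h - y k (head h (zeta h))))
   + nc (ph k u * y k (head h (zeta h)) - y k g)) _.
  apply: le_trans (lerD (ncD _ _) (lexx _)); apply: le_trans (ncD _ _).
  rewrite le_eqVlt; apply/orP; left; apply/eqP; congr nc; ring.
rewrite !ncM !nc_e2 !mul1r -addrA lerD //.
rewrite mulrDr mulr1 lerD ?hy3 // (le_trans hp) // mulrC ler_wpM2l //.
by rewrite mulr_ge0 // exprn_ge0 //; case/andP: rP => /ltW.
Qed.

(** Both ends of [u] are compared with a common ancestor. In contrast to [phase_path], the error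
    does not grow with [u]. *)
Lemma phase_legal k u b : legal (u ++ [:: b]) ->
  nc (ph k u * y k (head b u) - y k b) <= 2 * phase_err k.
Proof.
case: u => [_|c u [p [a /infixP[P [Q E]]]]].
  rewrite inflate_nil /= mulr0 oppr0 e2_0 mul1r subrr nc0 mulr_ge0 //.
  exact: phase_err_ge0.
have h1 := phase_root k (E : _ = P ++ c :: (u ++ [:: b]) ++ Q).
have h2 : nc (ph k (P ++ c :: u) * y (k + p) a - y k b) <= phase_err k.
  by apply: phase_root; rewrite E -!catA.
rewrite ph_cat in h2.
set Y := y (k + p) a in h1 h2; rewrite [head _ _]/=.
apply: le_trans (_ : _ <= nc (ph k (c :: u) * (y k c - ph k P * Y))
   + nc (ph k P * ph k (c :: u) * Y - y k b)) _.
  apply: le_trans (ncD _ _); rewrite le_eqVlt; apply/orP; left; apply/eqP.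
  by congr nc; ring.
by rewrite ncM nc_e2 mul1r ncB mulr_natl mulr2n lerD.
Qed.

(** A twisted count that is additive along concatenation up to a bounded defect [w0]; the counts of
    occurrences of a fixed word are the intended instance. *)
Variables (Phi : seq letter -> R[i]) (w0 : R).
Hypothesis w0_ge0 : 0 <= w0.
Hypothesis Phi0 : Phi [::] = 0.
Hypothesis Phib : forall u, nc (Phi u) <= (size u)%:R.
Hypothesis PhiD : forall u v,
  nc (Phi (u ++ v) - (Phi u + e2 (- (alpha * (size u)%:R)) * Phi v)) <= w0.

Local Notation V k b := (y k b * Phi (inflate k [:: b])).

Lemma tile_sum k d u : legal u ->
  nc (y k (head d u) * Phi (inflate k u) - \sum_(c <- u) V k c)
    <= (size u)%:R * w0 + 2 * phase_err k * (size (inflate k u))%:R.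
Proof.
elim/last_ind: u => [_|u c IH].
  by rewrite inflate_nil Phi0 big_nil mulr0 subrr nc0 /= mul0r mulr0 addr0.
rewrite -cats1 => h.
have lu : legal u by apply: legal_infix h; exact: prefix_infix.
have := phase_legal k h.
have hE : head d (u ++ [:: c]) = head c u by case: (u).
rewrite hE big_cat big_seq1 /= inflate_cat !size_cat !natrD /= => hph.
set A := inflate k u in hph *; set B := inflate k [:: c].
have hPhi := PhiD A B.
have {}IH : nc (y k (head c u) * Phi A - \sum_(c0 <- u) V k c0)
    <= (size u)%:R * w0 + 2 * phase_err k * (size A)%:R.
  have := IH lu; case: (u) @A hph hPhi => [|//] A hph hPhi.
  by rewrite /A inflate_nil Phi0 !mulr0.
set p := e2 _ in hph hPhi.
apply: le_trans (_ : _ <= nc (y k (head c u) * Phi A - \sum_(c0 <- u) V k c0)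
  + (nc (y k (head c u) * (Phi (A ++ B) - (Phi A + p * Phi B)))
  + nc ((p * y k (head c u) - y k c) * Phi B))) _.
  apply: le_trans (lerD (lexx _) (ncD _ _)); apply: le_trans (ncD _ _).
  rewrite le_eqVlt; apply/orP; left; apply/eqP; congr nc; ring.
rewrite !ncM hy1 mul1r.
have hB : nc (p * y k (head c u) - y k c) * nc (Phi B) <= 2 * phase_err k * (size B)%:R.
  by rewrite ler_pM ?nc_ge0.
lra.
Qed.

(** Multiplied by the phase of the tile, [Phi] is additive over subtiles: the defect [w0] per
    subtile is small relative to the length, and the phases match up to a geometric error. Hence
    [ratio_converges] applies to the real and imaginary parts. *)
Lemma twisted_means : exists (c : R[i]) (h : nat -> R),
  [/\ exp_small h, forall k, 0 <= h k,
      forall k b, nc (V k b - c * (len k b)%:R) <= h k * (len k b)%:R &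
      forall k d u, legal u -> nc (y k (head d u) * Phi (inflate k u)
         - c * (size (inflate k u))%:R) <= h k * (size (inflate k u))%:R].
Proof.
have [sg [sgE sg0 hsg]] := growth.
have etaE : exp_small phase_err.
  apply: exp_small_geom rP; case/andP: rP => r0 r1.
  have r1' : 0 <= 1 - rho by rewrite subr_ge0 ltW.
  by rewrite divr_ge0 // mulr_ge0 // addr_ge0.
have r0 : 0 < rho by case/andP: rP.
pose err k := C * rho ^+ k + ((maxlen 1)%:R * w0 * sg k + 2 * phase_err k).
have [D [s [D0 sP herr]]] : exp_small err.
  apply: exp_smallD; first exact: exp_small_geom.
  by apply: exp_smallD; apply: exp_smallM; rewrite ?mulr_ge0.
have hV k b : nc (V k.+1 b - \sum_(c <- zeta b) V k c) <= D * s ^+ k * (len k.+1 b)%:R.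
  apply: (@le_trans _ _ (err k * (len k.+1 b)%:R)); last by rewrite ler_wpM2r.
  have lz : legal (zeta b) by exists 1%N, b; rewrite (subst_word1 zeta b : inflate 1 [:: b] = _) infix_refl.
  have := tile_sum k b lz; rewrite -inflateSr -/(len _ _) => ht.
  apply: le_trans (_ : _ <= nc ((y k.+1 b - y k (head b (zeta b))) * Phi (inflate k.+1 [:: b]))
    + nc (y k (head b (zeta b)) * Phi (inflate k.+1 [:: b]) - \sum_(c <- zeta b) V k c)) _.
    apply: le_trans (ncD _ _); rewrite le_eqVlt; apply/orP; left; apply/eqP.
    by congr nc; ring.
  rewrite [leRHS]mulrDl lerD //.
    by rewrite ncM ler_pM ?nc_ge0 ?hy3 // Phib.
  apply: le_trans ht _; rewrite [leRHS]mulrDl lerD2r -mulrA.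
  rewrite [_ * w0]mulrC -!mulrA [leRHS]mulrCA ler_wpM2l //.
  apply: (@le_trans _ _ (maxlen 1)%:R).
    rewrite ler_nat -(subst_word1 zeta b); exact: maxlen_ge.
  rewrite ler_peMr //; have := hsg k [:: b] => /le_trans; apply.
  rewrite ler_wpM2l // ler_nat; exact: len_mono.
have s01 : 0 <= s < 1 by case/andP: sP => /ltW -> ->.
have [|c1 [D1 [s1 [D10 s1P h1]]]] :=
    @ratio_converges R n zeta hsubst m mP hd (fun k b => complex.Re (V k b)) D s D0 s01.
  move=> k b; rewrite -Re_sum -ReB; exact: le_trans (Re_le_nc _) (hV k b).
have [|c2 [D2 [s2 [D20 s2P h2]]]] :=
    @ratio_converges R n zeta hsubst m mP hd (fun k b => complex.Im (V k b)) D s D0 s01.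
  move=> k b; rewrite -Im_sum -ImB; exact: le_trans (Im_le_nc _) (hV k b).
pose c : R[i] := c1 +i* c2.
pose h k := D1 * s1 ^+ k + D2 * s2 ^+ k.
have h0 k : 0 <= h k.
  case/andP: s1P => s10 _; case/andP: s2P => s20 _.
  by rewrite addr_ge0 // mulr_ge0 // exprn_ge0 // ltW.
have hE : exp_small h by apply: exp_smallD; exact: exp_small_geom.
have hVc k b : nc (V k b - c * (len k b)%:R) <= h k * (len k b)%:R.
  apply: le_trans (nc_le_ReIm _) _; rewrite mulrDl.
  have -> : ((len k b)%:R : R[i]) = ((len k b)%:R : R)%:C by rewrite rmorph_nat.
  rewrite ReB ImB /= !mulr0 subr0 add0r lerD //.
exists c, (fun k => w0 * sg k + 2 * phase_err k + h k); split.
- apply: exp_smallD => //; apply: exp_smallD; exact: exp_smallM.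
- by move=> k; rewrite addr_ge0 // addr_ge0 // mulr_ge0 // phase_err_ge0.
- move=> k b; apply: le_trans (hVc k b) _; rewrite ler_wpM2r // lerDr addr_ge0 // mulr_ge0 //.
  exact: phase_err_ge0.
move=> k d u lu; have ht := tile_sum k d lu.
apply: le_trans (_ : _ <= nc (y k (head d u) * Phi (inflate k u) - \sum_(c <- u) V k c)
   + nc (\sum_(c <- u) V k c - c * (size (inflate k u))%:R)) _.
  exact: ncT.
rewrite [leRHS]mulrDl lerD //.
  apply: le_trans ht _; rewrite [leRHS]mulrDl lerD2r -mulrA mulrC ler_wpM2l //.
rewrite size_inflate !natr_sum !mulr_sumr -sumrB (le_trans (nc_sum _ _ _)) //.
by apply: ler_sum => b _; exact: hVc.
Qed.

(** [Q] is fixed by the parse of [w] into tiles of level [k], being determined by the initial piece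
    and the phase of the first full tile. It serves all prefixes of [w] at once, which is what makes
    the averages along a point a Cauchy sequence. *)
Lemma phase_window (c : R[i]) (h : nat -> R) k w :
  (forall d u, legal u -> nc (y k (head d u) * Phi (inflate k u)
         - c * (size (inflate k u))%:R) <= h k * (size (inflate k u))%:R) ->
  0 <= h k -> legal w ->
  exists Q : R[i], nc Q = 1 /\ forall N, (maxlen k <= N <= size w)%N ->
    nc (Phi (take N w) - Q * c * N%:R) <= h k * N%:R + 2 * (w0 + (maxlen k)%:R * (1 + nc c)).
Proof.
move=> hc hk0 /(legal_parse hsubst k)[s [v [ws ss lv]]].
have ny d : nc ((y k (head d v))^*%C) = 1 by rewrite nc_conj hy1.
pose d : letter := ord0.
pose es := e2 (- (alpha * (size s)%:R)).
exists (es * (y k (head d v))^*%C); split.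
  by rewrite ncM nc_e2 ny mulr1.
move=> N /andP[kN Nw].
have sN : (size s <= N)%N by exact: leq_trans kN.
have EN : take N w = s ++ take (N - size s) (inflate k v).
  move: ws => /prefixP[t Et].
  have : take N (s ++ inflate k v) = take N w.
    by rewrite Et take_cat ltn_neqAle Nw andbT; case: eqP => //= ->; rewrite subnn take0 cats0 take_size.
  by move=> <-; rewrite take_cat ltnNge sN.
have [j [t [Et st]]] := take_inflate zeta k v (N - size s).
rewrite Et in EN; set v' := take j v in EN *.
have sz : N = (size s + (size (inflate k v') + size t))%N.
  by rewrite -!size_cat -EN size_takel.
rewrite EN; set A := inflate k v' in EN sz *.
have h1 := PhiD s (A ++ t); have h2 := PhiD A t; rewrite -/es in h1.
set ea := e2 _ in h2.
have lv' : legal v'.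
  by apply: legal_infix lv; exact: infix_take.
have h3 : nc (y k (head d v) * Phi A - c * (size A)%:R) <= h k * (size A)%:R.
  have := hc d v' lv'; rewrite -/A; case Ev' : v' => [|b v''].
    by rewrite /A Ev' inflate_nil Phi0 !mulr0.
  by rewrite /v' in Ev'; case: (v) (j) Ev' => [|? ?] [|?] //= [<- _].
have {}h3 : nc (Phi A - (y k (head d v))^*%C * c * (size A)%:R) <= h k * (size A)%:R.
  rewrite (_ : _ - _ = (y k (head d v))^*%C * (y k (head d v) * Phi A - c * (size A)%:R)).
    by rewrite ncM ny mul1r.
  have := conj_mul_nc (y k (head d v)); rewrite hy1 expr1n => E.
  by rewrite mulrBr !mulrA [_^*%C * y _ _]mulrC E mul1r.
set q := (y k (head d v))^*%C in h3 *.
have nq : nc q = 1 by rewrite nc_conj hy1.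
have E : Phi (s ++ A ++ t) - es * q * c * N%:R =
    Phi (s ++ A ++ t) - (Phi s + es * Phi (A ++ t))
  + (es * (Phi (A ++ t) - (Phi A + ea * Phi t)) + (es * (Phi A - q * c * (size A)%:R)
  + (Phi s + (es * ea * Phi t + es * q * c * ((size A)%:R - N%:R))))) by ring.
have {E} : nc (Phi (s ++ A ++ t) - es * q * c * N%:R) <=
    nc (Phi (s ++ A ++ t) - (Phi s + es * Phi (A ++ t)))
  + (nc (es * (Phi (A ++ t) - (Phi A + ea * Phi t))) + (nc (es * (Phi A - q * c * (size A)%:R))
  + (nc (Phi s) + (nc (es * ea * Phi t) + nc (es * q * c * ((size A)%:R - N%:R)))))).
  by rewrite E; do 4 (apply: le_trans (ncD _ _) _; rewrite lerD2l); exact: ncD.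
move=> /le_trans; apply.
rewrite !ncM !nc_e2 nq !mul1r.
have -> : nc ((size A)%:R - N%:R) = (size s)%:R + (size t)%:R :> R.
  rewrite -ncN opprB.
  have -> : N%:R - (size A)%:R = (size s + size t)%:R :> R[i].
    by rewrite [in LHS]sz !natrD; ring.
  by rewrite nc_nat natrD.
have AN : (size A)%:R <= N%:R :> R by rewrite ler_nat sz; lia.
have hA : h k * (size A)%:R <= h k * N%:R by rewrite ler_wpM2l.
have hs : (size s)%:R <= (maxlen k)%:R :> R by rewrite ler_nat.
have ht : (size t)%:R <= (maxlen k)%:R :> R by rewrite ler_nat.
have := Phib s; have := Phib t; have c0 := nc_ge0 c.
have : nc c * ((size s)%:R + (size t)%:R) <= nc c * ((maxlen k)%:R + (maxlen k)%:R).
  by rewrite ler_wpM2l // lerD.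
lra.
Qed.

End phases.

(** * Return words and quasi-periods *)

(** The value 1 on the first [k0] levels is the trivial bound for the distance of a real number to
    its floor. *)
Lemma exp_small_shift (R : realType) (eps : nat -> R) k0 : exp_small eps ->
  exp_small (fun k => if (k < k0)%N then 1 else eps (k - k0)%N).
Proof.
move=> [C [rho [C0 /andP[r0 r1] h]]].
have rk k : 0 < rho ^+ k by rewrite exprn_gt0.
exists ((C + 1) / rho ^+ k0), rho; split; rewrite ?r0 //.
  by rewrite divr_ge0 ?addr_ge0 // ltW.
move=> k; case: ltnP => hk.
  rewrite mulrAC ler_pdivlMr // mul1r.
  apply: (@le_trans _ _ (rho ^+ k)); last by rewrite ler_peMl ?lerDr // ltW.
  by rewrite ler_wiXn2l ?(ltW r0) ?(ltW r1) ?(ltnW hk).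
rewrite mulrAC ler_pdivlMr //.
apply: (@le_trans _ _ (C * rho ^+ k)); last by rewrite ler_wpM2r ?lerDl // ltW.
by rewrite -{2}(subnK hk) exprD mulrA ler_wpM2r // ltW.
Qed.

Section cycles.
Variables (R : realType) (n : nat) (zeta : 'I_n.+1 -> seq 'I_n.+1).
Local Notation letter := 'I_n.+1.
Local Notation inflate := (inflate zeta).
Implicit Types (alpha : R) (x : seq letter).

(** The stretch of [x0] from one occurrence of a letter to any later occurrence of it, not only the
    next one. *)
Definition return_word (x0 : seq letter) v :=
  exists (c : letter) p v' q, v = c :: v' /\ x0 = p ++ (c :: v') ++ c :: q.

Definition quasi_period x0 alpha := forall v, return_word x0 v ->
  exists2 eps : nat -> R, exp_small eps &
    forall k, exists z : int, `|alpha * (size (inflate k v))%:R - z%:~R| <= eps k.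

Lemma quasi_period_mul x0 alpha (j : int) :
  quasi_period x0 alpha -> quasi_period x0 (j%:~R * alpha).
Proof.
move=> h v /h[eps epsE heps]; exists (fun k => `|j%:~R| * eps k).
  exact: exp_smallM.
move=> k; have [z hz] := heps k; exists (j * z); rewrite intrM -mulrA -mulrBr normrM.
by rewrite ler_wpM2l.
Qed.

Lemma quasi_period_shift x0 alpha k0 :
  (forall v, return_word x0 v -> exists2 eps : nat -> R, exp_small eps &
     forall k, exists z : int, `|alpha * (size (inflate (k0 + k) v))%:R - z%:~R| <= eps k) ->
  quasi_period x0 alpha.
Proof.
move=> h v /h[eps e0 he].
exists (fun k => if (k < k0)%N then 1 else eps (k - k0)%N); first exact: exp_small_shift.
move=> k; case: ltnP => hk.
  set x := alpha * _; exists (Num.floor x).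
  have := floor_itv x; rewrite intrD /= => /andP[h1 h2].
  by rewrite ger0_norm; lra.
by have [z] := he (k - k0)%N; rewrite subnKC // => hz; exists z.
Qed.

Lemma quasi_period_divisible x0 (q k0 : nat) : (0 < q)%N ->
  (forall l v, (k0 <= l)%N -> return_word x0 v -> (q %| size (inflate l v))%N) ->
  quasi_period x0 q%:R^-1.
Proof.
move=> q0 hq; have qR : q%:R != 0 :> R by rewrite pnatr_eq0 -lt0n.
apply: (quasi_period_shift (k0 := k0)) => v rv.
exists (fun k => 0 * (1 / 2) ^+ k); first by apply: exp_small_geom => //; lra.
move=> k; have /dvdnP[c ->] := hq _ v (leq_addr k k0) rv; exists c%:Z.
by rewrite natrM -pmulrn mulrCA mulVf // mulr1 subrr normr0 mul0r.
Qed.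

(** A finite list containing all return words, over which their individual rates can be made
    uniform. *)
Definition factors (x0 : seq letter) : seq (seq letter) :=
  [seq take l (drop i x0) | i <- iota 0 (size x0).+1, l <- iota 0 (size x0).+1].

Lemma return_word_factor x0 v : return_word x0 v -> v \in factors x0.
Proof.
move=> [c [p [v' [q [-> ->]]]]]; apply/allpairsP.
exists (size p, size (c :: v')); split.
- by rewrite mem_iota size_cat /=; lia.
- by rewrite mem_iota !size_cat /=; lia.
by rewrite drop_size_cat // take_size_cat.
Qed.

Lemma quasi_period_unif x0 alpha : quasi_period x0 alpha ->
  exists C rho : R, [/\ 0 <= C, 0 < rho < 1 & forall v, return_word x0 v ->
    forall k, exists z : int,
      `|alpha * (size (inflate k v))%:R - z%:~R| <= C * rho ^+ k].
Proof.
move=> h.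
have [C [rho [C0 rP hC]]] : exists C rho : R, [/\ 0 <= C, 0 < rho < 1 &
    forall v, v \in factors x0 -> return_word x0 v -> forall k,
      exists z : int, `|alpha * (size (inflate k v))%:R - z%:~R| <= C * rho ^+ k].
  elim: (factors x0) => [|w s [C [r [C0 rP IH]]]].
    by exists 0, (1/2); split=> //; lra.
  case: (pselect (return_word x0 w)) => hw; last first.
    exists C, r; split=> // v; rewrite inE => /predU1P[-> //|]; exact: IH.
  have [eps [D [t [D0 tP hD]]] heps] := h w hw.
  have [E [u [E0 uP h1 h2]]] := geom_dominate C0 D0 rP tP.
  exists E, u; split=> // v; rewrite inE => /predU1P[-> _ k|vs rv k].
    have [z hz] := heps k; exists z.
    exact: le_trans hz (le_trans (hD k) (h2 k)).
  have [z hz] := IH v vs rv k; exists z; exact: le_trans hz (h1 k).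
exists C, rho; split=> // v rv; apply: hC => //; exact: return_word_factor.
Qed.

End cycles.

(** This is why return words suffice: two prefixes of [x0] that stop in front of the same letter
    differ by a return word, so the phase or residue of a prefix depends only on the letter that
    follows, up to what a quasi-period controls. *)
Lemma prefix_return_word (n : nat) (x0 P : seq 'I_n.+1) b q : x0 = P ++ b :: q ->
  exists v, P = take (index b x0) x0 ++ v /\ (v = [::] \/ return_word x0 v).
Proof.
move=> E; have ip : (index b x0 <= size P)%N.
  rewrite E index_cat; case: ifP => [bp|_]; last by rewrite /= eqxx addn0.
  by rewrite ltnW // index_mem.
have Et : take (index b x0) x0 = take (index b x0) P.
  have : take (index b x0) (P ++ b :: q) = take (index b x0) P by rewrite takel_cat.
  by rewrite -E.
exists (drop (index b x0) P); rewrite Et cat_take_drop; split=> //.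
case: (ltnP (index b x0) (size P)) => h; last by left; rewrite drop_oversize.
have Ed : drop (index b x0) P = b :: drop (index b x0).+1 P.
  rewrite (drop_nth b h); congr (_ :: _).
  have : nth b (P ++ b :: q) (index b x0) = nth b P (index b x0) by rewrite nth_cat h.
  by rewrite -E => <-; rewrite nth_index // E mem_cat mem_head orbT.
right; exists b, (take (index b x0) P), (drop (index b x0).+1 P), q; split=> //.
by rewrite -Ed catA cat_take_drop.
Qed.

Lemma nc_e2_close (R : realType) (s t d : R) (z : int) :
  `|s - t - z%:~R| <= d -> nc (e2 s - e2 t) <= 8 * d.
Proof.
move=> h; have -> : e2 s - e2 t = e2 t * (e2 (s - t) - 1).
  by rewrite mulrBr mulr1 -e2D [t + _]addrC subrK.
rewrite ncM nc_e2 mul1r (le_trans (nc_e2B1_int _ z)) //.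
by rewrite ler_wpM2l.
Qed.

Section phase_system.
Variables (R : realType) (n : nat) (zeta : 'I_n.+1 -> seq 'I_n.+1).
Local Notation letter := 'I_n.+1.
Local Notation inflate := (inflate zeta).
Local Notation legal := (legal zeta).
Hypothesis hsubst : is_substitution zeta.
Variable x0 : seq letter.
Hypothesis x0_pairs : forall b c, legal [:: b; c] -> infix [:: b; c] x0.
Hypothesis x0_letters : forall b, b \in x0.
Hypothesis x0_legal : legal x0.
Variable alpha : R.
Local Notation ph k u := (e2 (- (alpha * (size (inflate k u))%:R))).

(** The phase of [b] is that of the prefix of [x0] before the first [b]. Other occurrences give
    nearly the same phase by [prefix_return_word], and compatibility with neighbours follows as
    every legal pair occurs in [x0]. Compatibility between levels holds up to a factor common to all
    letters, which is removed by renormalising. *)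
Lemma phase_system : quasi_period zeta x0 alpha ->
  exists (y : nat -> letter -> R[i]) (C rho : R),
  [/\ 0 <= C, 0 < rho < 1, forall k b, nc (y k b) = 1,
     forall k b b', legal [:: b; b'] -> nc (ph k [:: b] * y k b - y k b') <= C * rho ^+ k &
     forall k b, nc (y k.+1 b - y k (head b (zeta b))) <= C * rho ^+ k].
Proof.
move=> /quasi_period_unif[C [rho [C0 rP hC]]].
have rk0 k : 0 <= rho ^+ k by rewrite exprn_ge0 //; case/andP: rP => /ltW.
have Ck0 k : 0 <= C * rho ^+ k by rewrite mulr_ge0.
pose y0 k b := ph k (take (index b x0) x0).
have F1 k p b q : x0 = p ++ b :: q -> nc (ph k p - y0 k b) <= 8 * (C * rho ^+ k).
  move=> E.
  have [v [Ev hv]] := prefix_return_word E.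
  rewrite [in ph k p]Ev.
  case: hv => [->|rv].
    by rewrite cats0 subrr nc0 mulr_ge0.
  have [z hz] := hC v rv k.
  apply: (@nc_e2_close _ _ _ _ (- z)).
  rewrite inflate_cat size_cat natrD.
  rewrite [X in `|X|](_ : _ = - (alpha * (size (inflate k v))%:R - z%:~R)).
    by rewrite normrN.
  by rewrite rmorphN /=; ring.
have ny0 k b : nc (y0 k b) = 1 by exact: nc_e2.
have F2 k b b' : legal [:: b; b'] ->
    nc (ph k [:: b] * y0 k b - y0 k b') <= 16 * C * rho ^+ k.
  move=> /x0_pairs/infixP[p [q E]].
  have h1 := F1 k p b (b' :: q) E.
  have h2 : nc (ph k (p ++ [:: b]) - y0 k b') <= 8 * (C * rho ^+ k).
    by apply: (F1 k _ _ q); rewrite E -catA.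
  rewrite ph_cat in h2.
  apply: le_trans (_ : _ <= nc (ph k [:: b] * (y0 k b - ph k p))
     + nc (ph k p * ph k [:: b] - y0 k b')) _.
    apply: le_trans (ncD _ _); rewrite le_eqVlt; apply/orP; left; apply/eqP.
    by congr nc; ring.
  by rewrite ncM nc_e2 mul1r ncB; lra.
pose h0 := head ord0 x0.
pose D : R := (size (inflate 1 x0))%:R * (16 * C).
have C16 : 0 <= 16 * C by rewrite mulr_ge0.
have D0 : 0 <= D by rewrite mulr_ge0.
(* At level k + 1 positions are measured from the start of [inflate 1 x0], whose first letter is the
   first letter of [zeta h0]. Its phase at level k is the offset between the two levels, the same
   for all [b]. *)
have F3 k b : nc (y0 k.+1 b * y0 k (head h0 (zeta h0)) - y0 k (head b (zeta b)))
     <= D * rho ^+ k.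
  pose v := take (index b x0) x0.
  have Ex : x0 = v ++ b :: drop (index b x0).+1 x0.
    have bi : (index b x0 < size x0)%N by rewrite index_mem.
    by rewrite -{1}(cat_take_drop (index b x0) x0) (drop_nth b bi) nth_index.
  have [t Et] : exists t, zeta b = head b (zeta b) :: t.
    by case E: (zeta b) => [|c t]; [have := hsubst E|exists t].
  have lg : legal (inflate 1 v ++ [:: head b (zeta b)]).
    case: x0_legal => p [a va]; exists (1 + p)%N, a.
    rewrite inflateD; apply: infix_trans (infix_inflate zeta 1 va).
    rewrite Ex inflate_cat (inflate_cons zeta 1 b) (subst_word1 zeta b : inflate 1 [:: b] = _).
    set r := inflate 1 (drop _ _).
    have -> : inflate 1 v ++ zeta b ++ r = (inflate 1 v ++ [:: head b (zeta b)]) ++ t ++ r.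
      by rewrite -catA /= -cat_cons -Et.
    exact: prefix_infix.
  have E1 : y0 k.+1 b = ph k (inflate 1 v) by rewrite /y0 -inflateD addn1.
  have hh : head (head b (zeta b)) (inflate 1 v) = head h0 (zeta h0).
    case: v Ex {lg E1} => [|c v] Ex.
      by rewrite inflate_nil (_ : h0 = b) // /h0 Ex.
    have -> : h0 = c by rewrite /h0 Ex.
    rewrite (inflate_cons zeta 1 c) (subst_word1 zeta c : inflate 1 [:: c] = _).
    by case E: (zeta c) => [|d w] //; have := hsubst E.
  have := phase_path F2 k lg.
  rewrite hh -E1 => /le_trans; apply.
  rewrite mulrA ler_wpM2r // ler_wpM2r // ler_nat.
  by rewrite Ex inflate_cat size_cat leq_addr.
(* The accumulated product of the offsets in [F3]; multiplying by it leaves the relation within a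
   level untouched. *)
pose K := fix K k := if k is k'.+1 then K k' * y0 k' (head h0 (zeta h0)) else 1 : R[i].
have KS k : K k.+1 = K k * y0 k (head h0 (zeta h0)) by [].
have nK k : nc (K k) = 1.
  by elim: k => [|k IH]; [exact: nc1 | rewrite KS ncM IH ny0 mulr1].
exists (fun k b => K k * y0 k b), (16 * C + D), rho; split=> //.
- by rewrite addr_ge0.
- by move=> k b; rewrite ncM nK ny0 mulr1.
- move=> k b b' lg; rewrite mulrCA -mulrBr ncM nK mul1r.
  by rewrite (le_trans (F2 k b b' lg)) // ler_wpM2r // lerDl.
move=> k b; rewrite KS -mulrA [y0 _ _ * y0 _ _]mulrC -mulrBr ncM nK mul1r.
by rewrite (le_trans (F3 k b)) // ler_wpM2r // lerDr.
Qed.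

End phase_system.

(** * Windows and eigenfunctions *)

Section shift_measurability.
Variable n : nat.
Local Notation letter := 'I_n.+1.

Lemma open_coordinate (i : int) (A : set letter) : open [set x : full_shift n | A (x i)].
Proof.
have -> : [set x : full_shift n | A (x i)] =
    (proj i : full_shift n -> discrete_topology letter) @^-1` A by [].
apply: open_comp; last exact: discrete_open.
by move=> x _; exact: proj_continuous.
Qed.

Lemma open_window (k : int) N (A : set (seq letter)) :
  open [set x : full_shift n | A (window x k N)].
Proof.
elim: N k A => [|N IH] k A.
  have [A0|nA0] := pselect (A [::]).
    rewrite (_ : [set x | _] = setT); first exact: openT.
    by apply/seteqP; split.
  rewrite (_ : [set x | _] = set0); first exact: open0.
  by apply/seteqP; split.
have E (x : int -> letter) : window x k N.+1 = x k :: window x (k + 1) N.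
  have -> : window x k N.+1 = x (k + 0) :: map (fun i : nat => x (k + i%:Z)) (iota (1 + 0) N) by [].
  rewrite addr0 (iotaDl 1 0 N) -map_comp.
  by congr (_ :: _); apply: eq_map => i /=; rewrite PoszD addrA.
rewrite (_ : [set x | _] = \bigcup_(a in [set: letter])
    ([set x : full_shift n | x k = a] `&` [set x : full_shift n | A (a :: window x (k + 1) N)])).
  apply: bigcup_open => a _; apply: openI.
    exact: (open_coordinate k [set a]).
  exact: (IH (k + 1) [set w | A (a :: w)]).
apply/seteqP; split=> [x /=|x [a _ [/= <-]]]; last by rewrite E.
by rewrite E => Ax; exists (x k).
Qed.

Lemma measurable_window d (T : measurableType d) (F : seq letter -> T) (k : int) N
  (D : set (borel_shift n)) :
  measurable_fun D (fun x : borel_shift n => F (window x k N)).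
Proof.
move=> mD Y mY; apply: measurableI => //; apply: sub_sigma_algebra.
exact: (open_window k N [set w | Y (F w)]).
Qed.

Lemma window_sub (x : int -> letter) (k : int) m (i N : nat) :
  (i + m <= N)%N -> take m (drop i (window x k N)) = window x (k + i%:Z) m.
Proof.
move=> h; rewrite /window /mkseq -map_drop -map_take drop_iota take_iota.
rewrite add0n (minn_idPl _); last by lia.
have -> : iota i m = [seq (i + j)%N | j <- iota 0 m] by rewrite -{1}(addn0 i) iotaDl.
rewrite -map_comp; apply: eq_map => j /=.
by rewrite PoszD addrA.
Qed.

Lemma subst_space_legal (zeta : letter -> seq letter) (x : full_shift n) :
  subst_space zeta x <-> forall k N, legal zeta (window x k N).
Proof.
by split=> h k N; [have [p [a ?]] := h k N|have [p [a ?]] := h k N]; exists p, a.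
Qed.

(** Legality of the centred windows is enough, because every window is a factor of one of them; this
    is a countable intersection of open sets. *)
Lemma measurable_subst_space (zeta : letter -> seq letter) :
  measurable (subst_space zeta : set (borel_shift n)).
Proof.
rewrite (_ : subst_space zeta = \bigcap_(i in [set: nat])
   [set x : full_shift n | legal zeta (window x (- i%:Z) (2 * i))]).
  apply: bigcap_measurable; first by exists 0%N.
  move=> i _; apply: sub_sigma_algebra.
  exact: (open_window _ _ [set w | legal zeta w]).
apply/seteqP; split=> [x /subst_space_legal h i _|x h]; first exact: h.
apply/subst_space_legal => k N; pose i := (absz k + N)%N.
have hk : (0 <= k + i%:Z) by rewrite /i; lia.
have -> : window x k N = take N (drop (absz (k + i%:Z)) (window x (- i%:Z) (2 * i))).
  by rewrite window_sub; [congr window; lia|rewrite /i; lia].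
have hi : legal zeta (window x (- i%:Z) (2 * i)) := h i I.
by apply: legal_infix hi; apply: infix_trans (infix_drop _ _); exact: infix_take.
Qed.

Lemma shift_subst_space (zeta : letter -> seq letter) (k : int) (x : full_shift n) :
  subst_space zeta x -> subst_space zeta (shift_seq k x).
Proof.
move=> /subst_space_legal h; apply/subst_space_legal => l N.
have -> : window (shift_seq k x) l N = window x (l + k) N.
  by rewrite /window /shift_seq; apply: eq_mkseq => i; congr x; ring.
exact: h.
Qed.

End shift_measurability.

Lemma sum_nat_shift (V : nmodType) (P : pred nat) (F : nat -> V) a b :
  \sum_(a <= j < a + b | P j) F j = \sum_(0 <= j < b | P (j + a)%N) F (j + a)%N.
Proof. by rewrite -{1}[a]add0n big_addn addKn. Qed.

(** * Twisted counts of the occurrences of a word *)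

Section occurrences.
Variables (R : realType) (n : nat) (alpha : R).
Local Notation letter := 'I_n.+1.

Definition occurs (W u : seq letter) j := take (size W) (drop j u) == W.

Definition occ_sum (W u : seq letter) : R[i] :=
  \sum_(0 <= j < size u | occurs W u j) e2 (- (alpha * j%:R)).

Variable W : seq letter.

Lemma occ_sum_nil : occ_sum W [::] = 0.
Proof. by rewrite /occ_sum big_geq. Qed.

Lemma occ_sum_le u : nc (occ_sum W u) <= (size u)%:R.
Proof.
apply: le_trans (nc_sum _ _ _) _.
rewrite big_mkcond; apply: (@le_trans _ _ (\sum_(0 <= j < size u) 1)).
  by apply: ler_sum => j _; case: ifP => _ //; rewrite nc_e2.
by rewrite sumr_const_nat subn0.
Qed.

(** Only occurrences across the junction are counted differently, and these start at one of the last
    [size W] positions of [u]. *)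
Lemma occ_sum_cat u v :
  nc (occ_sum W (u ++ v) - (occ_sum W u + e2 (- (alpha * (size u)%:R)) * occ_sum W v))
    <= (size W)%:R.
Proof.
have E : occ_sum W (u ++ v) = \sum_(0 <= j < size u | occurs W (u ++ v) j) e2 (- (alpha * j%:R))
   + e2 (- (alpha * (size u)%:R)) * occ_sum W v.
  rewrite /occ_sum size_cat (@big_cat_nat _ _ _ (size u)) ?leq_addr //=.
  congr (_ + _).
  rewrite sum_nat_shift mulr_sumr.
  apply: eq_big => [j|j _]; first by rewrite /occurs drop_cat ltnNge leq_addl /= addnK.
  by rewrite natrD mulrDr opprD e2D mulrC.
rewrite E opprD addrACA subrr addr0 /occ_sum.
rewrite big_mkcond [X in _ - X]big_mkcond -sumrB (le_trans (nc_sum _ _ _)) //.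
pose N := (size u - size W)%N.
have hN : (N <= size u)%N by exact: leq_subr.
rewrite (@big_cat_nat _ _ _ N) //= big1_seq ?add0r.
  apply: (@le_trans _ _ (\sum_(N <= j < size u) 1)).
    apply: ler_sum_nat => j /andP[_ ju].
    rewrite /occurs; case: (eqVneq (take _ (drop j u))) => [h|_].
      suff -> : take (size W) (drop j (u ++ v)) == W by rewrite subrr nc0.
      rewrite drop_cat ju takel_cat ?h //.
      have := congr1 size h; rewrite size_take; case: ifP => [/ltnW //|_ ->//].
    by case: ifP => _; rewrite subr0 ?nc0 // nc_e2.
  by rewrite sumr_const_nat ler_nat /N; lia.
move=> j /andP[_]; rewrite mem_index_iota /N => /andP[_ hj].
rewrite /occurs drop_cat; have ju : (j < size u)%N by lia.
by rewrite ju takel_cat ?size_drop; [rewrite subrr nc0|lia].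
Qed.

End occurrences.

Lemma cvg_of_cauchy (R : realType) (u : nat -> R) :
  (forall e, 0 < e -> exists N, forall i j, (N <= i)%N -> (N <= j)%N -> `|u i - u j| <= e) ->
  cvgn u.
Proof.
move=> h; apply/cauchy_cvgP; apply/cauchy_exP => e e0.
have [N hN] := h (e / 2) (divr_gt0 e0 (ltr0n _ 2)).
exists (u N); exists N => // j /= Nj; rewrite /ball /=.
by rewrite (le_lt_trans (hN _ _ (leqnn _) Nj)) //; lra.
Qed.

Lemma ae_exists d (T : measurableType d) (R : realType) (mu : {measure set T -> \bar R})
  (D : set T) (P : T -> Prop) :
  measurable D -> (0 < mu D)%E -> {ae mu, forall x, D x -> P x} ->
  exists2 x, D x & P x.
Proof.
move=> mD D0 [A [mA A0 hA]]; apply: contrapT => nP.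
have : D `<=` A.
  move=> x Dx; apply: hA => /= h; apply: nP; exists x => //; exact: h.
move=> DA; have : (mu D <= mu A)%E by apply: le_measure => //; rewrite inE.
by rewrite A0 leNgt D0.
Qed.

Lemma limit_close (R : realType) (u : nat -> R) (a l e : R) N0 :
  u @ \oo --> l -> (forall i, (N0 <= i)%N -> `|a - u i| <= e) -> `|a - l| <= e.
Proof.
move=> /cvgrPdist_lt ul h; apply/ler_addgt0Pr => d d0.
have [N _ hN] := ul d d0.
have h1 := h (maxn N0 N) (leq_maxl _ _).
have h2 := hN (maxn N0 N) (leq_maxr _ _).
rewrite -(subrKA (u (maxn N0 N))) (le_trans (ler_normD _ _)) // lerD //.
by rewrite distrC ltW.
Qed.

Section eigenfunction.
Variables (R : realType) (n : nat) (zeta : 'I_n.+1 -> seq 'I_n.+1).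
Local Notation letter := 'I_n.+1.
Local Notation inflate := (inflate zeta).
Local Notation len := (len zeta).
Local Notation legal := (legal zeta).
Local Notation X := (subst_space zeta : set (borel_shift n)).
Hypothesis hsubst : is_substitution zeta.
Variable m : nat.
Hypothesis mP : forall a b, a \in inflate m [:: b].
Hypothesis hd : (2 <= n.+1)%N.
Variable mu : probability (borel_shift n) R.
Hypothesis hmu : invariant_probability zeta mu.

(** The averages of [Phi] over initial windows of a point are eventually close to one multiple
    [Q * c], so they converge uniformly to a bounded measurable [g]. Dropping the first letter
    changes [Phi] by a twist and a bounded amount, hence g(Tx) = e(alpha) g(x). If there is no such
    eigenfunction, then g = 0 almost everywhere, whereas |g| = |c| at every point. *)
Lemma eigenfunction_of_averages (Phi : seq letter -> R[i]) (alpha w0 : R) (c : R[i]) :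
  ~ nontrivial_discrete_spectrum zeta mu -> e2 alpha <> 1 -> 0 <= w0 ->
  (forall u, nc (Phi u) <= (size u)%:R) ->
  (forall u v, nc (Phi (u ++ v) - (Phi u + e2 (- (alpha * (size u)%:R)) * Phi v)) <= w0) ->
  (forall e, 0 < e -> exists B, forall w, legal w -> exists Q : R[i], nc Q = 1 /\
     forall N, (B <= N <= size w)%N -> nc (Phi (take N w) - Q * c * N%:R) <= e * N%:R) ->
  c = 0.
Proof.
move=> wm ea w00 Phib PhiD hB.
pose a N (x : borel_shift n) : R[i] := (N%:R^-1 : R)%:C * Phi (window x 0 N).
have mX : measurable X := measurable_subst_space zeta.
have n_a N x : nc (a N x) <= 1.
  rewrite ncM nc_real ger0_norm ?invr_ge0 //; case: N => [|N]; first by rewrite invr0 mul0r.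
  rewrite ler_pdivrMl ?ltr0n // mulr1 (le_trans (Phib _)) //.
  by rewrite /window size_mkseq.
have aQ e : 0 < e -> exists B, forall x M, X x -> exists Q : R[i], nc Q = 1 /\
    forall N, (B <= N <= M)%N -> nc (a N x - Q * c) <= e.
  move=> /hB[B H]; exists B.+1 => x M /subst_space_legal hx.
  have [Q [Q1 hQ]] := H _ (hx 0 M); exists Q; split=> // N /andP[BN NM].
  have N0 : 0 < N%:R :> R by rewrite ltr0n; case: N BN {NM}.
  have tw : take N (window x 0 M) = window x 0 N.
    by have := @window_sub n x 0 N 0 M; rewrite drop0 addr0 add0n; apply.
  have := hQ N; rewrite tw (ltnW BN) /= size_mkseq NM => /(_ isT) h.
  have -> : a N x - Q * c = (N%:R^-1 : R)%:C * (Phi (window x 0 N) - Q * c * N%:R).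
    rewrite mulrBr; congr (_ - _); rewrite mulrCA -[(N%:R : R[i])](rmorph_nat (real_complex R)).
    by rewrite -rmorphM mulVf ?mulr1 // gt_eqF.
  by rewrite ncM nc_real gtr0_norm ?invr_gt0 // ler_pdivrMl // [leRHS]mulrC.
have cau e : 0 < e -> exists B, forall x, X x -> forall N M, (B <= N)%N -> (B <= M)%N ->
    nc (a N x - a M x) <= e.
  move=> e0; have [|B hBQ] := aQ (e / 2); first by lra.
  exists B => x Xx N M BN BM; have [Q [_ hQ]] := hBQ x (maxn N M) Xx.
  have h1 := hQ N; rewrite BN leq_maxl in h1; have {}h1 := h1 isT.
  have h2 := hQ M; rewrite BM leq_maxr in h2; have {}h2 := h2 isT.
  by rewrite (le_trans (ncT _ (Q * c) _)) // [e]splitr lerD // ncB.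
pose re x := lim ((fun N => complex.Re (a N x)) @ \oo).
pose im x := lim ((fun N => complex.Im (a N x)) @ \oo).
have cre x : X x -> (fun N => complex.Re (a N x)) @ \oo --> re x.
  move=> Xx; apply: cvg_of_cauchy => e /cau[B hBc]; exists B => i j Bi Bj.
  by rewrite -ReB (le_trans (Re_le_nc _)) // hBc.
have cim x : X x -> (fun N => complex.Im (a N x)) @ \oo --> im x.
  move=> Xx; apply: cvg_of_cauchy => e /cau[B hBc]; exists B => i j Bi Bj.
  by rewrite -ImB (le_trans (Im_le_nc _)) // hBc.
pose g x : R[i] := re x +i* im x.
have ag e : 0 < e -> exists B, forall x, X x -> forall N, (B <= N)%N -> nc (a N x - g x) <= e.
  move=> e0; have [|B hBc] := cau (e / 2); first by lra.
  exists B => x Xx N BN; rewrite (le_trans (nc_le_ReIm _)) // ReB ImB [e]splitr lerD //=.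
    apply: (limit_close (N0 := B) (cre x Xx)) => i Bi.
    by rewrite -ReB (le_trans (Re_le_nc _)) // hBc.
  apply: (limit_close (N0 := B) (cim x Xx)) => i Bi.
  by rewrite -ImB (le_trans (Im_le_nc _)) // hBc.
have mre : measurable_fun X re.
  apply: (measurable_realfun.measurable_fun_cvg (h := fun N x => complex.Re (a N x))) => //.
  by move=> N; exact: (measurable_window (fun w => complex.Re ((N%:R^-1 : R)%:C * Phi w))).
have mim : measurable_fun X im.
  apply: (measurable_realfun.measurable_fun_cvg (h := fun N x => complex.Im (a N x))) => //.
  by move=> N; exact: (measurable_window (fun w => complex.Im ((N%:R^-1 : R)%:C * Phi w))).
have ng x : X x -> nc (g x) <= 2.
  move=> Xx; have [B hBg] := ag 1 ltr01.
  have := hBg x Xx B (leqnn B); rewrite ncB => h.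
  rewrite (le_trans (nc_ler_sub _ (a B x))) //.
  by have := n_a B x; lra.
have gT x : X x -> g (shift_seq 1 x) = e2 alpha * g x.
  move=> Xx; have XT := shift_subst_space 1 Xx.
  have wE N : window x 0 N.+1 = [:: x 0] ++ window (shift_seq 1 x) 0 N.
    rewrite /window /mkseq [LHS]/= addr0 /=; congr (_ :: _).
    rewrite (iotaDl 1 0 N) -map_comp; apply: eq_map => i /=.
    by rewrite /shift_seq PoszD; congr x; ring.
  (* The defect [w0] of additivity, 1 for the letter that is dropped, and 1 for the change of the
     denominator from N to N + 1. *)
  have hN N : nc (a N.+1 x - e2 (- alpha) * a N (shift_seq 1 x)) <= (w0 + 2) * N.+1%:R^-1.
    set aT := a N (shift_seq 1 x).
    have E : Phi (window (shift_seq 1 x) 0 N) = N%:R * aT.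
      rewrite /aT /a mulrA -[(N%:R : R[i])](rmorph_nat (real_complex R)) -rmorphM.
      case: N {aT} => [|N]; last by rewrite divff ?pnatr_eq0 // mul1r.
      rewrite !mul0r; apply/eqP; rewrite -nc_eq0 eq_le nc_ge0 andbT; exact: Phib.
    have := PhiD [:: x 0] (window (shift_seq 1 x) 0 N).
    rewrite -wE mulr1 E => h; have h1 := Phib [:: x 0].
    have -> : a N.+1 x - e2 (- alpha) * aT = (N.+1%:R^-1 : R)%:C *
        ((Phi (window x 0 N.+1) - (Phi [:: x 0] + e2 (- alpha) * (N%:R * aT)))
         + (Phi [:: x 0] - e2 (- alpha) * aT)).
      rewrite /a; set s := (_ : R)%:C; set P := Phi (window _ _ _).
      have Es : s * N.+1%:R = 1.
        rewrite -[(N.+1%:R : R[i])](rmorph_nat (real_complex R)) -rmorphM.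
        by rewrite mulVf ?pnatr_eq0.
      transitivity (s * P - (s * N.+1%:R) * (e2 (- alpha) * aT)).
        by rewrite Es mul1r.
      rewrite -natr1; ring.
    rewrite ncM nc_real ger0_norm ?invr_ge0 // mulrC ler_wpM2r ?invr_ge0 //.
    apply: le_trans (ncD _ _) _; apply: lerD => //.
    apply: le_trans (ncD _ _) _; rewrite ncN ncM nc_e2 mul1r.
    have := n_a N (shift_seq 1 x); rewrite -/aT /= in h1 *; lra.
  suff : nc (g x - e2 (- alpha) * g (shift_seq 1 x)) <= 0.
    move=> h; have /eqP : nc (g x - e2 (- alpha) * g (shift_seq 1 x)) = 0.
      by apply/eqP; rewrite eq_le h nc_ge0.
    by rewrite nc_eq0 subr_eq0 => /eqP ->; rewrite mulrA -e2D subrr e2_0 mul1r.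
  apply/ler_addgt0Pr => e e0; rewrite add0r.
  have [|B hBg] := ag (e / 4); first by lra.
  pose N := maxn B (Num.truncn ((w0 + 2) / (e / 2))).
  have hN2 : (w0 + 2) * N.+1%:R^-1 <= e / 2.
    rewrite ler_pdivrMr ?ltr0n // mulrC -ler_pdivrMr ?divr_gt0 //.
    apply: (@le_trans _ _ (Num.truncn ((w0 + 2) / (e / 2))).+1%:R).
      exact/ltW/truncnS_gt.
    by rewrite ler_nat ltnS leq_maxr.
  have h1 := hBg x Xx N.+1 (leqW (leq_maxl _ _)).
  have h2 := hBg _ XT N (leq_maxl _ _).
  have := le_trans (hN N) hN2 => h3.
  apply: le_trans (_ : _ <= nc (g x - a N.+1 x) +
     (nc (a N.+1 x - e2 (- alpha) * a N (shift_seq 1 x)) +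
      nc (e2 (- alpha) * (a N (shift_seq 1 x) - g (shift_seq 1 x))))) _.
    have L (p q r s t : R[i]) : p - t * s = (p - q) + ((q - t * r) + t * (r - s)) by ring.
    rewrite (L (g x) (a N.+1 x) (a N (shift_seq 1 x))).
    by apply: le_trans (ncD _ _) _; rewrite lerD2l; exact: ncD.
  by rewrite ncB ncM nc_e2 mul1r; lra.
have ae0 : {ae mu, forall x, X x -> g x = 0}.
  apply: contrapT => nae; apply: wm; exists alpha, g; split=> //.
    split=> //.
    apply: (@le_lt_trans _ _ (\int[mu]_(x in X) (cst 4%:E x))%E); last first.
      by rewrite integral_cst //= hmu.1 mule1 ltry.
    apply: ge0_le_integral => //.
    - by move=> x _; rewrite lee_fin sqr_ge0.
    - apply/measurable_realfun.measurable_EFinP.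
      rewrite (_ : (fun x => _) = (fun x => re x ^+ 2 + im x ^+ 2)).
        by apply: measurable_funD; apply: measurable_funX.
      by apply/funext => x; rewrite nc_sqr.
    - move=> x Xx; rewrite lee_fin /=.
      by rewrite (_ : 4 = 2 ^+ 2) ?lerXn2r ?nnegrE ?nc_ge0 ?ng //; ring.
  by apply: aeW => x; exact: gT.
have mu1 : (0 < mu X)%E by rewrite hmu.1 lte_fin ltr01.
have [x Xx gx] := ae_exists mX mu1 ae0.
apply/eqP; rewrite -nc_eq0 eq_le nc_ge0 andbT.
apply/ler_addgt0Pr => e e0; rewrite add0r.
have [|B1 h1] := aQ (e / 2); first by lra.
have [|B2 h2] := ag (e / 2); first by lra.
have [Q [Q1 hQ]] := h1 x (maxn B1 B2) Xx.
have {}hQ := hQ (maxn B1 B2); rewrite leq_maxl leqnn in hQ; have {}hQ := hQ isT.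
have := h2 x Xx (maxn B1 B2) (leq_maxr _ _); rewrite gx subr0 => h3.
have : nc (Q * c) <= nc (a (maxn B1 B2) x) + e / 2.
  by apply: le_trans (nc_ler_sub _ (a (maxn B1 B2) x)) _; rewrite lerD2l ncB.
by rewrite ncM Q1 mul1r; lra.
Qed.

Variable x0 : seq letter.
Hypothesis x0_pairs : forall b c, legal [:: b; c] -> infix [:: b; c] x0.
Hypothesis x0_letters : forall b, b \in x0.
Hypothesis x0_legal : legal x0.

(** By [phase_window] the limit [c] of the twisted means is also the modulus, up to a unit, of all
    long averages, so [eigenfunction_of_averages] forces it to vanish and only the error term
    remains. *)
Lemma occ_sum_small (alpha : R) (W : seq letter) :
  ~ nontrivial_discrete_spectrum zeta mu -> e2 alpha <> 1 ->
  quasi_period zeta x0 alpha ->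
  exists2 h : nat -> R, exp_small h &
    forall k b, nc (occ_sum alpha W (inflate k [:: b])) <= h k * (len k b)%:R.
Proof.
move=> wm ea /(phase_system hsubst x0_pairs x0_letters x0_legal).
move=> [y [C [rho [C0 rP hy1 hy2 hy3]]]].
have w0 : 0 <= (size W)%:R :> R by [].
have [c [h [hE h0 h1 h2]]] := twisted_means hsubst mP hd C0 rP hy1 hy2 hy3 w0
  (occ_sum_nil alpha W) (occ_sum_le alpha W) (occ_sum_cat alpha W).
exists h => // k b; suff c0 : c = 0.
  by have := h1 k b; rewrite c0 mul0r subr0 ncM hy1 mul1r.
apply: (eigenfunction_of_averages wm ea w0 (occ_sum_le alpha W) (occ_sum_cat alpha W)).
move=> e e0; have e20 : 0 < e / 2 by lra.
have [k1 hk] := exp_small_lt hE e20.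
pose B : R := 2 * ((size W)%:R + (maxlen zeta k1)%:R * (1 + nc c)).
exists (maxn (maxlen zeta k1) (Num.truncn (B / (e / 2))).+1) => w lw.
have [Q [Q1 hQ]] := phase_window hsubst hd C0 rP hy1 w0 (occ_sum_nil alpha W)
  (occ_sum_le alpha W) (occ_sum_cat alpha W) (h2 k1) (h0 k1) lw.
exists Q; split=> // N; rewrite geq_max -andbA => /and3P[N1 N2 N3].
apply: le_trans (hQ N _) _; first by rewrite N1.
rewrite [e]splitr [leRHS]mulrDl lerD ?ler_wpM2r ?(ltW (hk k1 _)) // -ler_pdivrMl // mulrC.
apply: le_trans (ltW (truncnS_gt _)) _; by rewrite ler_nat.
Qed.

End eigenfunction.

(** * Complexity and the order of a quasi-period *)

Section complexity.
Variables (n : nat) (zeta : 'I_n.+1 -> seq 'I_n.+1).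
Local Notation letter := 'I_n.+1.
Local Notation X := (subst_space zeta).

Definition space_words N : {set N.-tuple letter} :=
  [set t : N.-tuple letter | `[< exists2 x, X x & window x 0 N = t >]].

Lemma size_window (x : int -> letter) k N : size (window x k N) == N.
Proof. by rewrite size_mkseq. Qed.

Lemma windowS (x : int -> letter) k N :
  window x k N.+1 = rcons (window x k N) (x (k + N%:Z)).
Proof. by rewrite /window mkseqS. Qed.

Lemma window_shift (x : full_shift n) (j k : int) N :
  window (shift_seq j x) k N = window x (k + j) N.
Proof. by rewrite /window /shift_seq; apply: eq_mkseq => i; congr x; ring. Qed.

(** The argument of Morse and Hedlund. If the number of words does not grow from length N to N + 1,
    each word of length N has a unique right extension, so any window of length N determines the
    point to its right; this leaves room for finitely many points only. *)
Lemma complexity N : infinite_set X -> (N < #|space_words N|)%N.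
Proof.
move=> hinf.
have /pcard_leP/injfunPex[f fX finj] := (infiniteP X).1 hinf.
elim: N => [|N IH].
  apply/card_gt0P; exists [tuple]; rewrite inE; apply/asboolP; exists (f 0%N) => //.
  exact: fX.
rewrite ltnNge; apply/negP => hcard.
have tN (t : N.+1.-tuple letter) : size (take N t) == N.
  by rewrite size_takel // size_tuple.
pose tr (t : N.+1.-tuple letter) : N.-tuple letter := Tuple (tN t).
have img : space_words N = tr @: space_words N.+1.
  apply/setP => t; apply/idP/imsetP.
    rewrite inE => /asboolP[x Xx Ex]; exists (Tuple (size_window x 0 N.+1)).
      by rewrite inE; apply/asboolP; exists x.
    apply: val_inj => /=; rewrite windowS Ex -cats1 take_size_cat ?size_tuple //.
  move=> [s]; rewrite inE => /asboolP[x Xx Ex] ->; rewrite inE; apply/asboolP; exists x => //=.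
  by rewrite -Ex windowS -cats1 take_size_cat // size_mkseq.
have tinj : {in space_words N.+1 &, injective tr}.
  apply/imset_injP; rewrite -img eqn_leq {1}img leq_imset_card /=.
  exact: leq_trans hcard IH.
have ext0 x y : X x -> X y -> window x 0 N = window y 0 N -> x N%:Z = y N%:Z.
  move=> Xx Xy E.
  have := tinj (Tuple (size_window x 0 N.+1)) (Tuple (size_window y 0 N.+1)).
  have hx : Tuple (size_window x 0 N.+1) \in space_words N.+1.
    by rewrite inE; apply/asboolP; exists x.
  have hy : Tuple (size_window y 0 N.+1) \in space_words N.+1.
    by rewrite inE; apply/asboolP; exists y.
  move=> /(_ hx hy) H; have {}H : tr (Tuple (size_window x 0 N.+1)) = tr (Tuple (size_window y 0 N.+1)).
    apply: val_inj => /=; rewrite !windowS -!cats1 !take_size_cat ?size_mkseq //.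
  move: (tinj _ _ hx hy H) => /(congr1 val) /=.
  by rewrite !windowS !add0r => /rcons_inj[].
have ext x y k : X x -> X y -> window x k N = window y k N -> x (k + N%:Z) = y (k + N%:Z).
  move=> Xx Xy E; have := ext0 (shift_seq k x) (shift_seq k y).
  rewrite /shift_seq ![_%:Z + k]addrC; apply; try exact: shift_subst_space.
  by rewrite !(window_shift _ k) add0r.
have rext x y k : X x -> X y -> window x k N = window y k N ->
    forall i : nat, window x k (N + i) = window y k (N + i).
  move=> Xx Xy E; elim=> [|i IHi]; first by rewrite addn0.
  rewrite addnS !windowS IHi; congr rcons.
  have := ext x y (k + i%:Z) Xx Xy.
  rewrite (_ : k + i%:Z + N%:Z = k + (N + i)%N%:Z); last by rewrite PoszD; ring.
  apply.
  have hsub (z : int -> letter) : take N (drop i (window z k (N + i))) = window z (k + i%:Z) N.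
    by rewrite window_sub // addnC.
  by rewrite -!hsub IHi.
pose L := #|{: N.-tuple letter}|.
have dif (i j : 'I_L.+1) : exists p : nat, i != j ->
    exists2 q : int, (absz q <= p)%N & f i q != f j q.
  case: (eqVneq i j) => [_|ij]; first by exists 0%N.
  have : f i <> f j.
    move=> E; move: ij; rewrite -(inj_eq val_inj) => /eqP; apply; apply: finj => //; exact: in_setT.
  move=> fij; have [q hq] : exists q, f i q <> f j q.
    apply: contrapT => h; apply: fij; apply/funext => q; apply: contrapT => hq.
    by apply: h; exists q.
  by exists (absz q) => _; exists q => //; apply/eqP.
have /fin_all_exists[P hP] : forall ij : 'I_L.+1 * 'I_L.+1, exists p : nat, ij.1 != ij.2 ->
    exists2 q : int, (absz q <= p)%N & f ij.1 q != f ij.2 q.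
  by move=> [i j]; exact: dif.
pose K := (\max_ij P ij)%N.
pose F (i : 'I_L.+1) : N.-tuple letter := Tuple (size_window (f i) (- K%:Z) N).
have /injectiveP Finj : injectiveb F.
  apply/injectiveP => i j /(congr1 val) /= E; apply/eqP; apply/negPn/negP => ij.
  have [q qP] := hP (i, j) ij; rewrite /= => /negP; apply.
  have qK : (absz q <= K)%N.
    by apply: leq_trans qP _; exact: (leq_bigmax_cond (F := P)).
  have fXi l : X (f l) by exact: fX.
  have := rext _ _ _ (fXi i) (fXi j) E (2 * K).+1 => /(congr1 (fun s => nth ord0 s (absz (q + K%:Z)))).
  rewrite !nth_mkseq; try lia.
  by rewrite (_ : - K%:Z + _ = q); [move=> ->|lia].
have := leq_card F Finj.
by rewrite card_ord ltnn.
Qed.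

End complexity.

Section occurrence_count.
Variables (n : nat) (zeta : 'I_n.+1 -> seq 'I_n.+1).
Local Notation letter := 'I_n.+1.
Local Notation inflate := (inflate zeta).
Implicit Types (W u v : seq letter).

Definition occ_count W u := (\sum_(0 <= j < size u) occurs W u j)%N.

Lemma occ_count_cat W u v : (occ_count W u + occ_count W v <= occ_count W (u ++ v))%N.
Proof.
rewrite /occ_count size_cat [leqRHS](@big_cat_nat _ _ _ (size u)) ?leq_addr //=.
rewrite [X in (_ <= _ + X)%N](sum_nat_shift xpredT); apply: leq_add.
  rewrite !big_mkord; apply: leq_sum => j _.
  rewrite /occurs drop_cat ltn_ord; case: eqP => //= h.
  rewrite takel_cat ?h ?eqxx //.
  have := congr1 size h; rewrite size_take; case: ifP => [/ltnW //|_ ->//].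
apply: leq_sum => j _.
by rewrite /occurs drop_cat ltnNge leq_addl /= addnK.
Qed.

Lemma occ_count_infix W u : W != [::] -> infix W u -> (0 < occ_count W u)%N.
Proof.
move=> W0 /infixP[p [q ->]].
apply: leq_trans (occ_count_cat _ _ _); rewrite addn_gt0; apply/orP; right.
rewrite /occ_count size_cat big_ltn ?addn_gt0 ?lt0n ?size_eq0 ?W0 //.
by rewrite /occurs drop0 take_size_cat // eqxx.
Qed.

Lemma occ_count_inflate W Q u : W != [::] ->
  (forall b, infix W (inflate Q [:: b])) -> (size u <= occ_count W (inflate Q u))%N.
Proof.
move=> W0 h; elim: u => [//|b u IH].
rewrite inflate_cons /= -add1n (leq_trans _ (occ_count_cat _ _ _)) // leq_add //.
exact: occ_count_infix.
Qed.

End occurrence_count.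

Lemma occ_sum0 (R : realType) (n : nat) (W u : seq 'I_n.+1) :
  occ_sum (0 : R) W u = (occ_count W u)%:R.
Proof.
rewrite /occ_sum /occ_count natr_sum big_mkcond; apply: eq_bigr => j _.
by rewrite mul0r oppr0 e2_0; case: ifP.
Qed.

Section order_bound.
Variables (R : realType) (n : nat) (zeta : 'I_n.+1 -> seq 'I_n.+1).
Local Notation letter := 'I_n.+1.
Local Notation inflate := (inflate zeta).
Local Notation len := (len zeta).
Local Notation legal := (legal zeta).
Local Notation X := (subst_space zeta : set (borel_shift n)).
Hypothesis hsubst : is_substitution zeta.
Variable m : nat.
Hypothesis mP : forall a b, a \in inflate m [:: b].
Hypothesis hd : (2 <= n.+1)%N.
Variable mu : probability (borel_shift n) R.
Hypothesis hmu : invariant_probability zeta mu.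
Variable x0 : seq letter.
Hypothesis x0_pairs : forall b c, legal [:: b; c] -> infix [:: b; c] x0.
Hypothesis x0_letters : forall b, b \in x0.
Hypothesis x0_legal : legal x0.
Hypothesis haper : aperiodic zeta.

(** A tile of level [k], its right neighbour, and an offset in the first. This determines the next N
    letters as long as no tile is shorter than N. Offsets beyond the end of a short tile are
    included; they only enlarge the count. *)
Local Notation place k := (letter * letter * 'I_(maxlen zeta k))%type.
Definition place_word k N (p : place k) : seq letter :=
  take N (drop p.2 (inflate k [:: p.1.1] ++ inflate k [:: p.1.2])).

Definition multiplicity := (n.+1 * n.+1 * maxlen zeta m)%N.

(** Let N be the least tile length of level [k]. The number of places is at most [multiplicity]
    times N, since tile lengths are comparable, and they are distributed over more than N words of
    length N; some word gets at most [multiplicity] of them, whatever [k] is. *)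
Lemma few_places k : exists (N : nat) (W : seq letter),
  [/\ forall b, (N <= len k b)%N, (0 < N)%N, size W = N, legal W &
    (#|[pred p : place k | place_word N p == W]| <= multiplicity)%N].
Proof.
have [b0 hb0] : exists b0, forall b, (len k b0 <= len k b)%N.
  have [a _ ha] := @arg_minP _ _ letter ord0 xpredT (len k) isT.
  by exists a => b; exact: ha.
pose N := len k b0.
have cW := @complexity n zeta N haper.
have [t tP ht] : exists2 t, t \in space_words zeta N &
    (#|[pred p : place k | place_word N p == t]| <= multiplicity)%N.
  apply: contrapT => hno.
  have hall t : t \in space_words zeta N ->
      (multiplicity.+1 <= \sum_(p : place k) (place_word N p == t))%N.
    move=> tP; rewrite ltnNge; apply/negP => h; apply: hno; exists t => //.
    apply: leq_trans h; rewrite -sum1_card big_mkcond; apply: leq_sum => p _.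
    by rewrite inE; case: eqP.
  have h1 : (N.+1 * multiplicity.+1 <= \sum_(t in space_words zeta N) \sum_(p : place k) (place_word N p == t))%N.
    apply: (@leq_trans (\sum_(t in space_words zeta N) multiplicity.+1)%N).
      by rewrite sum_nat_const leq_mul.
    exact: leq_sum.
  have h2 : (\sum_(t in space_words zeta N) \sum_(p : place k) (place_word N p == t) <= #|{: place k}|)%N.
    rewrite exchange_big -sum1_card; apply: leq_sum => p _.
    case: (pickP [pred t | (t \in space_words zeta N) && (place_word N p == val t)]) => [t /andP[tP /eqP tE]|h].
      rewrite (bigD1 t) //= tE eqxx big1 // => s /andP[_ st].
      by rewrite (inj_eq val_inj) eq_sym (negPf st).
    by rewrite big1 // => t tP; have := h t; rewrite /= tP /= => ->.
  have := leq_trans h1 h2; rewrite !card_prod !card_ord leqNgt /multiplicity => /negP; apply.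
  have := maxlen_comparable hsubst mP k b0; rewrite -/N => hc.
  apply: (@leq_ltn_trans (n.+1 * n.+1 * (maxlen zeta m * N))); first by rewrite leq_mul2l hc orbT.
  by rewrite mulnA mulnC mulSn; set a := (_ * maxlen zeta m)%N; nia.
exists N, t; split=> //; first exact: len_gt0.
  by rewrite size_tuple.
move: tP; rewrite inE => /asboolP[x Xx <-]; exact: (subst_space_legal zeta x).1 Xx _ _.
Qed.

Lemma occurs_place k N W u j :
  (forall b, (N <= len k b)%N) -> size W = N -> (j < size (inflate k u))%N ->
  occurs W (inflate k u) j ->
  exists w1 g w2 (p : place k), [/\ u = w1 ++ g :: w2, place_word N p = W,
     p.1.1 = g & j = (size (inflate k w1) + p.2)%N].
Proof.
move=> hN sW hj; have [w1 [g [w2 [r [Eu hr Et Ed]]]]] := locate hj.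
rewrite /occurs Ed sW => /eqP EW.
have rm : (r < maxlen zeta k)%N by apply: leq_trans hr (maxlen_ge _ _ _).
have Ej : j = (size (inflate k w1) + r)%N.
  have := congr1 size Et; rewrite size_takel ?(ltnW hj) // size_cat size_takel //.
  exact: ltnW.
(* If no tile follows, the occurrence ends within [g], so any letter can serve as the neighbour; [g]
   is taken. *)
have [c hc] : exists c, take N (drop r (inflate k [:: g]) ++ inflate k w2)
    = take N (drop r (inflate k [:: g]) ++ inflate k [:: c]).
  have sg c : (N <= size (drop r (inflate k [:: g]) ++ inflate k [:: c]))%N.
    by rewrite size_cat (leq_trans (hN c)) // leq_addl.
  case: w2 {Eu Ed} EW => [|c w2] EW.
    exists g; rewrite inflate_nil cats0; rewrite inflate_nil cats0 in EW.
    rewrite takel_cat // -sW -EW size_take; by case: ifP => [/ltnW|_].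
  by exists c; rewrite (inflate_cons zeta k c w2) catA takel_cat.
exists w1, g, w2, (g, c, Ordinal rm); split=> //.
by rewrite /place_word /= drop_cat hr -hc.
Qed.

(** A second moment with M = 4B + 1 characters, B being [multiplicity]. For a place [c], [T c j] is
    the sum of M powers of e(-alpha j) times the phase [q c]. If no i alpha with 0 < i < M is an
    integer, the off-diagonal correlations are twisted counts at non-integral quasi-periods and are
    negligible, so the sum of |T|^2 over the occurrences of [W] is about M per occurrence. But at
    its own place an occurrence has a base close to 1, so |T| >= M/2. Summing over at most B places
    gives M^2/4 <= BM up to a small error, which is false. *)
Lemma order_bound (alpha : R) :
  ~ nontrivial_discrete_spectrum zeta mu -> quasi_period zeta x0 alpha ->
  exists j : nat, [/\ (0 < j)%N, (j <= 4 * multiplicity)%N & e2 (j%:R * alpha) = 1].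
Proof.
move=> wm qp; apply: contrapT => hno.
pose B := multiplicity; pose M := (4 * B).+1.
have B0 : (0 < B)%N by rewrite !muln_gt0 /= maxlen_gt0.
have BR : 1 <= B%:R :> R by rewrite ler1n.
have MR : M%:R = 4 * B%:R + 1 :> R by rewrite /M -natr1 natrM.
have ne (i j : 'I_M) : i != j -> e2 (((i%:Z - j%:Z)%:~R : R) * alpha) <> 1.
  move=> ij E; apply: hno; exists (absz (i%:Z - j%:Z)); split.
  - by move: ij; rewrite -(inj_eq val_inj) /=; lia.
  - by have := ltn_ord i; have := ltn_ord j; rewrite /M; lia.
  case: (leqP j i) => hij.
    rewrite -[RHS]E; congr e2; congr (_ * _).
    by rewrite -[in RHS](gez0_abs (_ : 0 <= i%:Z - j%:Z)) //; lia.
  have -> : (absz (i%:Z - j%:Z))%:R * alpha = - ((i%:Z - j%:Z)%:~R * alpha).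
    rewrite -mulNr; congr (_ * _); rewrite -rmorphN /=.
    by rewrite -[in RHS](gez0_abs (_ : 0 <= - (i%:Z - j%:Z))) ?abszN //; lia.
  by rewrite e2N E conjc1.
have [y [C [rho [C0 rP hy1 hy2 hy3]]]] := phase_system hsubst x0_pairs x0_letters x0_legal qp.
have etaE : exp_small (@phase_err R n zeta C rho).
  apply: (exp_small_geom _ rP); case/andP: rP => r0 r1.
  have r1' : 0 <= 1 - rho by rewrite subr_ge0 ltW.
  by rewrite divr_ge0 // mulr_ge0 // addr_ge0.
have M0 : 0 < M%:R :> R by rewrite ltr0n.
have M20 : 0 < (2 * M%:R)^-1 :> R by rewrite invr_gt0 mulr_gt0.
(* A phase error of 1/(2M) keeps all M powers within 1/2 of 1, so their sum has modulus at least
   M/2. *)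
have [k hk] := exp_small_lt etaE M20.
have {}hk := hk k (leqnn k).
have [N [W [hN N0 sW lW hB]]] := few_places k.
have Wn : W != [::] by rewrite -size_eq0 sW -lt0n.
have [Q hQ] := legal_everywhere hsubst mP lW.
have hQ' b : infix W (inflate Q [:: b]) by exact: hQ.
have LQ : 0 < (maxlen zeta Q)%:R :> R by rewrite ltr0n maxlen_gt0.
have [D [t [D0 tP hD]]] : exists D t : R, [/\ 0 <= D, 0 < t < 1 &
    forall (i j : 'I_M), i != j -> forall l b,
    nc (occ_sum (((i%:Z - j%:Z)%:~R : R) * alpha) W (inflate l [:: b])) <= D * t ^+ l * (len l b)%:R].
  have H (ij : 'I_M * 'I_M) : exists h : nat -> R, exp_small h /\ (ij.1 != ij.2 -> forall l b,
    nc (occ_sum (((ij.1%:Z - ij.2%:Z)%:~R : R) * alpha) W (inflate l [:: b])) <= h l * (len l b)%:R).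
    case: (eqVneq ij.1 ij.2) => [_|nij].
      by exists (fun l => 0 * (1/2) ^+ l); split=> //; apply: exp_small_geom => //; lra.
    have [h hE hh] := occ_sum_small hsubst mP hd hmu x0_pairs x0_letters x0_legal W wm
        (ne _ _ nij) (quasi_period_mul (ij.1%:Z - ij.2%:Z) qp).
    by exists h.
  have /fin_all_exists[F hF] := H.
  have [D [t [D0 tP hD]]] := exp_small_seq (enum {: 'I_M * 'I_M}) (fun ij => (hF ij).1).
  exists D, t; split=> // i j ij l b.
  apply: le_trans ((hF (i, j)).2 ij l b) _.
  by rewrite ler_wpM2r // hD // mem_enum.
(* As M - 4B = 1, the surplus of M^2/4 over BM is M/4. With this [e] the off-diagonal terms
   contribute at most M/8 per occurrence, because [W] occurs in every tile of level [Q]. *)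
pose e : R := (8 * B%:R * M%:R * (maxlen zeta Q)%:R)^-1.
have den0 : 0 < 8 * B%:R * M%:R * (maxlen zeta Q)%:R :> R.
  by rewrite !mulr_gt0 // ltr0n.
have e0 : 0 < e by rewrite invr_gt0.
have [P hP] := exp_small_lt (exp_small_geom D0 tP) e0.
pose p := maxn P Q; pose u := inflate p [:: ord0]; pose U := inflate k u.
have EU : U = inflate (k + p) [:: ord0] by rewrite inflateD.
have off (i j : 'I_M) : i != j ->
    nc (occ_sum (((i%:Z - j%:Z)%:~R : R) * alpha) W U) <= e * (size U)%:R.
  move=> ij; rewrite EU; apply: le_trans (hD i j ij (k + p)%N ord0) _.
  rewrite ler_wpM2r // ltW //; apply: hP.
  by apply: (leq_trans (leq_maxl P Q)); exact: leq_addl.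
pose nocc := occ_count W U.
have hocc : (size U)%:R <= (maxlen zeta Q)%:R * nocc%:R :> R.
  pose v := inflate (k + p - Q) [:: ord0].
  have EUv : U = inflate Q v.
    rewrite EU /v -inflateD subnKC //.
    by apply: (leq_trans (leq_maxr P Q)); exact: leq_addl.
  rewrite -natrM ler_nat.
  apply: (@leq_trans (maxlen zeta Q * size v)).
    rewrite EUv size_inflate mulnC -sum_seq_const; apply: leq_sum => b _; exact: maxlen_ge.
  by rewrite leq_mul2l /nocc EUv occ_count_inflate ?orbT.
have U0 : 0 < (size U)%:R :> R by rewrite ltr0n EU len_gt0.
pose Y := y (k + p)%N ord0.
(* By [phase_root], e(-alpha j) times [q c] is close to 1 whenever j is an occurrence at the place
   [c]. *)
pose q (c : place k) : R[i] := Y * (y k c.1.1 * e2 (- (alpha * (c.2 : nat)%:R)))^*%C.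
have nq c : nc (q c) = 1 by rewrite ncM nc_conj ncM !hy1 nc_e2 !mulr1.
pose T c j : R[i] := \sum_(i < M) (e2 (- (alpha * j%:R)) * q c) ^+ i.
have S1 c : \sum_(0 <= j < size U | occurs W U j) nc (T c j) ^+ 2
    <= M%:R * nocc%:R + M%:R ^+ 2 * (e * (size U)%:R).
  have E : (\sum_(0 <= j < size U | occurs W U j) nc (T c j) ^+ 2)%:C =
      \sum_(i < M) \sum_(i' < M) q c ^+ i * (q c)^*%C ^+ i' *
        occ_sum (((i%:Z - i'%:Z)%:~R : R) * alpha) W U.
    rewrite rmorph_sum /=.
    transitivity (\sum_(0 <= j < size U | occurs W U j) \sum_(i < M) \sum_(i' < M)
        q c ^+ i * (q c)^*%C ^+ i' * e2 (- (((i%:Z - i'%:Z)%:~R : R) * alpha * j%:R))).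
      apply: eq_bigr => j _; rewrite -conj_mul_nc /T (rmorph_sum conjc) /= mulr_suml.
      apply: eq_bigr => i _; rewrite mulr_sumr; apply: eq_bigr => i' _.
      have cXM (z w : R[i]) l : ((z * w) ^+ l)^*%C = z^*%C ^+ l * w^*%C ^+ l.
        by rewrite rmorphXn rmorphM exprMn.
      rewrite cXM exprMn -e2N opprK.
      rewrite -!e2_mulrn mulrACA -e2D mulrC; congr (_ * e2 _).
      have -> : ((i%:Z - i'%:Z)%:~R : R) = i%:R - i'%:R.
        by rewrite intrD rmorphN /= -!pmulrn.
      by rewrite -[in LHS]mulr_natr -[X in _ + X]mulr_natr; ring.
    rewrite exchange_big; apply: eq_bigr => i _.
    rewrite exchange_big; apply: eq_bigr => i' _.
    by rewrite /occ_sum mulr_sumr.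
  have -> : \sum_(0 <= j < size U | occurs W U j) nc (T c j) ^+ 2 =
      nc ((\sum_(0 <= j < size U | occurs W U j) nc (T c j) ^+ 2)%:C : R[i]).
    by rewrite nc_real ger0_norm // sumr_ge0 // => j _; exact: sqr_ge0.
  rewrite E; apply: le_trans (nc_sum _ _ _) _.
  apply: (@le_trans _ _ (\sum_(i < M) (nocc%:R + M%:R * (e * (size U)%:R)))); last first.
    rewrite sumr_const card_ord -[leLHS]mulr_natl; rewrite mulrDr expr2 -!mulrA //.
  apply: ler_sum => i _; apply: le_trans (nc_sum _ _ _) _.
  rewrite (bigD1 i) //= lerD //.
    rewrite !ncM !ncX nc_conj nq !expr1n !mul1r subrr mul0r occ_sum0 nc_nat //.
  apply: (@le_trans _ _ (\sum_(i' < M | i' != i) e * (size U)%:R)).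
    apply: ler_sum => i' i'i.
    by rewrite !ncM !ncX nc_conj nq !expr1n !mul1r off // eq_sym.
  rewrite sumr_const -[leLHS]mulr_natl ler_wpM2r ?mulr_ge0 ?(ltW e0) //.
  by rewrite ler_nat (leq_trans (max_card _)) // card_ord.
have S2 j : (j < size U)%N -> occurs W U j -> exists2 c : place k,
    place_word N c == W & (M%:R / 2) ^+ 2 <= nc (T c j) ^+ 2.
  move=> jU oj; have [w1 [g [w2 [c [Eu pw cg Ej]]]]] := occurs_place hN sW jU oj.
  exists c; first by rewrite pw.
  have hroot := phase_root hd C0 rP hy2 hy3 k Eu.
  rewrite -/Y in hroot; set ph := e2 _ in hroot.
  have hz : nc (e2 (- (alpha * j%:R)) * q c - 1) <= (2 * M%:R)^-1.
    apply: le_trans (ltW hk); apply: le_trans hroot.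
    have Eph : e2 (- (alpha * j%:R)) = ph * e2 (- (alpha * (c.2 : nat)%:R)).
      by rewrite -e2D [in LHS]Ej natrD mulrDr opprD.
    set er := e2 (- (alpha * (c.2 : nat)%:R)) in Eph *.
    have Eer : er * er^*%C = 1 by rewrite conj_mul_nc nc_e2 expr1n.
    have Ey : y k g * (y k g)^*%C = 1 by rewrite conj_mul_nc hy1 expr1n.
    have -> : e2 (- (alpha * j%:R)) * q c - 1 = (y k g)^*%C * (ph * Y - y k g).
      rewrite /q cg (rmorphM conjc) /= -/er Eph mulrBr [_ * y k g]mulrC Ey; congr (_ - _).
      have L (a1 a2 a3 a4 a5 : R[i]) : a1 * a2 * (a3 * (a4 * a5)) = a2 * a5 * (a4 * (a1 * a3)).
        by ring.
      by rewrite L Eer mul1r.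
    by rewrite ncM nc_conj hy1 mul1r.
  rewrite lerXn2r ?nnegrE ?nc_ge0 ?divr_ge0 //.
  have nz : nc (e2 (- (alpha * j%:R)) * q c) = 1 by rewrite ncM nc_e2 nq mulr1.
  set z := e2 _ * _ in hz nz.
  have zi i : nc (z ^+ i - 1) <= i%:R * nc (z - 1).
    elim: i => [|i IH]; first by rewrite expr0 subrr nc0 mul0r.
    rewrite exprS (_ : _ - 1 = z * (z ^+ i - 1) + (z - 1)); last by ring.
    by rewrite (le_trans (ncD _ _)) // ncM nz mul1r -natr1 mulrDl mul1r lerD2r.
  have hT : nc (M%:R - T c j) <= M%:R / 2.
    rewrite ncB.
    have -> : T c j - M%:R = \sum_(i < M) (z ^+ i - 1).
      by rewrite sumrB sumr_const card_ord.
    apply: le_trans (nc_sum _ _ _) _.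
    apply: (@le_trans _ _ (\sum_(i < M) M%:R * (2 * M%:R)^-1)).
      apply: ler_sum => i _; apply: le_trans (zi i) _; apply: ler_pM => //; first exact: nc_ge0.
      by rewrite ler_nat ltnW.
    rewrite sumr_const card_ord -[leLHS]mulr_natl le_eqVlt; apply/orP; left; apply/eqP.
    by field; rewrite gt_eqF.
  have := nc_ler_sub (M%:R : R[i]) (T c j); rewrite nc_nat; lra.
have S3 : nocc%:R * (M%:R / 2) ^+ 2 <= B%:R * (M%:R * nocc%:R + M%:R ^+ 2 * (e * (size U)%:R)).
  apply: (@le_trans _ _ (\sum_(0 <= j < size U | occurs W U j)
      \sum_(c : place k | place_word N c == W) nc (T c j) ^+ 2)).
    have -> : nocc%:R * (M%:R / 2) ^+ 2 = \sum_(0 <= j < size U | occurs W U j) (M%:R / 2) ^+ 2 :> R.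
      rewrite /nocc /occ_count natr_sum mulr_suml [RHS]big_mkcond; apply: eq_bigr => j _.
      by case: (occurs W U j); rewrite ?mul1r ?mul0r.
    rewrite big_nat_cond [leRHS]big_nat_cond; apply: ler_sum => j /andP[/andP[_ jU] oj].
    have [c cW hc] := S2 j jU oj.
    by rewrite (bigD1 c) //= (le_trans hc) // lerDl sumr_ge0 // => c' _; exact: sqr_ge0.
  rewrite exchange_big /=.
  apply: (@le_trans _ _ (\sum_(c : place k | place_word N c == W)
      (M%:R * nocc%:R + M%:R ^+ 2 * (e * (size U)%:R)))).
    by apply: ler_sum => c _; exact: S1.
  rewrite sumr_const -[leLHS]mulr_natl ler_wpM2r //.
    by rewrite addr_ge0 ?mulr_ge0 ?(ltW e0) ?exprn_ge0.
  by rewrite ler_nat.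
have Ee : M%:R * B%:R * e * (maxlen zeta Q)%:R = 1 / 8.
  by rewrite /e; field; rewrite !gt_eqF // ltr0n.
have h4 : M%:R / 4 * nocc%:R <= B%:R * M%:R ^+ 2 * e * (size U)%:R.
  have : M%:R / 4 * nocc%:R = nocc%:R * (M%:R / 2) ^+ 2 - B%:R * M%:R * nocc%:R :> R.
    by rewrite MR; field.
  move=> ->; rewrite lerBlDr (le_trans S3) // le_eqVlt; apply/orP; left; apply/eqP; ring.
have n0 : 0 < nocc%:R :> R.
  by rewrite -(pmulr_rgt0 _ LQ) (lt_le_trans U0).
have h5 : B%:R * M%:R ^+ 2 * e * (size U)%:R <= M%:R * (1 / 8) * nocc%:R.
  apply: (@le_trans _ _ (B%:R * M%:R ^+ 2 * e * ((maxlen zeta Q)%:R * nocc%:R))).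
    by rewrite ler_wpM2l // !mulr_ge0 ?(ltW e0) ?exprn_ge0.
  rewrite -Ee le_eqVlt; apply/orP; left; apply/eqP; ring.
have := le_trans h4 h5; have := mulr_gt0 M0 n0; lra.
Qed.

End order_bound.

(** * Integrality of quasi-periods *)

Section krylov.
Variables (F : fieldType) (n : nat) (A : 'M[F]_n.+1).
Hypothesis hirr : irreducible_poly (char_poly A).

(** For degree reasons [p] is coprime to the irreducible characteristic polynomial; evaluating a
    Bezout relation at [A] yields an inverse by the Cayley-Hamilton theorem. *)
Lemma irreducible_horner_unit (p : {poly F}) :
  p != 0 -> (size p <= n.+1)%N -> horner_mx A p \in unitmx.
Proof.
move=> p0 sp.
have cop : coprimep p (char_poly A).
  rewrite /coprimep; apply/negPn/negP => g1.
  have := hirr.2 _ g1 (dvdp_gcdr _ _) => /eqp_size sg.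
  have := dvdp_leq p0 (dvdp_gcdl p (char_poly A)).
  by rewrite sg size_char_poly leqNgt ltnS sp.
have /Bezout_eq1_coprimepP[[u v] /= E] := cop.
have : horner_mx A u * horner_mx A p = 1.
  have := congr1 (horner_mx A) E.
  by rewrite rmorphD !rmorphM /= Cayley_Hamilton mulr0 addr0 rmorph1.
by move=> /mulmx1_unit[].
Qed.

(** A dependence among the rows D A^j reads D p(A) = 0 with p(A) invertible, so every nonzero row is
    cyclic. *)
Lemma krylov_span (D t : 'rV[F]_n.+1) : D != 0 ->
  exists r : 'I_n.+1 -> F, t = \sum_(j < n.+1) r j *: (D *m A ^+ j).
Proof.
move=> D0; pose K : 'M[F]_n.+1 := \matrix_(j < n.+1) (D *m A ^+ j).
pose pc (c : 'rV[F]_n.+1) := \poly_(j < n.+1) c 0 (inord j).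
have comb (c : 'rV[F]_n.+1) : c *m K = D *m horner_mx A (pc c).
  rewrite mulmx_sum_row /pc poly_def linear_sum /= mulmx_sumr.
  apply: eq_bigr => j _; rewrite rowK linearZ /= rmorphXn /= horner_mx_X inord_val.
  by rewrite scalemxAr.
have Ku : K \in unitmx.
  rewrite -row_free_unit -kermx_eq0; apply/rowV0P => c /sub_kermxP; rewrite comb => h.
  apply/eqP/negPn/negP => c0.
  have p0 : pc c != 0.
    apply: contraNneq c0 => h0; apply/eqP/rowP => j; rewrite mxE.
    have := congr1 (fun p : {poly F} => p`_j) h0.
    by rewrite coef_poly ltn_ord inord_val coef0.
  have := mulmxK (irreducible_horner_unit p0 (size_poly _ _)) D.
  by rewrite h mul0mx => /esym/eqP; rewrite (negPf D0).
exists (fun j => (t *m invmx K) 0 j).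
by rewrite -{1}[t](mulmxKV Ku) mulmx_sum_row; apply: eq_bigr => j _; rewrite rowK.
Qed.

End krylov.

Section substitution_matrix.
Variables (R : realType) (n : nat) (zeta : 'I_n.+1 -> seq 'I_n.+1).
Local Notation inflate := (inflate zeta).
Local Notation len := (len zeta).
Local Notation S := (subst_matrix zeta).
Hypothesis hsubst : is_substitution zeta.
Hypothesis hirr : irreducible_poly (char_poly (map_mx intr S : 'M[rat]_n.+1)).

Lemma len_matrix k b : (len k b)%:Z = \sum_i (S ^+ k) i b.
Proof.
have -> : len k b = (\sum_i count_mem i (inflate k [:: b]))%N.
  rewrite /len; elim: (inflate k [:: b]) => [|c u IH] /=; first by rewrite big1.
  rewrite big_split /= -IH (bigD1 c) //= eqxx big1 // => i /negPf.
  by rewrite eq_sym => ->.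
rewrite (big_morph Posz PoszD (erefl _)); apply: eq_bigr => i _.
by rewrite count_inflate big_seq1.
Qed.

(** If [D] were nonzero, the row of ones would be a rational combination of the D S^j. Multiplied by
    S^k, it gives the tile lengths themselves, which would then be negligible compared with tile
    lengths. *)
Lemma row_small_zero (D : 'rV[int]_n.+1) (h : nat -> R) :
  exp_small h -> (forall j b, `|((D *m S ^+ j) 0 b)%:~R| <= h j * (len j b)%:R) ->
  D = 0.
Proof.
move=> hE hD; apply/eqP/negPn/negP => D0.
pose Sq : 'M[rat]_n.+1 := map_mx intr S.
pose Dq : 'rV[rat]_n.+1 := map_mx intr D.
have Dq0 : Dq != 0.
  apply: contraNneq D0 => /rowP h0; apply/eqP/rowP => j.
  by have := h0 j; rewrite !mxE => /eqP; rewrite intr_eq0 => /eqP.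
have [r hr] := krylov_span hirr (const_mx 1) Dq0.
have EX k : Sq ^+ k = map_mx intr (S ^+ k) by rewrite rmorphXn.
have hlen k b : (len k b)%:R = \sum_(j < n.+1) ratr (r j) * ((D *m S ^+ (j + k)) 0 b)%:~R :> R.
  have E : ((len k b)%:R : rat) = \sum_(j < n.+1) r j * ((D *m S ^+ (j + k)) 0 b)%:~R.
    have <- : ((const_mx 1 : 'rV_n.+1) *m Sq ^+ k) 0 b = (len k b)%:R.
      rewrite mxE [RHS](pmulrn 1 (len k b)) len_matrix (rmorph_sum (intr : int -> rat)) /=.
      by apply: eq_bigr => i _; rewrite EX !mxE mul1r.
    rewrite hr mulmx_suml summxE; apply: eq_bigr => j _.
    have ES : Sq ^+ j *m Sq ^+ k = map_mx intr (S ^+ (j + k)) by rewrite -EX exprD.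
    by rewrite -scalemxAl mxE -mulmxA ES -map_mxM mxE.
  rewrite -[LHS](ratr_nat R) E rmorph_sum; apply: eq_bigr => j _.
  by rewrite rmorphM /= ratr_int.
have [C [rho [C0 rP hC]]] := hE.
pose s : R := \sum_(j < n.+1) `|ratr (r j)| * (maxlen zeta j)%:R.
have s0 : 0 <= s by apply: sumr_ge0 => j _; rewrite mulr_ge0.
have [k hk] := exp_small_lt (exp_small_geom (mulr_ge0 s0 C0) rP) (@ltr01 R).
have {hk} := hk k (leqnn k); rewrite ltNge => /negP; apply.
have L0 : 0 < (len k ord0)%:R :> R by rewrite ltr0n len_gt0.
rewrite -(ler_pM2r L0) mul1r {1}hlen /s !mulr_suml; apply: ler_sum => j _.
apply: le_trans (ler_norm _) _; rewrite normrM -!mulrA ler_wpM2l //.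
apply: le_trans (hD _ _) _.
have hl : (len (j + k) ord0)%:R <= (maxlen zeta j)%:R * (len k ord0)%:R :> R.
  rewrite -natrM ler_nat lenD mulnC -sum_seq_const; apply: leq_sum => c _; exact: maxlen_ge.
have hh : h (j + k)%N <= C * rho ^+ k.
  apply: le_trans (hC _) _; rewrite ler_wpM2l // exprD; case/andP: rP => r0 r1.
  by rewrite ler_piMl ?exprn_ge0 ?exprn_ile1 ?ltW.
apply: (@le_trans _ _ (C * rho ^+ k * (len (j + k) ord0)%:R)); first by rewrite ler_wpM2r.
have Ck : 0 <= C * rho ^+ k by rewrite mulr_ge0 // exprn_ge0 //; case/andP: rP => /ltW.
apply: le_trans (ler_wpM2l Ck hl) _.
rewrite le_eqVlt; apply/orP; left; apply/eqP; ring.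
Qed.

End substitution_matrix.

(** * Letters counted in residue classes of positions *)

Section letter_counts.
Variable n : nat.
Local Notation letter := 'I_n.+1.
Implicit Types (a : letter) (u v : seq letter).

Lemma occurs1_cat a u v (F : nat -> nat) :
  (\sum_(0 <= i < size (u ++ v)) occurs [:: a] (u ++ v) i * F i =
   \sum_(0 <= i < size u) occurs [:: a] u i * F i +
   \sum_(0 <= i < size v) occurs [:: a] v i * F (i + size u))%N.
Proof.
rewrite size_cat (@big_cat_nat _ _ _ (size u)) ?leq_addr //=.
rewrite [X in (_ + X)%N](sum_nat_shift xpredT); congr (_ + _)%N.
  rewrite !big_mkord; apply: eq_bigr => i _.
  rewrite /occurs drop_cat ltn_ord takel_cat //.
  by rewrite size_drop subn_gt0.
apply: eq_bigr => i _.
by rewrite /occurs drop_cat ltnNge leq_addl /= addnK.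
Qed.

Variable p : nat.

(** [t] is the position, modulo [p], at which [u] begins in a longer word, whence the rule for
    concatenation. *)
Definition phase_count a t u : nat :=
  \sum_(0 <= i < size u) occurs [:: a] u i * (p %| i + t).

Lemma phase_count_nil a t : phase_count a t [::] = 0%N.
Proof. by rewrite /phase_count big_geq. Qed.

Lemma phase_count_cat a t u v :
  phase_count a t (u ++ v) = (phase_count a t u + phase_count a (t + size u) v)%N.
Proof.
rewrite /phase_count occurs1_cat; congr (_ + _)%N; apply: eq_bigr => i _.
by rewrite -addnA [(size u + _)%N]addnC.
Qed.

Lemma phase_count_mod a t t' u : t = t' %[mod p] -> phase_count a t u = phase_count a t' u.
Proof.
move=> E; apply: eq_bigr => i _; congr (_ * nat_of_bool _)%N.
by rewrite /dvdn -modnDmr E modnDmr.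
Qed.

Hypothesis p0 : (0 < p)%N.

Lemma phase_count_sum a u : (\sum_(t < p) phase_count a t u)%N = count_mem a u.
Proof.
elim: u => [|b u IH].
  by rewrite /= big1 // => t _; rewrite phase_count_nil.
rewrite -cat1s.
have E : (\sum_(t < p) phase_count a t ([:: b] ++ u) =
  \sum_(t < p) phase_count a t [:: b] + \sum_(t < p) phase_count a (t + 1) u)%N.
  by rewrite -big_split; apply: eq_bigr => t _; rewrite phase_count_cat.
rewrite {}E count_cat -IH; congr (_ + _)%N.
  have E t : phase_count a t [:: b] = ((b == a) * (p %| t))%N.
    by rewrite /phase_count big_nat1 /occurs /= eqseq_cons andbT.
  under eq_bigr do rewrite E.
  rewrite -big_distrr /= addn0 -[RHS]muln1; congr (_ * _)%N.
  rewrite (bigD1 (Ordinal p0)) //= dvdn0 big1 // => t t0.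
  rewrite gtnNdvd //; by rewrite lt0n.
pose f (t : 'I_p) : 'I_p := Ordinal (ltn_pmod (t + 1) p0).
have fi : injective f.
  move=> s t /(congr1 val) /= /eqP; rewrite eqn_modDr => /eqP.
  by rewrite !modn_small //; exact: val_inj.
rewrite [RHS](reindex_inj fi) /=; apply: eq_bigr => t _.
by apply: phase_count_mod; rewrite modn_mod.
Qed.

End letter_counts.

Section roots_of_unity.
Variable R : realType.

Lemma sum_roots (p i : nat) : (0 < p)%N ->
  \sum_(s < p) e2 (s%:R / p%:R * i%:R : R) = ((p %| i) * p)%N%:R.
Proof.
move=> p0; have pR : p%:R != 0 :> R by rewrite pnatr_eq0 -lt0n.
pose w : R[i] := e2 (i%:R / p%:R : R).
have E (s : nat) : e2 (s%:R / p%:R * i%:R : R) = w ^+ s.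
  by rewrite /w -e2_mulrn -mulr_natr; congr e2; field.
under eq_bigr do rewrite E.
case: (boolP (p %| i)%N) => [/dvdnP[q Eq]|ndvd].
  have -> : w = 1 by rewrite /w Eq natrM mulfK // e2_nat.
  under eq_bigr do rewrite expr1n.
  by rewrite sumr_const card_ord mul1n.
have w1 : w - 1 != 0.
  rewrite subr_eq0; apply: contra ndvd => /eqP /e2_eq1[z Ez].
  have : (i%:Z : int) = z * p%:Z.
    apply: (@mulrIz R 1 _ _ _); first exact: oner_neq0.
    rewrite intrM -Ez -!pmulrn divfK //.
  move=> Ei; have : (p%:Z %| i%:Z)%Z by rewrite Ei dvdz_mull.
  by [].
have E0 : (w - 1) * (\sum_(s < p) w ^+ s) = 0.
  by rewrite -subrX1 /w -e2_mulrn -[_ *+ p]mulr_natr divfK // e2_nat subrr.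
move/eqP: E0; rewrite mulf_eq0 (negPf w1) /= => /eqP ->.
by rewrite mul0n.
Qed.

(** Fourier inversion modulo [p]. The mode s = 0 does not depend on [t]; the other modes are twisted
    counts at the fractions -s/p. *)
Lemma phase_count_dft (n p : nat) (a : 'I_n.+1) t u : (0 < p)%N ->
  (p * phase_count p a t u)%N%:R = \sum_(s < p)
     e2 (s%:R / p%:R * t%:R : R) * occ_sum (- (s%:R / p%:R)) [:: a] u.
Proof.
move=> p0; rewrite /phase_count natrM natr_sum mulr_sumr.
transitivity (\sum_(0 <= i < size u) \sum_(s < p)
   (occurs [:: a] u i)%:R * e2 (s%:R / p%:R * (i + t)%N%:R : R)).
  apply: eq_bigr => i _; rewrite -mulr_sumr sum_roots // !natrM; ring.
rewrite exchange_big; apply: eq_bigr => s _ /=.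
rewrite /occ_sum mulr_sumr [RHS]big_mkcond; apply: eq_bigr => i _.
case: (occurs _ _ _); last by rewrite mul0r.
by rewrite mul1r -e2D natrD; congr e2; ring.
Qed.

End roots_of_unity.

Section integrality.
Variables (R : realType) (n : nat) (zeta : 'I_n.+1 -> seq 'I_n.+1).
Local Notation letter := 'I_n.+1.
Local Notation inflate := (inflate zeta).
Local Notation len := (len zeta).
Local Notation legal := (legal zeta).
Local Notation S := (subst_matrix zeta).
Hypothesis hsubst : is_substitution zeta.
Variable m : nat.
Hypothesis mP : forall a b, a \in inflate m [:: b].
Hypothesis hd : (2 <= n.+1)%N.
Variable mu : probability (borel_shift n) R.
Hypothesis hmu : invariant_probability zeta mu.
Variable x0 : seq letter.
Hypothesis x0_pairs : forall b c, legal [:: b; c] -> infix [:: b; c] x0.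
Hypothesis x0_letters : forall b, b \in x0.
Hypothesis x0_legal : legal x0.
Hypothesis haper : aperiodic zeta.
Hypothesis hirr : irreducible_poly (char_poly (map_mx intr S : 'M[rat]_n.+1)).
Hypothesis wm : ~ nontrivial_discrete_spectrum zeta mu.

Section prime_period.
Variables p k : nat.
Hypothesis p1 : (1 < p)%N.
Hypothesis hp : forall l v, (k <= l)%N -> return_word x0 v -> (p %| size (inflate l v))%N.

(** The counterpart of the phases when 1/p is a quasi-period: modulo [p], the position of a tile of
    type [b] and level [k] relative to [x0], here without any error. *)
Definition residue b := size (inflate k (take (index b x0) x0)).

Lemma residue_split P b q : x0 = P ++ b :: q ->
  size (inflate k P) = residue b %[mod p].
Proof.
move=> E; have [v [-> [->|rv]]] := prefix_return_word E; first by rewrite cats0.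
rewrite inflate_cat size_cat; have /dvdnP[c ->] := hp (leqnn k) rv.
by rewrite addnC modnMDl.
Qed.

Lemma residue_pair b c : legal [:: b; c] -> residue b + len k b = residue c %[mod p].
Proof.
move=> /x0_pairs/infixP[P [q E]].
rewrite -modnDml -(residue_split (E : x0 = P ++ b :: c :: q)) modnDml.
have := @residue_split (P ++ [:: b]) c q; rewrite -catA => /(_ E).
by rewrite inflate_cat size_cat.
Qed.

Lemma residue_path u b : legal (u ++ [:: b]) ->
  residue (head b u) + size (inflate k u) = residue b %[mod p].
Proof.
elim: u => [|a u IH] h; first by rewrite inflate_nil addn0.
rewrite inflate_cons size_cat addnA -modnDml (residue_pair (c := head b u)) /=.
  rewrite modnDml; apply: IH.
  by apply: legal_infix h; exact: (infix_cons (u ++ [:: b]) a).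
apply: legal_infix h; case: u {IH} => [|c u]; first exact: infix_refl.
exact: (prefix_infix [:: a; c]).
Qed.

Lemma phase_count_tiles a t d u : legal u ->
  phase_count p a (t + residue (head d u)) (inflate k u) =
  (\sum_(g <- u) phase_count p a (t + residue g) (inflate k [:: g]))%N.
Proof.
elim/last_ind: u => [_|u g IH]; first by rewrite inflate_nil big_nil phase_count_nil.
rewrite -cats1 => h.
have lu : legal u by apply: legal_infix h; exact: prefix_infix.
have := residue_path h.
have hE : head d (u ++ [:: g]) = head g u by case: (u).
rewrite hE big_cat big_seq1 /= inflate_cat phase_count_cat => hr; congr (_ + _)%N.
  case: u {h hr hE} lu IH => [|c u] lu IH; last exact: IH.
  by rewrite inflate_nil phase_count_nil big_nil.
by apply: phase_count_mod; rewrite -addnA -modnDmr hr modnDmr.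
Qed.

(** The row [D t] counts the letter [a] in the tiles of level [k] at positions of one residue class,
    and [D t *m S ^+ j] does so at level k + j. In the absence of eigenvalues the classes become
    equally frequent with geometric error, so differences of these rows are integral and relatively
    small, hence zero by [row_small_zero]. The classes are thus equally populated already at level
    [k], and the total count is [p] times one of them. *)
Lemma matrix_divisible a b : (p%:Z %| (S ^+ k) a b)%Z.
Proof.
have p0 : (0 < p)%N by exact: ltnW.
have pR : p%:R != 0 :> R by rewrite pnatr_eq0 -lt0n.
have pRp : 0 < p%:R :> R by rewrite ltr0n.
pose D t : 'rV[int]_n.+1 := \row_g (phase_count p a (t + residue g) (inflate k [:: g]))%:Z.
have DS t j g : (D t *m S ^+ j) 0 g =
    (phase_count p a (t + residue (head ord0 (inflate j [:: g]))) (inflate (k + j) [:: g]))%:Z.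
  rewrite inflateD (phase_count_tiles _ _ _ (legal_inflate zeta j g)).
  rewrite (big_morph Posz PoszD (erefl _)) sumr_count mxE; apply: eq_bigr => l _.
  by rewrite mxE natz count_inflate big_seq1.
have nint s : (0 < s < p)%N -> e2 (- (s%:R / p%:R : R)) <> 1.
  move=> /andP[s0 sp] /e2_eq1[z hz].
  have h1 : - 1 < z%:~R :> R by rewrite -hz ltrN2 ltr_pdivrMr // mul1r ltr_nat.
  have h2 : z%:~R < 0 :> R by rewrite -hz oppr_lt0 divr_gt0 ?ltr0n.
  have : (-1 < z)%R by rewrite -(ltr_int R) rmorphN.
  by have : (z < 0)%R; [rewrite -(ltr_int R)|lia].
have qp s : quasi_period zeta x0 (- (s%:R / p%:R : R)).
  have := quasi_period_mul (- s%:Z) (quasi_period_divisible R p0 hp).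
  by rewrite mulrNz -pmulrn mulNr.
have [C [rho [C0 rP hC]]] : exists C rho : R, [/\ 0 <= C, 0 < rho < 1 & forall s, (0 < s < p)%N ->
    forall l b, nc (occ_sum (- (s%:R / p%:R)) [:: a] (inflate l [:: b])) <= C * rho ^+ l * (len l b)%:R].
  have H (s : 'I_p) : exists h : nat -> R, exp_small h /\ ((0 < s)%N -> forall l b,
     nc (occ_sum (- (s%:R / p%:R)) [:: a] (inflate l [:: b])) <= h l * (len l b)%:R).
    case: (posnP s) => s0.
      by exists (fun l => 0 * (1/2) ^+ l); split=> //; apply: exp_small_geom => //; lra.
    have sp : (0 < s < p)%N by rewrite s0 ltn_ord.
    have [h hE hh] := occ_sum_small hsubst mP hd hmu x0_pairs x0_letters x0_legal [:: a] wm
      (nint s sp) (qp s).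
    by exists h.
  have /fin_all_exists[F hF] := H.
  have [C [rho [C0 rP hC]]] := exp_small_seq (enum 'I_p) (fun s => (hF s).1).
  exists C, rho; split=> // s /andP[s0 sp] l c.
  apply: le_trans ((hF (Ordinal sp)).2 s0 l c) _.
  by rewrite ler_wpM2r // hC // mem_enum.
have rho0 l : 0 <= rho ^+ l by rewrite exprn_ge0 //; case/andP: rP => /ltW.
have diff t t' l c : `|(phase_count p a t (inflate l [:: c]))%:R
    - (phase_count p a t' (inflate l [:: c]))%:R| <= 2 * (C * rho ^+ l * (len l c)%:R) :> R.
  set u := inflate l [:: c].
  have B0 : 0 <= C * rho ^+ l * (len l c)%:R by rewrite !mulr_ge0.
  rewrite -(ler_pM2l pRp) -[X in X * `|_|](ger0_norm (ler0n R p)) -normrM.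
  rewrite -nc_real.
  have -> : (p%:R * ((phase_count p a t u)%:R - (phase_count p a t' u)%:R) : R)%:C =
      (p * phase_count p a t u)%N%:R - (p * phase_count p a t' u)%N%:R :> R[i].
    by rewrite rmorphM rmorphB /= !rmorph_nat mulrBr !natrM.
  rewrite !phase_count_dft // -sumrB.
  apply: le_trans (nc_sum _ _ _) _.
  apply: (@le_trans _ _ (\sum_(s < p) 2 * (C * rho ^+ l * (len l c)%:R))).
    apply: ler_sum => s _; rewrite -mulrBl ncM.
    case: (posnP s) => s0.
      by rewrite s0 !mul0r subrr nc0 mul0r mulr_ge0.
    apply: ler_pM; rewrite ?nc_ge0 //.
      by rewrite (le_trans (ncD _ _)) // ncN !nc_e2.
    by apply: hC; rewrite s0 ltn_ord.
  by rewrite sumr_const card_ord -[leLHS]mulr_natl.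
have D_eq t t' : D t = D t'.
  apply/eqP; rewrite -subr_eq0; apply/eqP.
  apply: (@row_small_zero R n zeta hsubst hirr (D t - D t') (fun j => 2 * C * (maxlen zeta k)%:R * rho ^+ j)).
    by apply: exp_small_geom => //; rewrite !mulr_ge0.
  move=> j g; rewrite mulmxBl !mxE -!/(fun_of_matrix _ _ _).
  have -> : (\sum_j0 D t 0 j0 * (S ^+ j) j0 g) = (D t *m S ^+ j) 0 g by rewrite mxE.
  have -> : (\sum_j0 D t' 0 j0 * (S ^+ j) j0 g) = (D t' *m S ^+ j) 0 g by rewrite mxE.
  rewrite !DS intrB -!pmulrn; apply: le_trans (diff _ _ _ _) _.
  rewrite -!mulrA ler_wpM2l // ler_wpM2l // [leRHS]mulrCA exprD -!mulrA.
  case/andP: rP => r0 r1.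
  apply: (@le_trans _ _ (1 * (rho ^+ j * (len (k + j) g)%:R))).
    by rewrite ler_wpM2r ?mulr_ge0 // exprn_ile1 // ltW.
  rewrite mul1r ler_wpM2l // -natrM ler_nat lenD mulnC -sum_seq_const.
  apply: leq_sum => c _; exact: maxlen_ge.
(* Adding p minus the residue of [b] cancels the shift built into the rows, so any [t] can be
   compared with the row for 0. *)
have cnt t : phase_count p a t (inflate k [:: b]) = phase_count p a (0 + residue b) (inflate k [:: b]).
  have /rowP/(_ b) := D_eq (t + (p - residue b %% p))%N 0%N.
  rewrite !mxE => -[<-]; apply: phase_count_mod.
  rewrite -addnA -modnDmr -[X in (t + X)%N](modnDmr) -modnDmr.
  have -> : (p - residue b %% p + residue b %% p = p)%N by rewrite subnK // ltnW // ltn_pmod.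
  by rewrite modnn mod0n addn0.
have -> : (S ^+ k) a b = (count_mem a (inflate k [:: b]))%:Z.
  by rewrite count_inflate big_seq1.
rewrite -(phase_count_sum p0); under eq_bigr do rewrite cnt.
by rewrite sum_nat_const card_ord PoszM dvdz_mulr.
Qed.

End prime_period.

Lemma matrix_power_divisible (p k l : nat) :
  (forall a b, (p%:Z %| (S ^+ k) a b)%Z) ->
  forall j a b, (k * l <= j)%N -> ((p ^ l)%N%:Z %| (S ^+ j) a b)%Z.
Proof.
move=> h; elim: l => [|l IH] j a b hj; first by rewrite expn0 dvd1z.
have -> : j = (k + (j - k))%N by rewrite subnKC // (leq_trans _ hj) // leq_pmulr.
rewrite exprD -mulmxE mxE.
apply: (big_ind (fun x : int => ((p ^ l.+1)%N%:Z %| x)%Z)) => [|x y|c _]; first exact: dvdz0.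
  exact: rpredD.
rewrite expnS PoszM dvdz_mul // IH //.
by rewrite mulnS in hj; lia.
Qed.

Lemma size_divisible (p l k0 : nat) :
  (forall a b j, (k0 <= j)%N -> ((p ^ l)%N%:Z %| (S ^+ j) a b)%Z) ->
  forall j v, (k0 <= j)%N -> (p ^ l %| size (inflate j v))%N.
Proof.
move=> h j v kj; rewrite size_inflate.
apply: (big_ind (fun x => p ^ l %| x)%N) => [|x y|c _]; first exact: dvdn0.
  exact: dvdn_add.
have : ((p ^ l)%N%:Z %| (len j c)%:Z)%Z.
  rewrite len_matrix.
  by apply: (big_ind (fun x : int => ((p ^ l)%N%:Z %| x)%Z)) => [|x y|a _]; [exact: dvdz0|exact: rpredD|exact: h].
by [].
Qed.

Lemma quasi_period_eventually (p : nat) : (0 < p)%N ->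
  quasi_period zeta x0 (p%:R^-1 : R) ->
  exists k, forall l v, (k <= l)%N -> return_word x0 v -> (p %| size (inflate l v))%N.
Proof.
move=> p0 /quasi_period_unif[C [rho [C0 rP hC]]].
have pR : 0 < p%:R :> R by rewrite ltr0n.
have pV : 0 < p%:R^-1 :> R by rewrite invr_gt0.
have [k hk] := exp_small_lt (exp_small_geom C0 rP) pV.
exists k => l v kl rv; have [z hz] := hC v rv l.
have {hz} := le_lt_trans hz (hk l kl).
rewrite -(ltr_pM2l pR) -[X in X * `|_|](ger0_norm (ltW pR)) -normrM mulrBr mulVKf ?gt_eqF //.
rewrite divff ?gt_eqF // => h.
have : (`|(size (inflate l v))%:Z - p%:Z * z| < 1)%R.
  by rewrite -(ltr_int R) intr_norm rmorphB rmorphM /= -!pmulrn.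
move=> h1; have E : (size (inflate l v))%:Z = p%:Z * z by lia.
have : (p%:Z %| (size (inflate l v))%:Z)%Z by rewrite E dvdz_mulr.
by [].
Qed.

(** [order_bound] makes [alpha] rational. If its least denominator j exceeds 1, choose a prime p
    dividing j; a Bezout relation writes 1/p as an integer multiple of [alpha] plus an integer, so
    1/p is itself a quasi-period. *)
Lemma quasi_period_integral (alpha : R) : quasi_period zeta x0 alpha ->
  exists z : int, alpha = z%:~R.
Proof.
move=> qp; apply: contrapT => nz.
have [j0 [j00 _ /e2_eq1[z0 hz0]]] := order_bound hsubst mP hd hmu x0_pairs x0_letters x0_legal haper wm qp.
have ex : exists j, (0 < j)%N && `[< exists z : int, j%:R * alpha = z%:~R >].
  by exists j0; rewrite j00; apply/asboolP; exists z0.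
have := ex_minnP ex; case=> j /andP[j0' /asboolP[z hz]] jmin.
have j1 : (1 < j)%N.
  rewrite ltn_neqAle j0' andbT; apply/eqP => E; apply: nz; exists z.
  by rewrite -hz -E mul1r.
pose p := pdiv j; have pp : prime p by exact: pdiv_prime.
have /dvdnP[l Ej] : (p %| j)%N by exact: pdiv_dvd.
have p0 := prime_gt0 pp; have p1 := prime_gt1 pp.
have l0 : (0 < l)%N by move: j0'; rewrite Ej muln_gt0 => /andP[].
have pR : p%:R != 0 :> R by rewrite pnatr_eq0 -lt0n.
have npz : ~~ (p%:Z %| z)%Z.
  apply/negP => /dvdzP[q Eq].
  have : (j <= l)%N.
    apply: jmin; rewrite l0; apply/asboolP; exists q.
    apply: (mulfI pR); rewrite mulrA -natrM mulnC -Ej hz Eq intrM mulrC -pmulrn //.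
  rewrite Ej leqNgt => /negP; apply; by rewrite ltn_Pmulr.
have [s [t Est]] : exists s t : int, s * z + t * p%:Z = 1.
  have cop : coprimez p%:Z z.
    by rewrite coprimezE prime_coprime.
  have [t [s Ets]] := Bezoutz p%:Z z; exists s, t; rewrite addrC Ets; exact/eqP.
have qpp : quasi_period zeta x0 (p%:R^-1 : R).
  have E : (p%:R^-1 : R) = (s * l%:Z)%:~R * alpha + t%:~R.
    apply: (mulfI pR); rewrite divff // mulrDr.
    have -> : p%:R * ((s * l%:Z)%:~R * alpha) = s%:~R * (j%:R * alpha).
      by rewrite Ej natrM intrM -pmulrn; ring.
    rewrite hz -intrM [p%:R * _]mulrC [X in _ + _ * X]pmulrn -intrM -intrD Est //.
  have q1 := quasi_period_mul (s * l%:Z) qp.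
  move=> v /q1[eps epsE heps]; exists eps => // k; have [y hy] := heps k.
  exists (y + t * (size (inflate k v))%:Z); rewrite E.
  rewrite (_ : _ - _ = (s * l%:Z)%:~R * alpha * (size (inflate k v))%:R - y%:~R) //.
  by rewrite intrD [(t * _)%:~R]intrM -[((size _)%:Z)%:~R]pmulrn; ring.
have [k hk] := quasi_period_eventually p0 qpp.
have hS := matrix_divisible p1 hk.
(* The bound on orders also serves as the exponent, because e < p^e. *)
pose e := (4 * multiplicity zeta m)%N.
have hl : (e < p ^ e)%N by exact: ltn_expl.
have pe0 : (0 < p ^ e)%N by rewrite expn_gt0 p0.
have peR : (p ^ e)%:R != 0 :> R by rewrite pnatr_eq0 -lt0n.
have qpe : quasi_period zeta x0 ((p ^ e)%:R^-1 : R).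
  apply: (quasi_period_divisible R (k0 := (k * e)%N)) => // i v ki _.
  by apply: (size_divisible (k0 := (k * e)%N)) => // a b i' hi'; exact: matrix_power_divisible hi'.
have [i [i0 ie /e2_eq1[y hy]]] := order_bound hsubst mP hd hmu x0_pairs x0_letters x0_legal haper wm qpe.
have h1 : 0 < y%:~R :> R by rewrite -hy divr_gt0 ?ltr0n.
have h2 : y%:~R < 1 :> R.
  by rewrite -hy ltr_pdivrMr ?ltr0n // mul1r ltr_nat (leq_ltn_trans ie).
rewrite ltr0z in h1; rewrite (ltrz1 R) in h2; lia.
Qed.

End integrality.

(** * Liouville's inequality and Diophantine approximation *)

Section integer_eigenvalues.
Variable R : realType.
Local Notation C := R[i].

Definition mxsum m (N : 'M[int]_m) : R := \sum_i \sum_j `|N i j|%:~R.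

Lemma mxsum_ge0 m (N : 'M[int]_m) : 0 <= mxsum N.
Proof. by apply: sumr_ge0 => i _; apply: sumr_ge0 => j _; rewrite ler0z. Qed.

Lemma nc_int (z : int) : nc (z%:~R : C) = `|z|%:~R.
Proof.
have -> : (z%:~R : C) = (z%:~R : R)%:C by rewrite rmorph_int.
by rewrite nc_real intr_norm.
Qed.

Lemma entry_le_mxsum m (N : 'M[int]_m) i j : `|N i j|%:~R <= mxsum N.
Proof.
rewrite /mxsum (bigD1 i) //= (bigD1 j) //= -addrA lerDl addr_ge0 //.
  by apply: sumr_ge0 => k _; rewrite ler0z.
by apply: sumr_ge0 => k _; apply: sumr_ge0 => l _; rewrite ler0z.
Qed.

Lemma eigenvalue_le_mxsum m (N : 'M[int]_m) (z : C) :
  eigenvalue (map_mx intr N) z -> nc z <= mxsum N.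
Proof.
case/eigenvalueP => v Ev v0.
pose s := \sum_j nc (v 0 j).
have s0 : 0 < s.
  rewrite lt_neqAle sumr_ge0 ?andbT => [|j _]; last exact: nc_ge0.
  apply: contraNneq v0 => /esym/eqP; rewrite psumr_eq0 => [/allP h|j _]; last exact: nc_ge0.
  apply/eqP/rowP => j; rewrite mxE; apply/eqP; rewrite -nc_eq0.
  by apply: (implyP (h j _)); rewrite // mem_index_enum.
rewrite -(ler_pM2r s0) /s mulr_sumr.
apply: (@le_trans _ _ (\sum_j \sum_i nc (v 0 i) * `|N i j|%:~R)).
  apply: ler_sum => j _; rewrite -ncM.
  have /rowP/(_ j) := Ev; rewrite !mxE => <-.
  apply: le_trans (nc_sum _ _ _) _; apply: ler_sum => i _.
  by rewrite ncM mxE nc_int.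
rewrite exchange_big mulr_sumr; apply: ler_sum => i _ /=.
rewrite -mulr_sumr mulrC ler_wpM2r ?nc_ge0 //.
rewrite /mxsum [leRHS](bigD1 i) //= lerDl; apply: sumr_ge0 => k _.
by apply: sumr_ge0 => l _; rewrite ler0z.
Qed.

(* The lowest nonzero coefficient of the characteristic polynomial is an
   integer, and up to sign it is the product of the nonzero eigenvalues. *)
Lemma small_eigenvalue_eq0 m (N : 'M[int]_m) (b : C) (B : R) :
  1 <= B -> mxsum N <= B -> eigenvalue (map_mx intr N) b -> b != 0 ->
  1 <= nc b * B ^+ m.
Proof.
move=> B1 NB eb b0.
pose p : {poly C} := char_poly (map_mx intr N).
have pE : p = map_poly intr (char_poly N) by rewrite map_char_poly.
have [rs Ers] := closed_field_poly_normal p.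
have lp : lead_coef p = 1 by exact/monicP/char_poly_monic.
rewrite lp scale1r in Ers.
have rsE z : (z \in rs) = eigenvalue (map_mx intr N) z.
  by rewrite eigenvalue_root_char -/p Ers root_prod_XsubC.
pose r1 := [seq z <- rs | z != 0].
pose k := count (pred1 0) rs.
have Ep : p = 'X^k * \prod_(z <- r1) ('X - z%:P).
  rewrite Ers /r1 /k; elim: rs {Ers rsE r1 k} => [|z rs IH].
    by rewrite !big_nil expr0 mulr1.
  rewrite big_cons IH /=; case: eqP => [->|_] /=.
    by rewrite subr0 exprS mulrA.
  by rewrite big_cons add0n mulrCA.
have ck : p`_k = \prod_(z <- r1) (- z).
  rewrite Ep coefXnM ltnn subnn -horner_coef0 horner_prod; apply: eq_bigr => z _.
  by rewrite !hornerE.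
have c0 : p`_k != 0.
  rewrite ck prodf_seq_neq0; apply/allP => z; rewrite mem_filter => /andP[z0 _].
  by rewrite oppr_eq0.
have c1 : 1 <= nc p`_k.
  rewrite pE coef_map in c0 *; rewrite nc_int -[1]/(1%:~R : R) ler_int.
  move: c0; rewrite intr_eq0; lia.
have sz : (size r1 <= m)%N.
  rewrite size_filter; apply: leq_trans (count_size _ _) _.
  have := size_char_poly (map_mx intr N : 'M[C]_m); rewrite -/p Ers size_prod_XsubC => -[->].
  by [].
have br : b \in r1 by rewrite mem_filter b0 rsE.
apply: le_trans c1 _; rewrite ck.
have prodb (r : seq C) : {subset r <= rs} -> nc (\prod_(z <- r) (- z)) <= B ^+ size r.
  elim: r => [|z r IH] hr; first by rewrite big_nil nc1.
  rewrite big_cons ncM ncN /= exprS ler_pM ?nc_ge0 //.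
    apply: le_trans NB; apply: eigenvalue_le_mxsum.
    by rewrite -rsE hr // mem_head.
  by apply: IH => w wr; rewrite hr // inE wr orbT.
rewrite (big_rem b br) /= ncM ncN ler_wpM2l ?nc_ge0 //.
apply: le_trans (prodb _ _) _.
  by move=> z /mem_rem; rewrite mem_filter => /andP[].
rewrite size_rem //; apply: ler_weXn2l => //.
exact: leq_trans (leq_pred _) sz.
Qed.

Variables (n : nat) (A : 'M[int]_n.+1).
Implicit Types P Q : {poly int}.

Definition evC P (z : C) : C := (map_poly intr P).[z].

Definition powersum : R := \sum_(k < n.+1) mxsum (A ^+ k).

Lemma mxsum_horner P (H : R) : (size P <= n.+1)%N -> 0 <= H ->
  (forall k, `|P`_k|%:~R <= H) -> mxsum (horner_mx A P) <= H * powersum.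
Proof.
move=> sP H0 hP.
have -> : horner_mx A P = \sum_(k < n.+1) P`_k *: A ^+ k.
  have {1}-> : P = \poly_(k < n.+1) P`_k.
    apply/polyP => k; rewrite coef_poly; case: ltnP => // h.
    by rewrite nth_default // (leq_trans sP).
  rewrite poly_def linear_sum /=; apply: eq_bigr => k _.
  by rewrite linearZ /= rmorphXn /= horner_mx_X.
rewrite /powersum mulr_sumr.
apply: (@le_trans _ _ (\sum_(k < n.+1) mxsum (P`_k *: A ^+ k))).
  rewrite /mxsum [leRHS]exchange_big; apply: ler_sum => i _.
  rewrite exchange_big; apply: ler_sum => j _.
  rewrite summxE intr_norm (rmorph_sum (intr : int -> R)) (le_trans (ler_norm_sum _ _ _)) //.
  by apply: ler_sum => k _; rewrite intr_norm.
apply: ler_sum => k _; rewrite /mxsum mulr_sumr; apply: ler_sum => i _.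
rewrite mulr_sumr; apply: ler_sum => j _.
by rewrite mxE normrM intrM ler_wpM2r // ler0z.
Qed.

Lemma evC_eigen P (z : C) (v : 'rV[C]_n.+1) : v *m map_mx intr A = z *: v ->
  v *m map_mx intr (horner_mx A P) = evC P z *: v.
Proof.
move=> hv; have hk k : v *m (map_mx intr A) ^+ k = z ^+ k *: v.
  elim: k => [|k IH]; first by rewrite !expr0 mulmx1 scale1r.
  by rewrite exprSr mulmxA IH -scalemxAl hv scalerA -exprSr.
rewrite map_horner_mx /evC horner_coef -{1}[map_poly _ P]coefK poly_def linear_sum /=.
rewrite mulmx_sumr scaler_suml; apply: eq_bigr => k _.
by rewrite linearZ /= rmorphXn /= horner_mx_X -scalemxAr hk scalerA.
Qed.

(** The number [b] is an eigenvalue of the integer matrix P1(A) (x) Q2(A) - Q1(A) (x) P2(A), the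
    tensor product of two eigenvectors being an eigenvector. Its modulus is bounded below through
    the product of the nonzero eigenvalues of that matrix, and [D] is the size of the matrix. *)
Lemma liouville : exists (c : R) (D : nat), 1 <= c /\
  forall (z w : C) P1 P2 Q1 Q2 (H : R),
  eigenvalue (map_mx intr A) z -> eigenvalue (map_mx intr A) w -> 1 <= H ->
  (forall P, P \in [:: P1; P2; Q1; Q2] ->
     (size P <= n.+1)%N /\ forall k, `|P`_k|%:~R <= H) ->
  let b := evC P1 z * evC Q2 w - evC P2 w * evC Q1 z in
  b != 0 -> 1 <= nc b * (c * H ^+ 2) ^+ D.
Proof.
pose d := (n.+1 * n.+1)%N.
pose c := (d * d)%N%:R * (2 * (powersum + 1) ^+ 2).
have p0 : 0 <= powersum by apply: sumr_ge0 => k _; exact: mxsum_ge0.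
have p1 : 1 <= (powersum + 1) ^+ 2 by rewrite exprn_ege1 // lerDr.
have d1 : 1 <= (d * d)%N%:R :> R by rewrite ler1n /d !muln_gt0.
have c1 : 1 <= c by rewrite /c; nra.
exists c, d; split=> // z w P1 P2 Q1 Q2 H.
move=> /eigenvalueP[v hv v0] /eigenvalueP[u hu u0] H1 hP b b0.
have H0 : 0 <= H by lra.
pose N : 'M[int]_d := horner_mx A P1 *t horner_mx A Q2 - horner_mx A Q1 *t horner_mx A P2.
have hN P : P \in [:: P1; P2; Q1; Q2] -> mxsum (horner_mx A P) <= H * (powersum + 1).
  move=> /hP[sP cP]; apply: le_trans (mxsum_horner sP H0 cP) _.
  by rewrite ler_wpM2l // lerDl.
have hent P Q i j : P \in [:: P1; P2; Q1; Q2] -> Q \in [:: P1; P2; Q1; Q2] ->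
    `|(horner_mx A P *t horner_mx A Q) i j|%:~R <= H ^+ 2 * (powersum + 1) ^+ 2.
  move=> /hN hP' /hN hQ'; rewrite !mxE normrM intrM -exprMn expr2.
  by rewrite ler_pM ?ler0z // (le_trans (entry_le_mxsum _ _ _)).
have NB : mxsum N <= c * H ^+ 2.
  apply: (@le_trans _ _ (\sum_(i < d) \sum_(j < d) (2 * (H ^+ 2 * (powersum + 1) ^+ 2)))).
    apply: ler_sum => i _; apply: ler_sum => j _.
    rewrite /N; set X := _ *t _; set Y := _ *t _.
    have -> : (X - Y) i j = X i j - Y i j by rewrite !mxE.
    have h1 : `|X i j|%:~R <= H ^+ 2 * (powersum + 1) ^+ 2.
      by apply: hent; rewrite !inE eqxx ?orbT.
    have h2 : `|Y i j|%:~R <= H ^+ 2 * (powersum + 1) ^+ 2.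
      by apply: hent; rewrite !inE eqxx ?orbT.
    rewrite intr_norm in h1; rewrite intr_norm in h2; rewrite intr_norm rmorphB.
    by apply: le_trans (ler_normB _ _) _; lra.
  rewrite !sumr_const card_ord -mulrnA -[leLHS]mulr_natl /c.
  rewrite le_eqVlt; apply/orP; left; apply/eqP; ring.
have cH : 1 <= c * H ^+ 2 by rewrite mulr_ege1 // exprn_ege1.
apply: (@small_eigenvalue_eq0 d N b (c * H ^+ 2) cH NB) => //.
apply/eigenvalueP; exists (v *t u : 'rV_(n.+1 * n.+1)); last first.
  apply: contra v0 => /eqP h0.
  have [j uj] : exists j, u 0 j != 0 by apply/rV0Pn.
  apply/eqP/rowP => i; rewrite mxE.
  have := tensmxE v u 0 0 i j; rewrite (h0 : v *t u = 0) mxE.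
  by move=> /esym/eqP; rewrite mulf_eq0 (negPf uj) orbF => /eqP.
have tm (Y1 Y2 : 'M[C]_n.+1) : (v *t u : 'rV_(n.+1 * n.+1)) *m (Y1 *t Y2) =
    (v *m Y1) *t (u *m Y2) := tensmx_mul v u Y1 Y2.
rewrite /N map_mxB !map_mxT mulmxBr !tm !(evC_eigen _ hv) !(evC_eigen _ hu).
rewrite /b scalerBl; congr (_ - _).
  by apply/matrixP => i j; rewrite !mxE; ring.
by apply/matrixP => i j; rewrite !mxE; ring.
Qed.

End integer_eigenvalues.

(** * Sequences satisfying the recurrence of the characteristic polynomial *)

Section linear_recurrence.
Variables (R : realType) (n : nat) (A : 'M[int]_n.+1).
Local Notation C := R[i].
Local Notation chi := (char_poly A).
Implicit Types (z w : C) (s : nat -> C).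

Lemma chi_top : chi`_n.+1 = 1.
Proof. by have /monicP := char_poly_monic A; rewrite lead_coefE size_char_poly. Qed.

Lemma chi_over k : (n.+1 < k)%N -> chi`_k = 0.
Proof. by move=> h; rewrite nth_default // size_char_poly. Qed.

(** The Horner tails of chi: at a root z, their values are the coefficients of chi(X)/(X - z). *)
Definition shift_poly j : {poly int} := \poly_(i < n.+1) chi`_(j.+1 + i).

Lemma coef_shift_poly j i : (shift_poly j)`_i = chi`_(j.+1 + i).
Proof.
rewrite coef_poly; case: ltnP => // h; rewrite chi_over //.
by rewrite addSn ltnS (leq_trans h) // leq_addl.
Qed.

Lemma size_shift_poly j : (size (shift_poly j) <= n.+1)%N.
Proof. exact: size_poly. Qed.

Local Notation h j z := (evC (shift_poly j) z).

Lemma shift_polyS j z : h j z = z * h j.+1 z + (chi`_j.+1)%:~R.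
Proof.
have E : shift_poly j = 'X * shift_poly j.+1 + (chi`_j.+1)%:P.
  apply/polyP => i; rewrite coefD coefXM coefC !coef_shift_poly.
  case: i => [|i] /=; first by rewrite addn0 add0r.
  by rewrite addr0 !addnS !addSn.
by rewrite /evC {1}E rmorphD rmorphM /= map_polyX map_polyC !hornerE.
Qed.

Lemma chi_shift_poly z : evC chi z = z * h 0 z + (chi`_0)%:~R.
Proof.
have E : chi = 'X * shift_poly 0 + (chi`_0)%:P.
  apply/polyP => i; rewrite coefD coefXM coefC.
  case: i => [|i] /=; first by rewrite add0r.
  by rewrite addr0 coef_shift_poly.
by rewrite /evC {1}E rmorphD rmorphM /= map_polyX map_polyC !hornerE.
Qed.

Lemma shift_poly_last z : h n z = 1.
Proof.
have E : shift_poly n = 1.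
  apply/polyP => i; rewrite coef_shift_poly coef1.
  case: i => [|i] /=; first by rewrite addn0 chi_top.
  by rewrite chi_over // addnS ltnS leq_addr.
by rewrite /evC E rmorph1 hornerC.
Qed.

Definition rec_at s k := \sum_(l < n.+2) (chi`_l)%:~R * s (k + l)%N = 0.

(** The linear functional on initial values that the shift multiplies by z. Up to the factor
    chi'(z), it extracts the coefficient of z^k in a solution of the recurrence. *)
Definition component s z := \sum_(j < n.+1) s j * h j z.

Lemma component_shift s z : evC chi z = 0 -> rec_at s 0 ->
  component (fun j => s j.+1) z = z * component s z.
Proof.
rewrite chi_shift_poly => hz hs.
have hg j : z * h j z = (if j is j'.+1 then h j' z else 0) - (chi`_j)%:~R.
  case: j => [|j]; first by apply/eqP; rewrite sub0r -addr_eq0 hz.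
  by rewrite (shift_polyS j) addrK.
rewrite /component mulr_sumr.
under [RHS]eq_bigr => j _ do rewrite mulrCA hg mulrBr.
rewrite sumrB [X in X - _]big_ord_recl /= mulr0 add0r.
have -> : \sum_(j < n.+1) s j * (chi`_j)%:~R = - s n.+1 :> C.
  move: hs; rewrite /rec_at big_ord_recr /= chi_top mul1r add0n => /eqP.
  rewrite addr_eq0 => /eqP <-; apply: eq_bigr => j _; by rewrite add0n mulrC.
rewrite big_ord_recr /= shift_poly_last mulr1 opprK; congr (_ + _).
Qed.

Lemma component_iter s z L : evC chi z = 0 -> (forall k, (k < L)%N -> rec_at s k) ->
  component (fun j => s (L + j)%N) z = z ^+ L * component s z.
Proof.
move=> hz; elim: L => [|L IH] hs; first by rewrite expr0 mul1r.
rewrite exprS -mulrA -IH; last by move=> k kL; apply: hs; rewrite ltnW.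
rewrite -component_shift //; last first.
  apply: etrans (hs L (ltnSn L)); apply: eq_bigr => l _; by rewrite add0n.
by apply: eq_bigr => j _; rewrite addnS addSn.
Qed.

(** A state is a block of n + 1 consecutive values stored as a function; its values at arguments
    above n are meaningless. *)
Definition extend_state (s : nat -> int) k := iter k (fun (t : nat -> int) j =>
  if (j < n)%N then t j.+1 else - \sum_(l < n.+1) chi`_l * t l) s.

Definition extend (s : nat -> int) k := extend_state s k 0%N.

Lemma extend_stateE (s : nat -> int) k j : (j <= n)%N -> extend_state s k j = extend s (k + j).
Proof.
elim: j k => [|j IH] k hj; first by rewrite addn0.
rewrite addnS -addSn -IH ?(ltnW hj) //.
by rewrite /extend_state /= hj.
Qed.

Lemma extend_small (s : nat -> int) k : (k <= n)%N -> extend s k = s k.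
Proof. by move=> kn; rewrite -[k]add0n -extend_stateE. Qed.

Lemma extend_rec (s : nat -> int) k : \sum_(l < n.+2) chi`_l * extend s (k + l) = 0.
Proof.
rewrite big_ord_recr /= chi_top mul1r addnS -addSn -extend_stateE //.
rewrite /extend_state /= ltnn; apply/eqP; rewrite subr_eq0; apply/eqP.
by apply: eq_bigr => l _; rewrite -extend_stateE // -ltnS.
Qed.

End linear_recurrence.

Section irreducible_recurrence.
Variables (R : realType) (n : nat) (A : 'M[int]_n.+1).
Local Notation C := R[i].
Local Notation chi := (char_poly A).
Local Notation h j z := (evC (shift_poly A j) z).
Hypothesis n0 : (0 < n)%N.
Hypothesis hirr : irreducible_poly (char_poly (map_mx intr A : 'M[rat]_n.+1)).
Hypothesis heig : forall z : C, eigenvalue (map_mx intr A : 'M[C]_n.+1) z -> nc z <> 1.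

Lemma evC_root z : (evC chi z == 0 :> C) = eigenvalue (map_mx intr A) z.
Proof. by rewrite eigenvalue_root_char -map_char_poly. Qed.

(** Irreducibility over the rationals makes P(A) invertible; its determinant is a nonzero integer,
    so it remains invertible over the complex numbers and cannot kill an eigenvector. *)
Lemma evC_neq0 (P : {poly int}) (z : C) : P != 0 -> (size P <= n.+1)%N ->
  evC chi z = 0 -> evC P z != 0.
Proof.
move=> P0 sP /eqP; rewrite evC_root => /eigenvalueP[v hv v0]; apply/negP => /eqP Pz.
have PQ0 : map_poly intr P != 0 :> {poly rat}.
  by rewrite map_poly_eq0_id0 // intr_eq0 lead_coef_eq0.
have sPQ : (size (map_poly intr P : {poly rat}) <= n.+1)%N.
  exact: leq_trans (size_poly _ _) sP.
have := irreducible_horner_unit hirr PQ0 sPQ.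
rewrite -map_horner_mx unitmxE det_map_mx unitfE intr_eq0 => hdet.
have hu : (map_mx intr (horner_mx A P) : 'M[C]_n.+1) \in unitmx.
  by rewrite unitmxE det_map_mx unitfE intr_eq0; exact: hdet.
have := mulmxK hu v.
by rewrite (evC_eigen P hv) Pz scale0r mul0mx => /esym/eqP; rewrite (negPf v0).
Qed.

Lemma chi_roots : exists rs : seq C, [/\ uniq rs, size rs = n.+1,
  forall z, (z \in rs) = (evC chi z == 0), map_poly intr chi = \prod_(z <- rs) ('X - z%:P) &
  forall z, z \in rs -> evC chi^`() z != 0].
Proof.
have [rs Ers] := closed_field_poly_normal (map_poly intr chi : {poly C}).
have lp : lead_coef (map_poly intr chi : {poly C}) = 1.
  by apply/monicP; rewrite map_char_poly char_poly_monic.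
rewrite lp scale1r in Ers.
have rsE z : (z \in rs) = (evC chi z == 0).
  by rewrite /evC -rootE Ers root_prod_XsubC.
have dz z : z \in rs -> evC chi^`() z != 0.
  rewrite rsE => /eqP zr; apply: evC_neq0 => //.
    apply/eqP => /polyP/(_ n); rewrite coef_deriv chi_top coef0 => /eqP.
    by rewrite -mulr_natr mul1r pnatr_eq0.
  by rewrite -ltnS (leq_trans (lt_size_deriv _)) ?size_char_poly // -size_poly_eq0 size_char_poly.
exists rs; split=> //.
  have hrem z : z \in rs -> z \notin rem z rs.
    move=> zr; have := dz z zr; apply: contra => zr2.
    rewrite /evC -deriv_map Ers (big_rem z zr) /= derivM derivXsubC mul1r !hornerE.
    by rewrite subrr mul0r addr0 -rootE root_prod_XsubC.
  elim: rs hrem {Ers rsE dz} => [//|a s IH] hrem /=.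
  have := hrem a (mem_head _ _); rewrite /= eqxx => as_; rewrite as_ IH // => z zs.
  have := hrem z; rewrite inE zs orbT /= => /(_ isT).
  case: eqP => [az _|_]; first by rewrite az zs in as_.
  by rewrite inE negb_or => /andP[].
have := size_char_poly (map_mx intr A : 'M[C]_n.+1).
by rewrite -map_char_poly Ers size_prod_XsubC => -[].
Qed.

(** Lagrange interpolation of the constant 1: the sum over the roots of chi(X)/((X - z) chi'(z))
    minus 1 has degree at most n and n + 1 zeros. The claim compares coefficients. *)
Lemma interpolation (rs : seq C) : uniq rs -> size rs = n.+1 ->
  (forall z, (z \in rs) = (evC chi z == 0)) ->
  (forall z, z \in rs -> evC chi^`() z != 0) ->
  forall s : nat -> C, s 0%N = \sum_(z <- rs) (evC chi^`() z)^-1 * component A s z.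
Proof.
move=> rsU rss rsE dz s.
pose chil z : {poly C} := \poly_(j < n.+1) h j z.
have hchil z : z \in rs -> ('X - z%:P) * chil z = map_poly intr chi.
  rewrite rsE => /eqP hz; apply/polyP => j.
  rewrite mulrBl coefB coefXM coefCM coef_map /= !coef_poly.
  case: j => [|j] /=.
    by rewrite sub0r; have := chi_shift_poly A z; rewrite hz => /esym/eqP; rewrite addrC addr_eq0 => /eqP ->.
  rewrite ltnS; case: (ltngtP j n) => jn.
  - by rewrite ltnS jn (shift_polyS A j) addrAC subrr add0r.
  - by rewrite ltnNge ltnW //= mulr0 subr0 chi_over.
  by rewrite jn ltnn mulr0 subr0 shift_poly_last chi_top.
have chil_ne z w : z \in rs -> w \in rs -> z != w -> (chil z).[w] = 0.
  move=> zr; rewrite rsE => /eqP hw zw.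
  have := congr1 (fun p : {poly C} => p.[w]) (hchil z zr).
  rewrite hornerM !hornerE -/(evC chi w) hw => /eqP.
  by rewrite mulf_eq0 subr_eq0 eq_sym (negPf zw) => /eqP.
have chil_eq z : z \in rs -> (chil z).[z] = evC chi^`() z.
  move=> zr; have := congr1 (fun p : {poly C} => p^`().[z]) (hchil z zr).
  by rewrite derivM derivXsubC mul1r !hornerE subrr mul0r addr0 deriv_map.
pose p : {poly C} := \sum_(z <- rs) (evC chi^`() z)^-1 *: chil z - 1.
have p0 : p = 0.
  apply: (roots_geq_poly_eq0 (rs := rs)) => //; last first.
    rewrite rss; apply: leq_trans (size_polyD _ _) _; rewrite geq_max size_polyN size_poly1 andbT.
    apply: leq_trans (size_sum _ _ _) _; apply/bigmax_leqP_seq => z _ _.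
    by apply: leq_trans (size_scale_leq _ _) _; exact: size_poly.
  apply/allP => w wr; rewrite rootE /p hornerD hornerN hornerC horner_sum.
  rewrite (bigD1_seq w) //= hornerZ chil_eq // mulVf ?dz // big_seq_cond big1 ?addr0 ?subrr //.
  by move=> z /andP[zr zw]; rewrite hornerZ chil_ne ?mulr0.
have co j : (j < n.+1)%N -> \sum_(z <- rs) (evC chi^`() z)^-1 * h j z = (j == 0%N)%:R.
  move=> jn; have /polyP/(_ j) := p0; rewrite coefB coef1 coef0 coef_sum => /eqP.
  rewrite subr_eq0 => /eqP <-; apply: eq_bigr => z _.
  by rewrite coefZ coef_poly jn.
have B (j : 'I_n.+1) : \sum_(z <- rs) (evC chi^`() z)^-1 * (s j * h j z) = s j * (j == ord0)%:R.
  transitivity (s j * \sum_(z <- rs) (evC chi^`() z)^-1 * h j z).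
    by rewrite mulr_sumr; apply: eq_bigr => z _; rewrite mulrCA.
  by rewrite co.
transitivity (\sum_(j < n.+1) s j * (j == ord0)%:R).
  rewrite (bigD1 ord0) //= mulr1 big1 ?addr0 // => j /negPf ->.
  by rewrite mulr0.
rewrite -(eq_bigr _ (fun j _ => B j)) exchange_big /=; apply: eq_bigr => z _.
by rewrite /component mulr_sumr.
Qed.

(** Otherwise all roots would lie strictly inside the unit disc, although their product is, up to
    sign, the integer chi(0). The latter is nonzero because 0 is no root of an irreducible
    polynomial of degree at least 2. *)
Lemma expanding_root : exists z : C, evC chi z = 0 /\ 1 < nc z.
Proof.
have [rs [rsU rss rsE Ers dz]] := chi_roots.
apply: contrapT => hno.
have small z : z \in rs -> nc z < 1.
  move=> zr; rewrite lt_neqAle; apply/andP; split.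
    by apply/eqP; apply: heig; rewrite -evC_root -rsE.
  rewrite leNgt; apply/negP => z1; apply: hno; exists z; split=> //.
  by apply/eqP; rewrite -rsE.
have c0 : (chi`_0)%:~R = \prod_(z <- rs) (- z) :> C.
  have := coef_map (intr : int -> C) chi 0; rewrite Ers /= => <-.
  by rewrite -horner_coef0 horner_prod; apply: eq_bigr => z _; rewrite !hornerE.
have cn0 : chi`_0 != 0.
  apply/negP => /eqP h0.
  have X1 : size ('X : {poly int}) = 2%N by rewrite size_polyX.
  have Xz : ('X : {poly int}) != 0 by rewrite -size_poly_eq0 X1.
  have sX : (size ('X : {poly int}) <= n.+1)%N by rewrite X1.
  have hz : evC chi 0 = 0 :> C by rewrite /evC horner_coef0 coef_map h0.
  have := evC_neq0 Xz sX hz; rewrite /evC map_polyX hornerX eqxx //.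
have : 1 <= nc ((chi`_0)%:~R : C).
  rewrite nc_int -[1]/(1%:~R : R) ler_int; move: cn0; lia.
rewrite c0 leNgt => /negP; apply.
case: rs rss small {rsU rsE Ers dz c0} => [//|z rs _ small].
rewrite big_cons ncM ncN.
have : nc (\prod_(j <- rs) - j) <= 1.
  elim: rs small => [|w rs IH] small; first by rewrite big_nil nc1.
  rewrite big_cons ncM ncN mulr_ile1 ?nc_ge0 //.
    by apply/ltW/small; rewrite !inE eqxx orbT.
  by apply: IH => y yr; apply: small; move: yr; rewrite !inE => /orP[->//|->]; rewrite !orbT.
have := small z (mem_head _ _); have := nc_ge0 z; have := nc_ge0 (\prod_(j <- rs) - j).
nra.
Qed.

Lemma spectral_gap (rs : seq C) : (forall z, z \in rs -> nc z <> 1) ->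
  exists rho sig : R, [/\ 1 < rho, 0 < sig < 1,
    forall z, z \in rs -> 1 < nc z -> rho <= nc z &
    forall z, z \in rs -> nc z < 1 -> nc z <= sig].
Proof.
elim: rs => [|z rs IH] hrs.
  by exists 2, (1/2); split=> //; [lra|lra].
have [|rho [sig [rho1 /andP[s0 s1] h1 h2]]] := IH.
  by move=> w wr; apply: hrs; rewrite inE wr orbT.
have z1 := hrs z (mem_head _ _).
case: (ltrP 1 (nc z)) => hz.
  exists (Num.min rho (nc z)), sig; split=> //.
  - by rewrite lt_min rho1.
  - by rewrite s0.
  - move=> w; rewrite inE => /predU1P[->|wr] hw; first by rewrite ge_min lexx orbT.
    by rewrite ge_min h1.
  move=> w; rewrite inE => /predU1P[->|wr] hw; first by lra.
  exact: h2.
exists rho, (Num.max sig (nc z)); split=> //.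
- rewrite lt_max s0 gt_max s1 /= lt_neqAle hz andbT; exact/eqP.
- move=> w; rewrite inE => /predU1P[->|wr] hw; first by lra.
  exact: h1.
move=> w; rewrite inE => /predU1P[->|wr] hw; first by rewrite le_max lexx orbT.
by rewrite le_max h2.
Qed.

End irreducible_recurrence.

Section diophantine.
Variables (R : realType) (n : nat) (A : 'M[int]_n.+1).
Local Notation C := R[i].
Local Notation chi := (char_poly A).
Local Notation h j z := (evC (shift_poly A j) z).
Hypothesis n0 : (0 < n)%N.
Hypothesis hirr : irreducible_poly (char_poly (map_mx intr A : 'M[rat]_n.+1)).
Hypothesis heig : forall z : C, eigenvalue (map_mx intr A : 'M[C]_n.+1) z -> nc z <> 1.

(** Writes the component of an integer sequence as the value of an integer polynomial, the form
    required by [liouville]. *)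
Definition component_poly (s : nat -> int) : {poly int} :=
  \sum_(j < n.+1) s j *: shift_poly A j.

Lemma component_polyE (s : nat -> int) (z : C) :
  evC (component_poly s) z = component A (fun j => (s j)%:~R) z.
Proof.
rewrite /evC /component_poly rmorph_sum horner_sum; apply: eq_bigr => j _.
by rewrite /= map_polyZ hornerZ.
Qed.

Lemma size_component_poly s : (size (component_poly s) <= n.+1)%N.
Proof.
apply: leq_trans (size_sum _ _ _) _; apply/bigmax_leqP => j _.
by apply: leq_trans (size_scale_leq _ _) _; exact: size_shift_poly.
Qed.

Definition chi_norm : R := 1 + \sum_(l < n.+2) `|chi`_l|%:~R.

Lemma chi_norm_ge1 : 1 <= chi_norm.
Proof. by rewrite lerDl; apply: sumr_ge0 => l _; rewrite ler0z. Qed.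

Lemma coef_chi_le l : `|chi`_l|%:~R <= chi_norm.
Proof.
case: (ltnP l n.+2) => hl; last first.
  by rewrite chi_over // normr0 (le_trans ler01 chi_norm_ge1).
rewrite /chi_norm (bigD1 (Ordinal hl)) //= addrCA lerDl addr_ge0 //.
by apply: sumr_ge0 => k _; rewrite ler0z.
Qed.

Lemma coef_component_poly_le (s : nat -> int) (B : R) k :
  (forall j, (j <= n)%N -> `|s j|%:~R <= B) ->
  `|(component_poly s)`_k|%:~R <= n.+1%:R * chi_norm * B.
Proof.
move=> hs; rewrite /component_poly coef_sum intr_norm rmorph_sum.
apply: le_trans (ler_norm_sum _ _ _) _.
apply: (@le_trans _ _ (\sum_(j < n.+1) chi_norm * B)).
  apply: ler_sum => j _; rewrite coefZ coef_shift_poly rmorphM normrM mulrC.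
  rewrite -!intr_norm ler_pM ?ler0z ?coef_chi_le ?hs //.
  by rewrite -ltnS.
by rewrite sumr_const card_ord -[leLHS]mulr_natl mulrA.
Qed.

Lemma evC_conj (P : {poly int}) (z : C) : evC P z^*%C = (evC P z)^*%C.
Proof.
rewrite /evC -[in RHS](horner_map conjc) -map_poly_comp; congr (_.[_]).
by apply: eq_map_poly => x /=; rewrite (rmorph_int conjc).
Qed.

Lemma int_lt1_eq0 (z : int) : (`|z|%:~R : R) < 1 -> z = 0.
Proof. by rewrite (ltrz1 R); lia. Qed.

(** The errors om u - K stay bounded up to level L, so their expanding components are at most of
    order rho^-L, and the quotients of the components of K and u are all close to [om]. Liouville's
    inequality turns closeness into equality: one number [al] is the quotient for all indices and
    all expanding roots at once. Then al u - K has contracting components only. *)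
Lemma diophantine : exists (del rho c : R) (D : nat), [/\ 0 < del, 1 < rho, 1 <= c &
  forall (I : Type) (u : I -> nat -> int) (i0 : I) (om H : R) (L : nat),
  1 <= H -> 0 <= om <= 1 ->
  (forall i k, \sum_(l < n.+2) chi`_l * u i (k + l)%N = 0) ->
  (forall i k, (k <= n)%N -> `|u i k|%:~R <= H) -> u i0 0%N != 0 ->
  (forall i k, (k <= L)%N -> exists z : int, `|om * (u i k)%:~R - z%:~R| <= del) ->
  c * H ^+ D <= rho ^+ L ->
  exists al : R, `|om - al| * rho ^+ L <= c * H ^+ D /\
    forall i, exists2 eps : nat -> R, exp_small eps &
      forall k, exists z : int, `|al * (u i k)%:~R - z%:~R| <= eps k].
Proof.
have [rs [rsU rss rsE Ers dz]] := chi_roots R hirr.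
have rsnc z : z \in rs -> nc z <> 1.
  by rewrite rsE evC_root => hz; exact: heig.
have [rho [sig [rho1 sigP hrho hsig]]] := spectral_gap rsnc.
have [cL [D1 [cL1 hL]]] := liouville R A.
have [z1 [z1r0 z1e]] := expanding_root n0 hirr heig.
have z1r : z1 \in rs by rewrite rsE z1r0.
pose X := chi_norm; have X1 : 1 <= X := chi_norm_ge1.
pose c1 : R := 1 + \sum_(z <- rs) \sum_(j < n.+1) nc (h j z).
have S0 (z : C) : 0 <= \sum_(j < n.+1) nc (h j z) by apply: sumr_ge0 => j _; exact: nc_ge0.
have c11 : 1 <= c1 by rewrite lerDl sumr_ge0.
have hc1 z : z \in rs -> \sum_(j < n.+1) nc (h j z) <= c1.
  move=> zr; apply: (@le_trans _ _ (\sum_(z <- rs) \sum_(j < n.+1) nc (h j z))).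
    exact: (sumr_mem_le zr S0).
  by rewrite lerDr.
have comp_le (s : nat -> C) z B : z \in rs -> 0 <= B -> (forall j, (j <= n)%N -> nc (s j) <= B) ->
    nc (component A s z) <= B * c1.
  move=> zr B0 hs; apply: le_trans (nc_sum _ _ _) _.
  apply: (@le_trans _ _ (B * \sum_(j < n.+1) nc (h j z))); last by rewrite ler_wpM2l ?hc1.
  rewrite mulr_sumr; apply: ler_sum => j _; rewrite ncM ler_wpM2r ?nc_ge0 // hs //.
  by rewrite -ltnS.
(* The recurrence applied to errors of at most [del] gives less than 1, so the nearest integers
   satisfy it exactly. *)
pose del : R := (2 * X)^-1.
have X0 : 0 < X by lra.
have del0 : 0 < del by rewrite invr_gt0 mulr_gt0.
have delX : del * X = 1 / 2 by rewrite /del; field; rewrite gt_eqF.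
have del1 : del <= 1.
  have : del * 1 <= del * X by rewrite ler_pM2l.
  by lra.
pose n1 : R := n.+1%:R; have n11 : 1 <= n1 by rewrite ler1n.
pose Y : R := 2 * (n1 * X); have Y1 : 1 <= Y by rewrite /Y; nra.
pose T : R := (cL * Y ^+ 2) ^+ D1.
have T1 : 1 <= T by rewrite exprn_ege1 // mulr_ege1 // exprn_ege1.
pose P : R := rho ^+ n.+1; have P1 : 1 <= P by rewrite exprn_ege1 // ltW.
pose c0 : R := 2 * (c1 ^+ 2 * (P * T)).
have PT1 : 1 <= P * T by rewrite mulr_ege1.
have c12 : 1 <= c1 ^+ 2 by rewrite exprn_ege1.
have c1PT : c1 * (P * T) <= c0.
  have q0 : 0 <= P * T by lra.
  have q1 : c1 <= c1 ^+ 2 by rewrite expr2 ler_peMl //; lra.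
  have q2 : c1 * (P * T) <= c1 ^+ 2 * (P * T) by rewrite ler_wpM2r.
  have q3 : 0 <= c1 ^+ 2 * (P * T) by rewrite mulr_ge0 //; lra.
  by rewrite /c0; lra.
have Pc0 : P <= c0.
  apply: le_trans c1PT; rewrite mulrCA ler_peMr //; first by lra.
  by rewrite mulr_ege1.
have rho0 : 0 < rho by lra.
(* In the exponent, Liouville's inequality accounts for twice [D1] and the size of one component of
   u for the additional 1. The factor 2 makes the assumption on L strictly incompatible with rho^L
   <= c0 H^D. *)
exists del, rho, (2 * c0), D1.*2.+1; split=> //; first by lra.
move=> I u i0 om H L H1 /andP[om0 om1] urec uH ui0 hnear hbig.
have HD0 k : 1 <= H ^+ k by rewrite exprn_ege1.
have nL : (n.+1 <= L)%N.
  rewrite -(ler_eXn2l rho1) (le_trans _ hbig) //.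
  by have := HD0 D1.*2.+1; rewrite -/P; nra.
have rL : 0 < rho ^+ L by rewrite exprn_gt0.
have /choice[K hK] : forall ik : I * nat, exists z : int, (ik.2 <= L)%N ->
    `|om * (u ik.1 ik.2)%:~R - z%:~R| <= del.
  move=> [i k]; case: (leqP k L) => kL; last by exists 0.
  by have [z hz] := hnear i k kL; exists z.
have {}hK i k : (k <= L)%N -> `|om * (u i k)%:~R - (K (i, k))%:~R| <= del.
  exact: (hK (i, k)).
pose Ki i k := K (i, k).
have KH i k : (k <= n)%N -> `|Ki i k|%:~R <= 2 * H.
  move=> kn; have kL : (k <= L)%N by rewrite (leq_trans kn) // ltnW.
  have := hK i k kL; have := uH i k kn; rewrite !intr_norm -/(Ki i k).
  set a : R := (u i k)%:~R; set b : R := (Ki i k)%:~R => h1 h2.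
  have h3 : `|om * a| <= H.
    by rewrite normrM (ger0_norm om0) (le_trans _ h1) // ler_piMl.
  have : `|b| <= `|om * a| + `|om * a - b|.
    have := ler_normB (om * a) (om * a - b); by rewrite subKr.
  lra.
have urecR (F : pzRingType) i k : \sum_(l < n.+2) (chi`_l * u i (k + l)%N)%:~R = 0 :> F.
  by rewrite -(rmorph_sum (intr : int -> F)) urec.
have Krec i k : (k + n.+1 <= L)%N -> \sum_(l < n.+2) chi`_l * Ki i (k + l)%N = 0.
  move=> kL; apply: int_lt1_eq0.
  have E : ((\sum_(l < n.+2) chi`_l * Ki i (k + l)%N)%:~R : R) =
     - \sum_(l < n.+2) (chi`_l)%:~R * (om * (u i (k + l)%N)%:~R - (Ki i (k + l)%N)%:~R).
    under [in RHS]eq_bigr => l _ do rewrite mulrBr mulrCA -!intrM.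
    rewrite sumrB -mulr_sumr. rewrite urecR mulr0 sub0r opprK.
    by rewrite rmorph_sum.
  rewrite intr_norm E normrN; apply: le_lt_trans (ler_norm_sum _ _ _) _.
  apply: (@le_lt_trans _ _ (\sum_(l < n.+2) `|chi`_l|%:~R * del)).
    apply: ler_sum => l _; rewrite normrM -intr_norm ler_wpM2l ?ler0z // hK //.
    by apply: leq_trans kL; rewrite leq_add2l -ltnS.
  rewrite -mulr_suml mulrC.
  apply: (@le_lt_trans _ _ (del * X)); last by rewrite delX ltr_pdivrMr // mul1r ltr1n.
  by rewrite ler_wpM2l ?(ltW del0) // lerDr.
pose eps i (k : nat) : C := om%:C * (u i k)%:~R - (Ki i k)%:~R.
have epsE i k : eps i k = (om * (u i k)%:~R - (Ki i k)%:~R : R)%:C.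
  by rewrite rmorphB rmorphM /= !rmorph_int.
have eps_comp i z : component A (eps i) z =
    om%:C * evC (component_poly (u i)) z - evC (component_poly (Ki i)) z.
  rewrite !component_polyE /component mulr_sumr -sumrB; apply: eq_bigr => j _.
  by rewrite /eps; ring.
have err i z : z \in rs -> 1 < nc z ->
    nc (om%:C * evC (component_poly (u i)) z - evC (component_poly (Ki i)) z) * rho ^+ L <= c1 * P.
  move=> zr ze; rewrite -eps_comp.
  have nL' : (n <= L)%N by exact: ltnW.
  have zroot : evC chi z = 0 by apply/eqP; rewrite -rsE.
  have hrec k : (k < L - n)%N -> rec_at A (eps i) k.
    move=> kL; rewrite /rec_at /eps.
    under eq_bigr => l _ do rewrite mulrBr mulrCA -!intrM.
    rewrite sumrB -mulr_sumr urecR -(rmorph_sum (intr : int -> C)) Krec ?mulr0 ?subrr //.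
    by rewrite addnS addnC -ltn_subRL.
  have := component_iter zroot hrec => E.
  have : nc (component A (fun j => eps i (L - n + j)%N) z) <= 1 * c1.
    apply: comp_le => // j jn; rewrite epsE nc_real (le_trans (hK i _ _)) //.
    by rewrite -[leqRHS](subnK nL') leq_add2l.
  rewrite E ncM ncX mul1r => h1.
  have h2 : nc (component A (eps i) z) * rho ^+ (L - n) <= c1.
    rewrite mulrC (le_trans _ h1) // ler_wpM2r ?nc_ge0 // lerXn2r ?nnegrE ?nc_ge0 ?(ltW rho0) //.
    exact: hrho.
  have -> : rho ^+ L = rho ^+ (L - n) * rho ^+ n by rewrite -exprD subnK.
  rewrite mulrA; apply: ler_pM => //.
  - by rewrite mulr_ge0 ?nc_ge0 ?exprn_ge0 ?ltW.
  - by rewrite exprn_ge0 ?ltW.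
  by rewrite /P ler_eXn2l.
have uP i z : z \in rs -> nc (evC (component_poly (u i)) z) <= H * c1.
  move=> zr; rewrite component_polyE; apply: comp_le => //; first exact: le_trans ler01 H1.
  by move=> j jn; rewrite nc_int uH.
have H0 : 0 <= H := le_trans ler01 H1.
have YH1 : 1 <= Y * H by rewrite mulr_ege1.
have coefs Q : (exists i, Q = component_poly (u i) \/ Q = component_poly (Ki i)) \/ Q = 0 \/ Q = 1 ->
    (size Q <= n.+1)%N /\ forall k, `|Q`_k|%:~R <= Y * H.
  have YE : Y * H = n.+1%:R * chi_norm * (2 * H) by rewrite /Y /n1 /X; ring.
  case=> [[i [->|->]]|[->|->]]; split=> //; rewrite ?size_component_poly ?size_poly0 ?size_poly1 // => k.
  - by rewrite YE; apply: coef_component_poly_le => j jn; rewrite (le_trans (uH i j jn)) // mulr_natl mulr2n lerDl.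
  - by rewrite YE; apply: coef_component_poly_le => j jn; exact: KH.
  - by rewrite coef0 normr0 (le_trans ler01).
  by rewrite coef1; case: (k == 0%N); rewrite ?normr0 ?normr1 // (le_trans ler01).
have TH : (cL * (Y * H) ^+ 2) ^+ D1 = T * H ^+ D1.*2.
  have -> : cL * (Y * H) ^+ 2 = (cL * Y ^+ 2) * H ^+ 2 by ring.
  by rewrite exprMn -exprM mul2n.
have TH0 : 0 <= T * H ^+ D1.*2 by apply: mulr_ge0; [exact: le_trans T1|exact: exprn_ge0].
have eigE z : z \in rs -> eigenvalue (map_mx intr A : 'M[C]_n.+1) z by rewrite rsE evC_root.
(* Cross-multiplied quotients: the difference is at most of order H rho^-L, which is below
   Liouville's bound unless it vanishes. *)
have equal i i' z z' : z \in rs -> 1 < nc z -> z' \in rs -> 1 < nc z' ->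
    evC (component_poly (Ki i)) z * evC (component_poly (u i')) z' =
    evC (component_poly (Ki i')) z' * evC (component_poly (u i)) z.
  move=> zr ze zr' ze'; apply/eqP; rewrite -subr_eq0; apply/negPn/negP => b0.
  have := hL z z' (component_poly (Ki i)) (component_poly (Ki i')) (component_poly (u i))
    (component_poly (u i')) (Y * H) (eigE z zr) (eigE z' zr') YH1.
  move=> /(_ _ b0); rewrite TH => hb.
  have {}hb := hb _; have {}hb : 1 <= nc (evC (component_poly (Ki i)) z * evC (component_poly (u i')) z' -
      evC (component_poly (Ki i')) z' * evC (component_poly (u i)) z) * (T * H ^+ D1.*2).
    apply: hb => Q; rewrite !inE => /or4P[] /eqP ->; apply: coefs; left.
    - by exists i; right.
    - by exists i'; right.
    - by exists i; left.
    by exists i'; left.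
  have e1 := err i z zr ze; have e2' := err i' z' zr' ze'.
  have u1 := uP i z zr; have u2 := uP i' z' zr'.
  set Ku := evC (component_poly (Ki i)) z in b0 hb e1 *.
  set Ku' := evC (component_poly (Ki i')) z' in b0 hb e2' *.
  set U := evC (component_poly (u i)) z in b0 hb e1 u1 *.
  set U' := evC (component_poly (u i')) z' in b0 hb e2' u2 *.
  have Eb : Ku * U' - Ku' * U = (om%:C * U' - Ku') * U - (om%:C * U - Ku) * U' by ring.
  have nb : nc (Ku * U' - Ku' * U) * rho ^+ L <= 2 * (c1 * P * (H * c1)).
    rewrite Eb; apply: (@le_trans _ _ ((nc (om%:C * U' - Ku') * nc U + nc (om%:C * U - Ku) * nc U') * rho ^+ L)).
      by rewrite ler_wpM2r ?(ltW rL) // -!ncM (le_trans (ncD _ _)) // ncN.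
    rewrite mulrDl mulr_natl mulr2n; apply: lerD; rewrite mulrAC ler_pM ?nc_ge0 //.
      by rewrite mulr_ge0 ?nc_ge0 ?(ltW rL).
    by rewrite mulr_ge0 ?nc_ge0 ?(ltW rL).
  have : rho ^+ L <= c0 * H ^+ D1.*2.+1.
    apply: (@le_trans _ _ (nc (Ku * U' - Ku' * U) * rho ^+ L * (T * H ^+ D1.*2))).
      by rewrite mulrAC ler_peMl // ltW.
    apply: le_trans (ler_wpM2r TH0 nb) _.
    rewrite le_eqVlt; apply/orP; left; apply/eqP; rewrite /c0 [H ^+ D1.*2.+1]exprS; ring.
  move=> /(le_trans hbig); rewrite -mulrA mulr_natl mulr2n gerDr leNgt mulr_gt0 //.
    by rewrite (lt_le_trans ltr01 (le_trans P1 Pc0)).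
  by rewrite (lt_le_trans ltr01 (HD0 _)).
have U0 : evC (component_poly (u i0)) z1 != 0.
  apply: (evC_neq0 hirr _ _ z1r0); last exact: size_component_poly.
  apply/eqP => /polyP/(_ n); rewrite coef_sum big_ord_recl /= coefZ coef_shift_poly chi_top mulr1.
  rewrite coef0 big1 ?addr0; first by apply/eqP.
  by move=> j _; rewrite coefZ coef_shift_poly chi_over ?mulr0 //= /bump /= add1n !addSn !ltnS leq_addl.
set U := evC (component_poly (u i0)) z1 in U0.
set V := evC (component_poly (Ki i0)) z1.
pose a := V / U; pose al := complex.Re a.
(* The conjugate of [z1] is an expanding root too, and equality of the two quotients means that [a]
   is real. *)
have aE : a = al%:C.
  have z1c : z1^*%C \in rs.
    by rewrite rsE evC_conj conjc_eq0 -rsE.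
  have := equal i0 i0 z1 z1^*%C z1r z1e z1c; rewrite nc_conj => /(_ z1e).
  rewrite !evC_conj -/U -/V => E.
  have Uc : U^*%C != 0 by rewrite conjc_eq0.
  have ac : a^*%C = a.
    rewrite /a (rmorphM conjc) /= conjc_inv.
    by apply/eqP; rewrite eqr_div // eq_sym -E.
  have conj_real (y : C) : y^*%C = y -> y = (complex.Re y)%:C.
    by case: y => p q [] /eqP; rewrite eq_sym -addr_eq0 -mulr2n mulrn_eq0 /= => /eqP ->.
  exact: conj_real.
have alE i z : z \in rs -> 1 < nc z ->
    evC (component_poly (Ki i)) z = al%:C * evC (component_poly (u i)) z.
  move=> zr ze; have := equal i i0 z z1 zr ze z1r z1e; rewrite -/U -/V => E.
  by apply: (mulIf U0); rewrite E -aE /a; field.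
exists al; split.
  have eU := err i0 z1 z1r z1e; rewrite alE // -/U -mulrBl -rmorphB ncM nc_real in eU.
  (* With these polynomials [b] is just the component [U] of [u i0]; the lower bound on it allows
     division in the estimate for om - al. *)
  have := hL z1 z1 (component_poly (u i0)) 0 0 1 (Y * H) (eigE z1 z1r) (eigE z1 z1r) YH1.
  have evC1 : evC 1 z1 = 1 :> C by rewrite /evC rmorph1 hornerC.
  have evC0 : evC 0 z1 = 0 :> C by rewrite /evC rmorph0 horner0.
  rewrite TH evC1 evC0 mul0r subr0 mulr1 => hU.
  have {hU} hU : 1 <= nc U * (T * H ^+ D1.*2).
    apply: hU => // Q; rewrite !inE => /or4P[] /eqP ->; apply: coefs; [|by right; left|by right; left|by right; right].
    by left; exists i0; left.
  apply: (@le_trans _ _ (`|om - al| * nc U * rho ^+ L * (T * H ^+ D1.*2))).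
    have -> : `|om - al| * nc U * rho ^+ L * (T * H ^+ D1.*2) =
      `|om - al| * rho ^+ L * (nc U * (T * H ^+ D1.*2)) by ring.
    by rewrite ler_peMr // mulr_ge0 // ltW.
  apply: le_trans (ler_wpM2r TH0 eU) _.
  have -> : c1 * P * (T * H ^+ D1.*2) = c1 * (P * T) * H ^+ D1.*2 by ring.
  rewrite exprS [leRHS]mulrA; apply: ler_pM => //.
  - by rewrite mulr_ge0 ?(le_trans ler01 c11) ?(le_trans ler01 PT1).
  - by rewrite exprn_ge0.
  rewrite (le_trans c1PT) // mulrAC ler_peMl ?mulr_ege1 ?ler1n //.
  by rewrite (le_trans ler01 (le_trans P1 Pc0)).
move=> i.
(* Nearest integers are controlled only up to level L; beyond that, the solution of the recurrence
   with the same initial values takes their place. *)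
pose e k : C := al%:C * (u i k)%:~R - (extend A (Ki i) k)%:~R.
have erec k : rec_at A e k.
  rewrite /rec_at /e; under eq_bigr => l _ do rewrite mulrBr mulrCA -!intrM.
  by rewrite sumrB -mulr_sumr urecR -(rmorph_sum (intr : int -> C)) extend_rec mulr0 subrr.
have ecomp z : component A e z = al%:C * evC (component_poly (u i)) z - evC (component_poly (Ki i)) z.
  rewrite !component_polyE /component mulr_sumr -sumrB; apply: eq_bigr => j _.
  rewrite /e extend_small; last by rewrite -ltnS.
  by rewrite mulrBl mulrA.
have eform k : e k = \sum_(z <- rs) (evC chi^`() z)^-1 * (z ^+ k * component A e z).
  have := interpolation rsU rss rsE dz (fun j => e (k + j)%N); rewrite addn0 => ->.
  rewrite big_seq_cond [RHS]big_seq_cond; apply: eq_bigr => z /andP[zr _].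
  by rewrite component_iter //; apply/eqP; rewrite -rsE.
pose B := \sum_(z <- rs) nc ((evC chi^`() z)^-1 * component A e z).
exists (fun k => B * sig ^+ k).
  apply: exp_small_geom => //; apply: sumr_ge0 => z _; exact: nc_ge0.
move=> k; exists (extend A (Ki i) k).
have eE : e k = (al * (u i k)%:~R - (extend A (Ki i) k)%:~R : R)%:C.
  by rewrite rmorphB rmorphM /= !rmorph_int.
rewrite -nc_real -eE.
rewrite eform (le_trans (nc_sum _ _ _)) // /B mulr_suml big_seq_cond [leRHS]big_seq_cond.
apply: ler_sum => z /andP[zr _].
rewrite mulrCA mulrC ncM; case: (ltrP 1 (nc z)) => hz.
  by rewrite ecomp (alE i z zr hz) subrr mulr0 nc0 !mul0r.
rewrite ler_wpM2l ?nc_ge0 // ncX lerXn2r ?nnegrE ?nc_ge0 //.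
  by case/andP: sigP => /ltW.
apply: hsig => //; rewrite lt_neqAle hz andbT; apply/eqP; exact: rsnc.
Qed.

End diophantine.

(** * Contraction of twisted sums *)

Section twisted_sum.
Variables (R : realType) (n : nat) (zeta : 'I_n.+1 -> seq 'I_n.+1).
Local Notation letter := 'I_n.+1.
Local Notation inflate := (inflate zeta).
Local Notation len := (len zeta).
Local Notation maxlen := (maxlen zeta).
Variable beta : letter -> R[i].
Variable F : R.
Hypothesis F0 : 0 <= F.
Hypothesis betaF : forall a, nc (beta a) <= F.

Definition twisted_sum (w : R) (u : seq letter) : R[i] :=
  foldr (fun a s => beta a + e2 (- w) * s) 0 u.
Local Notation Phi := twisted_sum.

Lemma twisted_sum_nil w : Phi w [::] = 0. Proof. by []. Qed.

Lemma twisted_sum_cons w a u : Phi w (a :: u) = beta a + e2 (- w) * Phi w u.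
Proof. by []. Qed.

Lemma twisted_sum_cat w u v : Phi w (u ++ v) = Phi w u + e2 (- (w * (size u)%:R)) * Phi w v.
Proof.
elim: u => [|a u IH]; first by rewrite mulr0 oppr0 e2_0 mul1r add0r.
rewrite cat_cons /= IH mulrDr mulrA -e2D addrA; congr (_ + e2 _ * _).
by rewrite mulrS; ring.
Qed.

Lemma nc_twisted_sum_cat w u v : nc (Phi w (u ++ v)) <= nc (Phi w u) + nc (Phi w v).
Proof. by rewrite twisted_sum_cat (le_trans (ncD _ _)) // ncM nc_e2 mul1r. Qed.

Lemma twisted_sum_le w u : nc (Phi w u) <= F * (size u)%:R.
Proof.
elim: u => [|a u IH]; first by rewrite twisted_sum_nil nc0 mulr0.
rewrite twisted_sum_cons /= mulrS mulrDr mulr1; apply: le_trans (ncD _ _) _.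
by rewrite ncM nc_e2 mul1r lerD.
Qed.

Lemma twisted_sum_near w u (z : int) :
  nc (Phi w u - \sum_(a <- u) beta a) <= 8 * F * `|w - z%:~R| * (size u)%:R ^+ 2.
Proof.
elim: u => [|a u IH] /=.
  by rewrite big_nil subr0 nc0 !mulr_ge0.
rewrite big_cons opprD addrACA subrr add0r.
set s := \sum_(_ <- _) _ in IH *.
have -> : e2 (- w) * Phi w u - s = (e2 (- w) - 1) * Phi w u + (Phi w u - s) by ring.
rewrite (le_trans (ncD _ _)) // ncM.
have h1 : nc (e2 (- w) - 1) <= 8 * `|w - z%:~R|.
  have -> : `|w - z%:~R| = `|- w - (- z)%:~R| by rewrite mulrNz opprK -normrN opprB addrC.
  exact: nc_e2B1_int.
have h2 := twisted_sum_le w u.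
have h3 := ler_pM (nc_ge0 _) (nc_ge0 _) h1 h2.
apply: le_trans (lerD h3 IH) _.
have -> : 8 * `|w - z%:~R| * (F * (size u)%:R) + 8 * F * `|w - z%:~R| * (size u)%:R ^+ 2 =
   8 * F * `|w - z%:~R| * ((size u)%:R * (size u).+1%:R) by rewrite -[(size u).+1]add1n natrD; ring.
by rewrite ler_wpM2l ?mulr_ge0 // expr2 ler_wpM2r // ler_nat.
Qed.

Definition mean_le w k r := forall b, nc (Phi w (inflate k [:: b])) <= r * (len k b)%:R.

Lemma mean_le_word w k r u : mean_le w k r ->
  nc (Phi w (inflate k u)) <= r * (size (inflate k u))%:R.
Proof.
move=> hr; elim: u => [|b u IH]; first by rewrite inflate_nil twisted_sum_nil nc0 mulr0.
rewrite inflate_cons size_cat natrD mulrDr (le_trans (nc_twisted_sum_cat _ _ _)) //.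
by rewrite lerD // hr.
Qed.

Lemma mean_le_mono w k k' r : (k <= k')%N -> mean_le w k r -> mean_le w k' r.
Proof.
move=> kk hr b; rewrite -(subnKC kk) /len inflateD.
exact: mean_le_word.
Qed.

Lemma mean_le0 w k : mean_le w k F.
Proof. by move=> b; exact: twisted_sum_le. Qed.

Hypothesis hsubst : is_substitution zeta.
Variable m : nat.
Hypothesis mP : forall a b, a \in inflate m [:: b].
Variables (x0 : seq letter) (m' : nat).
Hypothesis x0_everywhere : forall b, infix x0 (inflate m' [:: b]).

Definition loss (d : R) : R := d / ((maxlen m') * (maxlen m))%N%:R.

Lemma maxlens_gt0 : (0 < maxlen m' * maxlen m)%N.
Proof. by rewrite muln_gt0 !maxlen_gt0. Qed.

(** The word [x0] occurs in every tile of level m'. The two equal tiles bounding [v] together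
    contribute the factor 1 + e(-w |zeta^k v|), of modulus at most 2 - d, where the trivial bound
    has 2. The saving is [d] times the length of one such tile, a fixed fraction of the whole by
    comparability of lengths. *)
Lemma mean_contract w k r d v : 0 <= r -> 0 <= d -> return_word x0 v ->
  nc (1 + e2 (- (w * (size (inflate k v))%:R))) <= 2 - d ->
  mean_le w k r -> mean_le w (k + m') ((1 - loss d) * r).
Proof.
move=> r0 d0 [c [p [v' [q [-> x0E]]]]] hd' hr b.
have /infixP[s [t E]] := x0_everywhere b.
have {}E : inflate m' [:: b] = (s ++ p) ++ ([:: c] ++ v' ++ [:: c]) ++ (q ++ t).
  by rewrite E x0E -!catA.
have LE : (len k c <= len (k + m') b)%N.
  by rewrite /len inflateD E !inflate_cat !size_cat; lia.
have hl : (len (k + m') b)%:R <= ((maxlen m') * (maxlen m))%N%:R * (len k c)%:R :> R.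
  rewrite -natrM ler_nat -mulnA.
  apply: (@leq_trans (maxlen m' * maxlen k)); last first.
    by rewrite leq_mul2l maxlen_comparable // orbT.
  rewrite addnC (leq_trans (maxlen_ge _ _ _)) //.
  exact: maxlenD.
have hloss : loss d * (len (k + m') b)%:R <= d * (len k c)%:R.
  rewrite /loss mulrAC ler_pdivrMr ?ltr0n ?maxlens_gt0 // -mulrA ler_wpM2l //.
  by rewrite mulrC.
rewrite -mulrA mulrBl mul1r.
apply: (@le_trans _ _ (r * (len (k + m') b)%:R - r * (d * (len k c)%:R))); last first.
  by rewrite lerB // mulrCA ler_wpM2l.
rewrite {1}/len inflateD E !inflate_cat.
set P := inflate k s ++ _; set Q := inflate k q ++ _.
apply: (@le_trans _ _ (r * (size P)%:R + (r * (2 - d) * (len k c)%:R + r * (size (inflate k v'))%:R) + r * (size Q)%:R)).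
  rewrite (le_trans (nc_twisted_sum_cat _ _ _)) // -addrA lerD //.
    by rewrite /P -inflate_cat mean_le_word.
  rewrite (le_trans (nc_twisted_sum_cat _ _ _)) // lerD //; last by rewrite /Q -inflate_cat mean_le_word.
  have -> : Phi w (inflate k [:: c] ++ inflate k v' ++ inflate k [:: c]) =
     (1 + e2 (- (w * (size (inflate k (c :: v')))%:R))) * Phi w (inflate k [:: c]) +
     e2 (- (w * (len k c)%:R)) * Phi w (inflate k v').
    rewrite !twisted_sum_cat [inflate k (c :: v')]inflate_cons size_cat natrD.
    by rewrite /len [w * (_ + _)]mulrDr opprD e2D; ring.
  rewrite (le_trans (ncD _ _)) // lerD // ncM ?nc_e2 ?mul1r ?mean_le_word //.
  rewrite -mulrA mulrCA; apply: ler_pM; rewrite ?nc_ge0 //; exact: hr.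
by rewrite !size_cat !natrD /len; lra.
Qed.

End twisted_sum.

Section length_recurrence.
Variables (n : nat) (zeta : 'I_n.+1 -> seq 'I_n.+1).
Local Notation chi := (char_poly (subst_matrix zeta)).

Lemma char_poly_power (A : 'M[int]_n.+1) k :
  \sum_(l < n.+2) (char_poly A)`_l *: A ^+ (k + l) = 0.
Proof.
have := Cayley_Hamilton A.
rewrite /horner_mx /= /horner_morph horner_coef => H.
have {}H : \sum_(l < n.+2) (char_poly A)`_l *: A ^+ l = 0.
  have sz : (size (map_poly (scalar_mx (n := n.+1)) (char_poly A)) <= n.+2)%N.
    by rewrite (leq_trans (size_poly _ _)) // size_char_poly.
  move: H; rewrite -(big_mkord xpredT (fun l => (map_poly scalar_mx (char_poly A))`_l * A ^+ l)).
  move=> H; rewrite -[RHS]H -(big_mkord xpredT (fun l => (char_poly A)`_l *: A ^+ l)).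
  rewrite (big_cat_nat (leq0n _) sz) /= [X in _ + X = _]big_nat_cond [X in _ + X = _]big1 ?addr0; last first.
    move=> l /andP[/andP[hl _] _].
    have : (map_poly (scalar_mx (n := n.+1)) (char_poly A))`_l = 0 by rewrite nth_default.
    rewrite coef_map_id0 ?raddf0 //= => h.
    by rewrite -mul_scalar_mx h mul0mx.
  by apply: eq_bigr => l _; rewrite coef_map_id0 ?raddf0 //= -mul_scalar_mx.
under eq_bigr => l _ do rewrite exprD scalerAr.
by rewrite -mulr_sumr H mulr0.
Qed.

Lemma len_recurrence v k :
  \sum_(l < n.+2) chi`_l * (size (inflate zeta (k + l) v))%:Z = 0.
Proof.
pose S := subst_matrix zeta.
have E l : (size (inflate zeta (k + l) v))%:Z = \sum_(b <- v) \sum_i (S ^+ (k + l)) i b.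
  rewrite size_inflate -[LHS]natz natr_sum; apply: eq_bigr => b _.
  by rewrite natz len_matrix.
under eq_bigr => l _ do rewrite E mulr_sumr.
rewrite exchange_big big1 //= => b _.
under eq_bigr => l _ do rewrite mulr_sumr.
rewrite exchange_big big1 //= => i _.
have := congr1 (fun M : 'M[int]_n.+1 => M i b) (char_poly_power S k).
rewrite summxE mxE => H; rewrite -[RHS]H; apply: eq_bigr => l _.
by rewrite mxE.
Qed.

End length_recurrence.

Lemma return_word_size n (x0 v : seq 'I_n.+1) : return_word x0 v -> (0 < size v <= size x0)%N.
Proof. by move=> [c [p [v' [q [-> ->]]]]]; rewrite !size_cat /=; lia. Qed.

Lemma power_unbounded (R : realType) (rho K : R) : 1 < rho -> exists B, K <= rho ^+ B.
Proof.
move=> r1; have r0 : 0 < rho - 1 by rewrite subr_gt0.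
have := archi_boundP (normr_ge0 (K / (rho - 1))).
set B := Num.bound _ => hB; exists B.
apply: (@le_trans _ _ (1 + (rho - 1) *+ B)).
  have : K <= (rho - 1) * B%:R.
    by rewrite mulrC -ler_pdivrMr // (le_trans (ler_norm _)) // ltW.
  rewrite mulr_natr => h; rewrite (le_trans h) // lerDr ler01 //.
rewrite -{2}(subrKC 1 rho).
elim: (B) => [|b IH]; first by rewrite mulr0n addr0 expr0.
rewrite exprS; apply: le_trans (ler_wpM2l _ IH); last by rewrite addr_ge0 // ltW.
rewrite mulrDl mul1r mulrDr mulr1 mulrS addrA [X in _ <= _ + X]addrC.
have : 0 <= (rho - 1) * (rho - 1) *+ b by rewrite mulrn_wge0 // mulr_ge0 // ltW.
by rewrite -mulrnAr; lra.
Qed.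

(** * Frequencies away from the integers are detected by a return word *)

Section gap.
Variables (R : realType) (n : nat) (zeta : 'I_n.+1 -> seq 'I_n.+1).
Local Notation letter := 'I_n.+1.
Local Notation inflate := (inflate zeta).
Local Notation maxlen := (maxlen zeta).
Local Notation legal := (legal zeta).
Local Notation S := (subst_matrix zeta).
Hypothesis hsubst : is_substitution zeta.
Variable m : nat.
Hypothesis mP : forall a b, a \in inflate m [:: b].
Hypothesis hd : (2 <= n.+1)%N.
Variable mu : probability (borel_shift n) R.
Hypothesis hmu : invariant_probability zeta mu.
Variable x0 : seq letter.
Hypothesis x0_pairs : forall b c, legal [:: b; c] -> infix [:: b; c] x0.
Hypothesis x0_letters : forall b, b \in x0.
Hypothesis x0_legal : legal x0.
Hypothesis haper : aperiodic zeta.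
Hypothesis hirr : irreducible_poly (char_poly (map_mx intr S : 'M[rat]_n.+1)).
Hypothesis heig : forall z : R[i], eigenvalue (map_mx intr S : 'M[R[i]]_n.+1) z -> `|z| <> 1.
Hypothesis wm : ~ nontrivial_discrete_spectrum zeta mu.

Let qp_int := quasi_period_integral hsubst mP hd hmu x0_pairs x0_letters x0_legal haper hirr wm.

(* Without return words every real would be a quasi-period, in particular 1/2. *)
Lemma return_word_exists : exists v, return_word x0 v.
Proof.
apply: contrapT => hv; have [z hz] : exists z : int, (1 / 2 : R) = z%:~R.
  by apply: qp_int => v vr; case: hv; exists v.
have : (2 * z)%:~R = 1%:~R :> R by rewrite intrM -hz; field.
by move=> /intr_inj; lia.
Qed.

Lemma size_inflate_le k v : (size (inflate k v) <= size v * maxlen k)%N.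
Proof.
rewrite size_inflate -sum_seq_const; apply: leq_sum => b _; exact: maxlen_ge.
Qed.

(** Contrapositive of [diophantine], applied to the lengths of all inflated return words from level
    k0 on. The resulting [al] is a quasi-period, since a shift of levels is harmless, hence an
    integer, and it lies within E^-k0 of [om]. *)
Lemma gap (E : R) : 1 <= E -> exists B (del : R), 0 < del /\
  forall k0 om, (0 < k0)%N -> 0 <= om <= 1 ->
  (forall z : int, 1 < `|om - z%:~R| * E ^+ k0) ->
  exists k v, [/\ (k0 <= k)%N, (k <= k0 + B * k0)%N, return_word x0 v &
    forall z : int, del <= `|om * (size (inflate k v))%:R - z%:~R|].
Proof.
move=> E1.
have heig' (z : R[i]) : eigenvalue (map_mx intr S : 'M[R[i]]_n.+1) z -> nc z <> 1.
  by move=> /heig hz zE; apply: hz; rewrite normc_def; move: zE; case: (z) => x y /= ->.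
have n0 : (0 < n)%N by [].
have [del [rho [c [D [del0 rho1 c1 dio]]]]] := diophantine n0 hirr heig'.
have [v0 rv0] := return_word_exists.
pose La : R := (maxlen 1)%:R; pose Sz : R := (size x0)%:R.
have La1 : 1 <= La by rewrite ler1n maxlen_gt0.
have Sz1 : 1 <= Sz by rewrite ler1n; case: (x0) (x0_letters ord0).
pose H k0 : R := Sz * La ^+ (k0 + n).
have H1 k0 : 1 <= H k0 by rewrite mulr_ege1 // exprn_ege1.
pose K : R := c * Sz ^+ D * La ^+ (n * D).
have K1 : 1 <= K by rewrite !mulr_ege1 // exprn_ege1.
have HE k0 : c * H k0 ^+ D = K * (La ^+ D) ^+ k0.
  rewrite /H /K exprMn -!exprM mulnDl exprD [(k0 * D)%N]mulnC; ring.
(* Initial values at level k0 have size of order La^k0, so rho^(B k0) must beat La^(D k0) from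
   Liouville's inequality and the required precision E^k0. *)
have [B hB] := power_unbounded (K * La ^+ D * E) rho1.
exists B, del; split=> // k0 om k00 om01 hom; apply: contrapT => hno.
have hrho : c * H k0 ^+ D * E ^+ k0 <= rho ^+ (B * k0).
  rewrite HE exprM; apply: (@le_trans _ _ ((K * La ^+ D * E) ^+ k0)).
    rewrite (exprMn k0 (K * La ^+ D) E) (exprMn k0 K (La ^+ D)) ler_wpM2r ?exprn_ge0 ?(le_trans ler01 E1) //.
    rewrite ler_wpM2r ?exprn_ge0 ?(le_trans ler01 La1) //.
    by apply: (@le_trans _ _ (K ^+ 1)); [rewrite expr1|rewrite (ler_weXn2l K1)].
  apply: lerXn2r hB; rewrite nnegrE ?exprn_ge0 ?(ltW (lt_trans ltr01 rho1)) //.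
  have K0 := le_trans ler01 K1; have E0 := le_trans ler01 E1; have La0 := le_trans ler01 La1.
  by apply: mulr_ge0 => //; apply: mulr_ge0 => //; exact: exprn_ge0.
pose u (i : {v | return_word x0 v}) (j : nat) : int := (size (inflate (k0 + j) (sval i)))%:Z.
have [] := dio _ u (exist _ v0 rv0) om (H k0) (B * k0)%N (H1 k0) om01.
- by move=> i k; rewrite -[RHS](len_recurrence zeta (sval i) (k0 + k)); apply: eq_bigr => l _; rewrite /u addnA.
- move=> [v rv] k kn; rewrite /u /= ger0_norm // -[leLHS]/((size (inflate (k0 + k) v))%:R).
  apply: (@le_trans _ _ ((size x0 * maxlen 1 ^ (k0 + n))%N%:R)); last by rewrite natrM natrX.
  rewrite ler_nat (leq_trans (size_inflate_le _ _)) // leq_mul //.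
    by case/andP: (return_word_size rv).
  by rewrite (leq_trans (maxlen_exp _ _)) // leq_pexp2l ?maxlen_gt0 // leq_add2l.
- rewrite /u /= eqz_nat -lt0n.
  by apply: leq_trans (size_le_inflate _ _ _); case/andP: (return_word_size rv0).
- move=> [v rv] k kL; apply: contrapT => hz; apply: hno.
  exists (k0 + k)%N, v; split=> //; rewrite ?leq_addr ?leq_add2l // => z.
  by rewrite leNgt; apply/negP => /ltW hz'; apply: hz; exists z.
- apply: le_trans hrho; rewrite ler_peMr ?exprn_ege1 // mulr_ge0 ?exprn_ge0 //.
    by rewrite (le_trans ler01).
  by rewrite (le_trans ler01).
move=> al [hal heps].
have [z zE] : exists z : int, al = z%:~R.
  apply: qp_int; apply: (quasi_period_shift (k0 := k0)) => v rv.
  exact: (heps (exist _ v rv)).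
have := hom z; rewrite -zE ltNge => /negP; apply.
rewrite -(ler_pM2r (_ : 0 < rho ^+ (B * k0))) ?exprn_gt0 ?(lt_trans ltr01) // mul1r.
by rewrite mulrAC (le_trans _ hrho) // ler_wpM2r // exprn_ge0 // (le_trans ler01).
Qed.

End gap.

(** * Integrals of functions of windows *)

Lemma count_inflate_sum n (zeta : 'I_n.+1 -> seq 'I_n.+1) a k u :
  count_mem a (inflate zeta k u) = (\sum_(c <- u) count_mem a (inflate zeta k [:: c]))%N.
Proof.
elim: u => [|c u IH]; first by rewrite inflate_nil big_nil.
by rewrite inflate_cons count_cat big_cons IH.
Qed.

Section window_integrals.
Variables (R : realType) (n : nat) (zeta : 'I_n.+1 -> seq 'I_n.+1).
Local Notation letter := 'I_n.+1.
Local Notation inflate := (inflate zeta).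
Local Notation len := (len zeta).
Local Notation maxlen := (maxlen zeta).
Local Notation X := (subst_space zeta : set (borel_shift n)).
Variable mu : probability (borel_shift n) R.
Hypothesis hmu : invariant_probability zeta mu.

Let mX : measurable X := measurable_subst_space zeta.

Lemma measurable_window_in (k : int) N (A : set (seq letter)) :
  measurable (X `&` [set x : borel_shift n | A (window x k N)]).
Proof. by apply: measurableI => //; apply: sub_sigma_algebra; exact: open_window. Qed.

Lemma integrable_window (G : seq letter -> R) (k : int) N D :
  measurable D -> D `<=` X -> mu.-integrable D (EFin \o (fun x => G (window x k N))).
Proof.
move=> mD DX; apply: measurable_bounded_integrable => //.
- apply: (@le_lt_trans _ _ (mu X)); last by rewrite hmu.1 ltry.
  by apply: le_measure => //; rewrite inE.
- exact: measurable_window.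
exists (\sum_(w : N.-tuple letter) `|G w|); split; first exact: num_real.
move=> M hM x _ /=; apply: le_trans (ltW hM).
have sw : size (window x k N) == N by rewrite size_window.
by rewrite (bigD1 (Tuple sw)) //= lerDl sumr_ge0.
Qed.

Lemma Rintegral_window (G : seq letter -> R) (k : int) N :
  \int[mu]_(x in X) G (window x k N) = \sum_(w : N.-tuple letter)
    G w * fine (mu (X `&` [set x : borel_shift n | window x k N = w])).
Proof.
pose P (s : seq (N.-tuple letter)) : set (borel_shift n) :=
  X `&` [set x : borel_shift n | exists2 w : N.-tuple letter, w \in s & window x k N = w].
have PX s : P s `<=` X by move=> x [].
have mP s : measurable (P s).
  exact: (measurable_window_in k N [set u : seq letter | exists2 w : N.-tuple letter, w \in s & u = w]).
have E : X = P (index_enum (N.-tuple letter : finType)).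
  apply/seteqP; split=> x; last by case.
  move=> Xx; split=> //=; have sw : size (window x k N) == N by rewrite size_window.
  by exists (Tuple sw); rewrite ?mem_index_enum.
rewrite {1}E; elim: index_enum (index_enum_uniq (N.-tuple letter : finType)) => [_|w s IH /= /andP[ws us]].
  rewrite big_nil (_ : P [::] = set0) ?Rintegral_set0 //.
  by apply/seteqP; split=> x // [_ [w]]; rewrite in_nil.
rewrite big_cons -IH //.
have -> : P (w :: s) = (X `&` [set x : borel_shift n | window x k N = w]) `|` P s.
  apply/seteqP; split=> x.
    move=> [Xx [w']]; rewrite inE => /predU1P[->|h] hw; first by left.
    by right; split=> //; exists w'.
  case=> [[Xx hw]|[Xx [w' hw' hw]]]; split=> //=; first by exists w; rewrite ?mem_head.
  by exists w' => //; rewrite inE hw' orbT.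
have mw : measurable (X `&` [set x : borel_shift n | window x k N = w]).
  exact: (measurable_window_in k N [set u | u = w :> seq letter]).
rewrite Rintegral_setU //.
- congr (_ + _).
  rewrite (@eq_Rintegral _ _ _ _ _ (fun=> G w)) ?Rintegral_cst //.
  by move=> x; rewrite inE => -[_ /= ->].
- apply: integrable_window; first exact: measurableU.
  by move=> x [[]|[]].
apply/eqP; rewrite -subset0 => x /= [[_ hw] [_ [w' hw']]]; rewrite hw => /val_inj ww.
by move: ws; rewrite ww hw'.
Qed.

Lemma Rintegral_window_shift1 (G : seq letter -> R) (k : int) N :
  \int[mu]_(x in X) G (window x (k + 1) N) = \int[mu]_(x in X) G (window x k N).
Proof.
rewrite !Rintegral_window; apply: eq_bigr => w _; congr (_ * fine _).
rewrite -[RHS]hmu.2; last exact: (measurable_window_in k N [set u | u = w :> seq letter]).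
congr (mu _); apply/seteqP; split=> x /= [Xx hw].
  by split; [exact: shift_subst_space|rewrite window_shift].
split; last by rewrite -window_shift.
have -> : x = shift_seq (-1) (shift_seq 1 x) by apply/funext => i; rewrite /shift_seq addrNK.
exact: shift_subst_space.
Qed.

Lemma Rintegral_window_shift (G : seq letter -> R) (k : int) N :
  \int[mu]_(x in X) G (window x k N) = \int[mu]_(x in X) G (window x 0 N).
Proof.
elim/int_rec: k => [//|k IH|k IH].
  by rewrite -addn1 PoszD Rintegral_window_shift1.
by rewrite -IH -Rintegral_window_shift1; congr Rintegral; apply/funext => x; congr (G (window x _ _)); lia.
Qed.

Lemma Rintegral_le_bound (g : seq letter -> R) k N (e c : R) :
  (forall x, X x -> `|g (window x k N) - c| <= e) ->
  `|\int[mu]_(x in X) g (window x k N) - c| <= e.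
Proof.
move=> h.
have I (r : R) : \int[mu]_(x in X) r = r.
  by rewrite Rintegral_cst // (_ : fine _ = 1) ?mulr1 //; exact: congr1 hmu.1.
have ig := @integrable_window g k N X mX (@subset_refl _ _).
have ic (r : R) : mu.-integrable X (EFin \o (fun=> r)).
  exact: (@integrable_window (fun=> r) k N X mX (@subset_refl _ _)).
rewrite ler_norml lerBrDr lerBlDr; apply/andP; split.
  rewrite -(I (- e + c)); apply: le_Rintegral => // x /h.
  by rewrite ler_norml lerBrDr => /andP[].
rewrite -[leRHS]I; apply: le_Rintegral => // x /h.
by rewrite ler_norml lerBlDr => /andP[].
Qed.

Lemma Rintegral_birkhoff (g : letter -> R) N :
  \int[mu]_(x in X) (\sum_(a <- window x 0 N) g a) = N%:R * \int[mu]_(x in X) g (x 0).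
Proof.
elim: N => [|N IH].
  rewrite mul0r (_ : (fun x : borel_shift n => \sum_(a <- window x 0 0) g a) = (fun=> 0)).
    by rewrite Rintegral_cst // mul0r.
  by apply/funext => x; rewrite big_nil.
have E (x : borel_shift n) : \sum_(a <- window x 0 N.+1) g a =
    \sum_(a <- window x 0 N) g a + \sum_(a <- window x N 1) g a.
  rewrite windowS -cats1 big_cat /=; congr (_ + _).
  by rewrite /window /= !big_seq1 addr0 add0r.
under eq_Rintegral => x _ do rewrite E.
rewrite RintegralD //; last 2 first.
- exact: (integrable_window (fun u => \sum_(a <- u) g a)).
- exact: (integrable_window (fun u => \sum_(a <- u) g a)).
rewrite IH (Rintegral_window_shift (fun u => \sum_(a <- u) g a)) mulrSr mulrDl mul1r.
congr (_ + _); apply: eq_Rintegral => x _.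
by rewrite /window /= big_seq1 addr0.
Qed.

Hypothesis hsubst : is_substitution zeta.

Lemma window_decompose k N (x : full_shift n) : subst_space zeta x ->
  exists s v t, [/\ window x 0 N = s ++ inflate k v ++ t,
    (size s <= maxlen k)%N & (size t <= maxlen k)%N].
Proof.
move=> /subst_space_legal hx.
have [s [v [/prefixP[q qE] ss _]]] := legal_parse hsubst k (hx 0 N).
have : window x 0 N = take N (s ++ inflate k v).
  by rewrite qE take_size_cat //; apply/eqP; exact: size_window.
rewrite take_cat; case: ifP => _ ->.
  exists (take N s), [::], [::]; rewrite inflate_nil !cats0; split=> //.
  by rewrite size_take_min (leq_trans (geq_minr _ _)).
have [j [t [-> ht]]] := take_inflate zeta k v (N - size s).
by exists s, (take j v), t.
Qed.

Variable m : nat.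
Hypothesis mP : forall a b, a \in inflate m [:: b].
Hypothesis hd : (2 <= n.+1)%N.

(** Letter counts are exactly additive over subtiles, so [ratio_converges] applies with zero error.
    Frequencies being uniform, long Birkhoff sums are close to N times the mean with respect to [fr]
    at every point; integrating them against any invariant measure identifies the two means. *)
Lemma letter_frequency : exists (fr : letter -> R) (C lam : R),
  [/\ 0 <= C, 0 < lam < 1,
   forall (g : letter -> R) k u, `|\sum_(c <- inflate k u) g c - (\sum_a g a * fr a) * (size (inflate k u))%:R|
     <= (\sum_a `|g a|) * (C * lam ^+ k * (size (inflate k u))%:R) &
   forall g : letter -> R, \int[mu]_(x in X) g (x 0) = \sum_a g a * fr a].
Proof.
have /choice[fr /choice[eps heps]] : forall a : letter, exists c : R, exists eps : nat -> R,
    exp_small eps /\ forall k b,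
      `|(count_mem a (inflate k [:: b]))%:R - c * (len k b)%:R| <= eps k * (len k b)%:R.
  move=> a; have [|k b|c [C [rho [C0 rP h]]]] :=
    @ratio_converges R n zeta hsubst m mP hd
      (fun k b => (count_mem a (inflate k [:: b]))%:R) 0 0 (lexx _).
  - by rewrite lexx ltr01.
  - rewrite inflateSr mul0r mul0r.
    by rewrite count_inflate_sum natr_sum subrr normr0.
  by exists c, (fun k => C * rho ^+ k); split => //; exact: exp_small_geom.
have [C [lam [C0 lP hC]]] := exp_small_seq (enum letter) (fun a => (heps a).1).
have hfr a k b : `|(count_mem a (inflate k [:: b]))%:R - fr a * (len k b)%:R| <= C * lam ^+ k * (len k b)%:R.
  by rewrite (le_trans ((heps a).2 k b)) // ler_wpM2r // hC // mem_enum.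
have key g k u : `|\sum_(c <- inflate k u) g c - (\sum_a g a * fr a) * (size (inflate k u))%:R|
     <= (\sum_a `|g a|) * (C * lam ^+ k * (size (inflate k u))%:R).
  rewrite sum_inflate size_inflate natr_sum !mulr_sumr -sumrB.
  apply: le_trans (ler_norm_sum _ _ _) _; apply: ler_sum => b _.
  have -> : \sum_(c <- inflate k [:: b]) g c = \sum_a g a * (count_mem a (inflate k [:: b]))%:R.
    elim: (inflate k [:: b]) => [|c w IH].
      by rewrite big_nil big1 // => a _; rewrite mulr0.
    rewrite big_cons IH /=.
    under [RHS]eq_bigr => a _ do rewrite natrD mulrDr.
    rewrite big_split /= [X in _ = X + _](bigD1 c) //= eqxx mulr1 [X in _ = _ + X + _]big1 ?addr0 // => a.
    by rewrite eq_sym => /negPf ->; rewrite mulr0.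
  rewrite mulr_suml -sumrB mulr_suml; apply: le_trans (ler_norm_sum _ _ _) _.
  by apply: ler_sum => a _; rewrite -mulrA -mulrBr normrM ler_wpM2l.
exists fr, C, lam; split=> // g.
set c := \sum_a g a * fr a; set p := Rintegral _ _ _.
pose G := \sum_a `|g a|.
have G0 : 0 <= G by exact: sumr_ge0.
have gG a : `|g a| <= G by rewrite /G (bigD1 a) //= lerDl sumr_ge0.
have gsum u : `|\sum_(a <- u) g a| <= G * (size u)%:R.
  elim: u => [|a u IH]; first by rewrite big_nil normr0 mulr0.
  by rewrite big_cons mulrS mulrDr mulr1 (le_trans (ler_normD _ _)) // lerD.
have bnd k N : `|N%:R * p - c * N%:R| <= 2 * (G + `|c|) * (maxlen k)%:R + G * (C * lam ^+ k * N%:R).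
  rewrite -Rintegral_birkhoff.
  apply: (@Rintegral_le_bound (fun u => \sum_(a <- u) g a)) => x Xx.
  have [s [v [t [wE ss st]]]] := window_decompose k N Xx.
  have NE : N = (size s + size (inflate k v) + size t)%N.
    by rewrite -{1}(eqP (size_window x 0 N)) wE !size_cat addnA.
  rewrite wE {1}NE !big_cat /= !natrD.
  have hv := key g k v; rewrite -/c -/G in hv.
  have hs : `|\sum_(a <- s) g a| <= G * (maxlen k)%:R.
    by rewrite (le_trans (gsum s)) // ler_wpM2l // ler_nat.
  have ht : `|\sum_(a <- t) g a| <= G * (maxlen k)%:R.
    by rewrite (le_trans (gsum t)) // ler_wpM2l // ler_nat.
  have hcs : `|c * (size s)%:R| <= `|c| * (maxlen k)%:R.
    by rewrite normrM normr_nat ler_wpM2l // ler_nat.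
  have hct : `|c * (size t)%:R| <= `|c| * (maxlen k)%:R.
    by rewrite normrM normr_nat ler_wpM2l // ler_nat.
  have hvN : G * (C * lam ^+ k * (size (inflate k v))%:R) <= G * (C * lam ^+ k * N%:R).
    rewrite ler_wpM2l // ler_wpM2l ?mulr_ge0 ?exprn_ge0 ?ler_nat //; first by case/andP: lP => /ltW.
    by rewrite NE -addnA addnCA leq_addr.
  set a1 := \sum_(_ <- s) _ in hs *; set a2 := \sum_(_ <- inflate k v) _ in hv *.
  set a3 := \sum_(_ <- t) _ in ht *.
  have -> : a1 + (a2 + a3) - c * ((size s)%:R + (size (inflate k v))%:R + (size t)%:R) =
    a1 + a3 - c * (size s)%:R - c * (size t)%:R + (a2 - c * (size (inflate k v))%:R) by ring.
  apply: le_trans (ler_normD _ _) _; apply: lerD; last exact: le_trans hv hvN.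
  apply: le_trans (ler_normB _ _) _; apply: le_trans (lerD (ler_normB _ _) hct) _.
  apply: le_trans (lerD (lerD (ler_normD _ _) hcs) (lexx _)) _.
  by move: hs ht; set M := (maxlen k)%:R; rewrite mulrDr mulrDl; lra.
apply/eqP; rewrite -subr_eq0 -normr_eq0 eq_le normr_ge0 andbT.
apply/ler_addgt0Pr => e e0; rewrite add0r.
have lim : exp_small (fun k => G * C * lam ^+ k).
  by apply: exp_small_geom => //; exact: mulr_ge0.
have [K hK] := exp_small_lt lim (divr_gt0 e0 (ltr0n _ 2)).
have {hK} := hK K (leqnn _) => hK.
pose Q := 2 * (G + `|c|) * (maxlen K)%:R.
have Q0 : 0 <= Q by rewrite !mulr_ge0 ?addr_ge0.
have := archi_boundP (divr_ge0 Q0 (ltW (divr_gt0 e0 (ltr0n _ 2)))).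
set N := Num.bound _ => hN.
have N0 : 0 < N%:R :> R.
  by apply: le_lt_trans hN; apply: divr_ge0 => //; exact: ltW (divr_gt0 e0 (ltr0n _ 2)).
rewrite -(ler_pM2r N0).
have -> : `|p - c| * N%:R = `|N%:R * p - c * N%:R|.
  by rewrite -[in LHS](gtr0_norm N0) -normrM mulrBl [p * _]mulrC.
apply: le_trans (bnd K N) _; rewrite -/Q.
have h1 : Q <= e / 2 * N%:R by rewrite mulrC -ler_pdivrMr ?divr_gt0 // ltW.
have h2 : G * (C * lam ^+ K * N%:R) <= e / 2 * N%:R.
  by rewrite !mulrA ler_wpM2r // ltW.
by lra.
Qed.

End window_integrals.

(** * Decay of twisted sums *)

Section decay.
Variables (R : realType) (n : nat) (zeta : 'I_n.+1 -> seq 'I_n.+1).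
Local Notation letter := 'I_n.+1.
Local Notation inflate := (inflate zeta).
Local Notation len := (len zeta).
Local Notation maxlen := (maxlen zeta).
Local Notation legal := (legal zeta).
Local Notation S := (subst_matrix zeta).
Local Notation X := (subst_space zeta : set (borel_shift n)).
Hypothesis hsubst : is_substitution zeta.
Variable m : nat.
Hypothesis mP : forall a b, a \in inflate m [:: b].
Hypothesis hd : (2 <= n.+1)%N.
Variable mu : probability (borel_shift n) R.
Hypothesis hmu : invariant_probability zeta mu.
Implicit Types (beta : letter -> R[i]) (F w : R).

Lemma mean_le_weaken beta w k r r' : r <= r' -> mean_le zeta beta w k r -> mean_le zeta beta w k r'.
Proof. by move=> rr h b; rewrite (le_trans (h b)) // ler_wpM2r. Qed.

(** Without twist, the sums over tiles are exponentially small relative to the length l, since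
    [beta] has mean zero. The twist changes them by a multiple of |w - z| l^2, and l <= [maxlen 1] ^
    s makes this at most a multiple of 2^-s l. *)
Lemma mean_le_near_integer : exists (C th : R), [/\ 0 <= C, 0 < th < 1 &
  forall beta F w s (z : int), 0 <= F -> (forall a, nc (beta a) <= F) ->
    cintegral mu X (fun x => beta (x 0)) = 0 ->
    `|w - z%:~R| * (2 * (maxlen 1)%:R) ^+ s <= 1 ->
    mean_le zeta beta w s (F * (C * th ^+ s))].
Proof.
have [fr [C [lam [C0 /andP[l0 l1] hfr hint]]]] := letter_frequency hmu hsubst mP hd.
pose th := Num.max lam (1 / 2).
have hl : lam <= th by rewrite /th le_max lexx.
have h2 : 1 / 2 <= th by rewrite /th le_max lexx orbT.
have th1 : th < 1 by rewrite /th gt_max l1; lra.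
have th0 : 0 < th by lra.
pose N1 : R := n.+1%:R; have N10 : 0 <= N1 by exact: ler0n.
exists (8 + 2 * (N1 * C)), th; split; rewrite ?th0 //.
  by rewrite addr_ge0 // mulr_ge0 // mulr_ge0.
move=> beta F w s z F0 betaF /eqP; rewrite eq_complex /= => /andP[/eqP re0 /eqP im0] hw b.
pose u := inflate s [:: b]; pose l : R := (size u)%:R.
have lE : l = (len s b)%:R by [].
have l_ge0 : 0 <= l by exact: ler0n.
have part (g : letter -> R) : (forall a, `|g a| <= F) -> \int[mu]_(x in X) g (x 0) = 0 ->
    `|\sum_(c <- u) g c| <= F * (N1 * C * th ^+ s) * l.
  move=> gF g0; have := hfr g s [:: b]; rewrite -/u -hint g0 mul0r subr0 => h.
  apply: le_trans h _; rewrite -/l.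
  have -> : F * (N1 * C * th ^+ s) * l = (N1 * F) * (C * th ^+ s * l) by ring.
  apply: ler_pM; rewrite ?sumr_ge0 // ?mulr_ge0 ?exprn_ge0 ?(ltW l0) //.
    apply: (@le_trans _ _ (\sum_(a : letter) F)); first exact: ler_sum.
    by rewrite sumr_const card_ord -mulr_natl.
  by rewrite ler_wpM2r // ler_wpM2l // lerXn2r ?nnegrE ?(ltW l0) ?(ltW th0).
have hsum : nc (\sum_(c <- u) beta c) <= F * (2 * (N1 * C) * th ^+ s) * l.
  apply: le_trans (nc_le_ReIm _) _; rewrite Re_sum Im_sum.
  have hr := part _ (fun a => le_trans (Re_le_nc (beta a)) (betaF a)) re0.
  have hi := part _ (fun a => le_trans (Im_le_nc (beta a)) (betaF a)) im0.
  apply: le_trans (lerD hr hi) _.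
  by rewrite le_eqVlt; apply/orP; left; apply/eqP; ring.
have hL : l <= (maxlen 1)%:R ^+ s.
  by rewrite -natrX ler_nat (leq_trans (maxlen_ge _ s b)) // maxlen_exp.
have hwl : `|w - z%:~R| * l <= th ^+ s.
  have t2 : 0 < (2 : R) ^+ s by exact: exprn_gt0.
  apply: (@le_trans _ _ ((2 ^+ s)^-1)).
    rewrite -(ler_pM2r t2) mulVf ?gt_eqF // (le_trans _ hw) // exprMn -mulrA [l * _]mulrC.
    by rewrite ler_wpM2l // ler_wpM2l // ltW.
  rewrite -exprVn lerXn2r ?nnegrE ?(ltW th0) ?invr_ge0 //.
  by move: h2; rewrite mul1r.
have hn := twisted_sum_near F0 betaF w u z.
rewrite -lE -/u; apply: le_trans (nc_ler_sub _ (\sum_(c <- u) beta c)) _.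
apply: le_trans (lerD hsum hn) _.
have -> : F * ((8 + 2 * (N1 * C)) * th ^+ s) * l = F * (2 * (N1 * C) * th ^+ s) * l + 8 * F * l * th ^+ s by ring.
rewrite lerD2l -/l expr2.
have -> : 8 * F * `|w - z%:~R| * (l * l) = 8 * F * l * (`|w - z%:~R| * l) by ring.
by rewrite ler_wpM2l // !mulr_ge0.
Qed.

Hypothesis haper : aperiodic zeta.
Hypothesis hirr : irreducible_poly (char_poly (map_mx intr S : 'M[rat]_n.+1)).
Hypothesis heig : forall z : R[i], eigenvalue (map_mx intr S : 'M[R[i]]_n.+1) z -> `|z| <> 1.
Hypothesis wm : ~ nontrivial_discrete_spectrum zeta mu.

Lemma mean_le_far (E : R) : 1 <= E -> exists (q : nat) (th : R), [/\ (1 < q)%N, 0 < th < 1 &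
  forall beta F w s t, 0 <= F -> (forall a, nc (beta a) <= F) -> 0 <= w <= 1 -> (0 < s)%N ->
    (forall z : int, 1 < `|w - z%:~R| * E ^+ s) ->
    mean_le zeta beta w (s * q ^ t) (th ^+ t * F)].
Proof.
move=> E1.
have [x0 [m' [x0_pairs x0_letters x0_every]]] := universal_word hsubst mP.
have x0_legal : legal x0 by exists m', ord0.
have [B [del [del0 hgap]]] :=
  gap hsubst mP hd hmu x0_pairs x0_letters x0_legal haper hirr heig wm E1.
have [d1 d10 hd1] := nc_1De2_lt2 del0.
pose d := Num.min d1 (1 / 2); have d0 : 0 < d by rewrite /d lt_min d10; lra.
have dd1 : d <= d1 by rewrite /d ge_min lexx.
have d2 : d <= 1 / 2 by rewrite /d ge_min lexx orbT.
pose kap := loss zeta m m' d.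
have M0 : 0 < (maxlen m' * maxlen m)%N%:R :> R by rewrite ltr0n maxlens_gt0.
have kap0 : 0 < kap by rewrite divr_gt0.
have kap1 : kap <= 1 / 2.
  rewrite /kap /loss ler_pdivrMr // (le_trans d2) // ler_peMr // ler1n.
  exact: (maxlens_gt0 hsubst).
(* From k0 to q k0 there is room for the window of length B k0 and for the [m'] levels that the
   contraction takes. *)
exists (B + 2 + m')%N, (1 - kap); split; first by rewrite addnAC addn2.
  by apply/andP; split; lra.
move=> beta F w s t F0 betaF w01 s0 hw.
set q := (B + 2 + m')%N; set th := 1 - kap.
have th0 : 0 <= th by rewrite /th; lra.
elim: t => [|t IH].
  by rewrite expr0 mul1r; exact: mean_le0.
pose k0 := (s * q ^ t)%N.
have q0 : (0 < q)%N by rewrite /q addnAC addn2.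
have k00 : (0 < k0)%N by rewrite muln_gt0 s0 expn_gt0 q0.
have hw0 (z : int) : 1 < `|w - z%:~R| * E ^+ k0.
  apply: lt_le_trans (hw z) _; rewrite ler_wpM2l // ler_weXn2l //.
  by rewrite leq_pmulr // expn_gt0 q0.
have [k [v [k0k kB rv hv]]] := hgap k0 w k00 w01 hw0.
have hk : mean_le zeta beta w k (th ^+ t * F) by exact: mean_le_mono IH.
have thF : 0 <= th ^+ t * F by rewrite mulr_ge0 ?exprn_ge0.
have hc : nc (1 + e2 (- (w * (size (inflate k v))%:R))) <= 2 - d.
  apply: le_trans (hd1 _ _) _; last by rewrite lerB.
  move=> z; rewrite -normrN opprB opprK addrC.
  by have := hv (- z); rewrite mulrNz opprK.
have := mean_contract F0 hsubst mP x0_every thF (ltW d0) rv hc hk.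
rewrite -/kap -/th mulrA -exprS; apply: mean_le_mono.
rewrite expnSr mulnA -/k0; apply: (@leq_trans (k0 + B * k0 + m' * k0)).
  by rewrite leq_add // leq_pmulr.
by rewrite /q !mulnDr [(B * _)%N]mulnC [(m' * _)%N]mulnC leq_add2r addnC leq_add2l leq_pmulr.
Qed.

(** Whether [w] is near an integer is decided at level q^t. In the far case t further blocks of
    ratio q are traversed, up to level q^t q^t, which is why the base becomes q * q; in the near
    case the bound at level q^t is already better than needed. *)
Lemma decay : exists (q : nat) (C th : R), [/\ (1 < q)%N, 0 <= C, 0 < th < 1 &
  forall beta F w t, 0 <= F -> (forall a, nc (beta a) <= F) -> 0 <= w <= 1 ->
    cintegral mu X (fun x => beta (x 0)) = 0 ->
    mean_le zeta beta w (q ^ t) (F * (C * th ^+ t))].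
Proof.
have [C [th1 [C0 /andP[a0 a1] near]]] := mean_le_near_integer.
have E1 : 1 <= 2 * (maxlen 1)%:R :> R.
  by rewrite mulr_ege1 ?ler1n // maxlen_gt0.
have [q [th2 [q1 /andP[b0 b1] far]]] := mean_le_far E1.
pose th := Num.max th1 th2.
have ht1 : th1 <= th by rewrite /th le_max lexx.
have ht2 : th2 <= th by rewrite /th le_max lexx orbT.
have th0 : 0 < th by lra.
have thl : th < 1 by rewrite /th gt_max a1.
exists (q * q)%N, (1 + C), th; split; rewrite ?th0 ?thl //.
- by rewrite (ltn_trans q1) // ltn_Pmulr // ltnW.
- by rewrite addr_ge0.
move=> beta F w t F0 betaF w01 hmean.
have thn k : 0 <= th ^+ k by rewrite exprn_ge0 // ltW.
have q0 : (0 < q ^ t)%N by rewrite expn_gt0 ltnW.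
rewrite expnMn; have [hfar|hnear] := pselect (forall z : int, 1 < `|w - z%:~R| * (2 * (maxlen 1)%:R) ^+ (q ^ t)).
  apply: mean_le_weaken (far beta F w (q ^ t)%N t F0 betaF w01 q0 hfar).
  rewrite mulrC ler_wpM2l // (@le_trans _ _ (th ^+ t)) //.
    by rewrite lerXn2r ?nnegrE ?(ltW b0) ?(ltW th0).
  by rewrite ler_peMl // lerDl.
have [z hz] : exists z : int, `|w - z%:~R| * (2 * (maxlen 1)%:R) ^+ (q ^ t) <= 1.
  by apply: contrapT => h; apply: hnear => z; rewrite ltNge; apply/negP => hz; apply: h; exists z.
apply: (@mean_le_mono _ _ _ _ _ (q ^ t)); first by rewrite leq_pmulr.
apply: mean_le_weaken (near beta F w _ z F0 betaF hmean hz).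
rewrite ler_wpM2l //; apply: ler_pM; rewrite ?exprn_ge0 ?(ltW a0) ?lerDr //.
apply: (@le_trans _ _ (th ^+ (q ^ t))); first by rewrite lerXn2r ?nnegrE ?(ltW a0) ?(ltW th0).
by rewrite ler_wiXn2l ?(ltW th0) ?(ltW thl) // ltnW // ltn_expl.
Qed.

End decay.

(** * The spectral measure of an arc *)

Section complex_integral.
Variables (d : measure_display) (T : measurableType d) (R : realType).
Variables (mu : {measure set T -> \bar R}) (D : set T).
Hypothesis mD : measurable D.
Implicit Types f g : T -> R[i].

Definition cintegrable f :=
  mu.-integrable D (EFin \o (fun x => complex.Re (f x))) /\
  mu.-integrable D (EFin \o (fun x => complex.Im (f x))).

Lemma eq_cintegral f g : (forall x, D x -> f x = g x) -> cintegral mu D f = cintegral mu D g.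
Proof.
move=> fg; rewrite /cintegral; congr (_ +i* _); apply: eq_Rintegral => x; rewrite inE => Dx.
  by rewrite fg.
by rewrite fg.
Qed.

Lemma cintegrableD f g : cintegrable f -> cintegrable g -> cintegrable (fun x => f x + g x).
Proof.
move=> [fr fi] [gr gi]; split.
  have := integrableD mD fr gr; congr (mu.-integrable _ _).
  by apply/funext => x /=; rewrite ReD.
have := integrableD mD fi gi; congr (mu.-integrable _ _).
by apply/funext => x /=; rewrite ImD.
Qed.

Lemma cintegralD f g : cintegrable f -> cintegrable g ->
  cintegral mu D (fun x => f x + g x) = cintegral mu D f + cintegral mu D g.
Proof.
move=> [fr fi] [gr gi]; rewrite /cintegral.
under eq_Rintegral => x _ do rewrite ReD.
under [in X in _ +i* X]eq_Rintegral => x _ do rewrite ImD.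
by rewrite !RintegralD.
Qed.

Let ReM (c z : R[i]) : complex.Re (c * z) = complex.Re c * complex.Re z - complex.Im c * complex.Im z.
Proof. by case: c z => [a b] [x y]. Qed.

Let ImM (c z : R[i]) : complex.Im (c * z) = complex.Re c * complex.Im z + complex.Im c * complex.Re z.
Proof. by case: c z => [a b] [x y]. Qed.

Let integrableZ (r : R) (f : T -> R) : mu.-integrable D (EFin \o f) ->
  mu.-integrable D (EFin \o (fun x => r * f x)).
Proof. by move=> fi; have := integrableZl mD r fi; congr (mu.-integrable _ _). Qed.

Lemma cintegrableZ (c : R[i]) f : cintegrable f -> cintegrable (fun x => c * f x).
Proof.
move=> [fr fi]; split.
  have := integrableB mD (integrableZ (complex.Re c) fr) (integrableZ (complex.Im c) fi).
  by congr (mu.-integrable _ _); apply/funext => x /=; rewrite ReM.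
have := integrableD mD (integrableZ (complex.Re c) fi) (integrableZ (complex.Im c) fr).
by congr (mu.-integrable _ _); apply/funext => x /=; rewrite ImM.
Qed.

Lemma cintegralZ (c : R[i]) f : cintegrable f ->
  cintegral mu D (fun x => c * f x) = c * cintegral mu D f.
Proof.
move=> [fr fi]; rewrite /cintegral.
under eq_Rintegral => x _ do rewrite ReM.
under [in X in _ +i* X]eq_Rintegral => x _ do rewrite ImM.
rewrite RintegralB ?RintegralD ?RintegralZl //; try exact: integrableZ.
by case: c => a b.
Qed.

Lemma cintegral0 : cintegral mu D (fun=> 0) = 0.
Proof. by rewrite /cintegral /= !Rintegral_cst // !mul0r. Qed.

Lemma cintegrable0 : cintegrable (fun=> 0).
Proof.
by split; have := integrable0 mu D; congr (mu.-integrable _ _); apply/funext => x.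
Qed.

Lemma cintegral_sum (I : Type) (s : seq I) (c : I -> R[i]) (g : I -> T -> R[i]) :
  (forall i, cintegrable (g i)) ->
  cintegrable (fun x => \sum_(i <- s) c i * g i x) /\
  cintegral mu D (fun x => \sum_(i <- s) c i * g i x) = \sum_(i <- s) c i * cintegral mu D (g i).
Proof.
move=> hg; elim: s => [|i s [IH1 IH2]].
  rewrite big_nil (_ : (fun _ => _) = (fun=> 0)); last by apply/funext => x; rewrite big_nil.
  by split; [exact: cintegrable0|exact: cintegral0].
rewrite big_cons -IH2 -cintegralZ //.
rewrite (_ : (fun _ => _) = (fun x => c i * g i x + \sum_(j <- s) c j * g j x)); last first.
  by apply/funext => x; rewrite big_cons.
have h := cintegrableZ (c i) (hg i).
by split; [exact: cintegrableD|exact: cintegralD].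
Qed.

End complex_integral.

(** * Spectral measures of arcs tested against a Fejer type kernel *)

Section spectral_ball.
Variables (R : realType) (n : nat) (zeta : 'I_n.+1 -> seq 'I_n.+1).
Local Notation letter := 'I_n.+1.
Local Notation X := (subst_space zeta : set (borel_shift n)).
Variable mu : probability (borel_shift n) R.
Hypothesis hmu : invariant_probability zeta mu.
Variables (beta : letter -> R[i]) (sigma : {finite_measure set (measurableTypeR R) -> \bar R}).
Hypothesis hsigma : forall k : int,
  cintegral sigma `[0, 1[ (fun t => e2 (k%:~R * t)) =
  cintegral mu X (fun x => beta (x k) * (beta (x 0))^*%C).
Local Notation D := (`[0, 1[%classic : set (measurableTypeR R)).

Let mX : measurable X := measurable_subst_space zeta.
Let mD : measurable D. Proof. exact: measurable_itv. Qed.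

Lemma cintegrable_e2 (k : int) : cintegrable sigma D (fun t => e2 (k%:~R * t)).
Proof.
have sD : (sigma D < +oo)%E by rewrite ltey_eq fin_num_measure.
have cont : continuous (fun t : R => 2 * pi * (k%:~R * t)).
  by move=> t; apply: cvgM; [exact: cvg_cst|apply: cvgM; [exact: cvg_cst|exact: cvg_id]].
split; apply: measurable_bounded_integrable => //.
- apply: measurable_funTS; apply: continuous_measurable_fun => t.
  by apply: continuous_comp; [exact: cont|exact: continuous_cos].
- exists 1; split; first exact: num_real.
  by move=> M M1 t _ /=; rewrite (le_trans _ (ltW M1)) // ler_norml cos_geN1 cos_le1.
- apply: measurable_funTS; apply: continuous_measurable_fun => t.
  by apply: continuous_comp; [exact: cont|exact: continuous_sin].
exists 1; split; first exact: num_real.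
by move=> M M1 t _ /=; rewrite (le_trans _ (ltW M1)) // ler_norml sin_geN1 sin_le1.
Qed.

Lemma cintegrable_pair (j l : int) : cintegrable mu X (fun x => beta (x j) * (beta (x l))^*%C).
Proof.
pose a := (absz j + absz l)%N.
pose G (u : seq letter) := beta (nth ord0 u (absz (j + a%:Z))) * (beta (nth ord0 u (absz (l + a%:Z))))^*%C.
have E (x : borel_shift n) : beta (x j) * (beta (x l))^*%C = G (window x (- a%:Z) (2 * a).+1).
  rewrite /G /window !nth_mkseq; try by rewrite /a; lia.
  by congr (beta (x _) * (beta (x _))^*%C); rewrite /a; lia.
rewrite (_ : (fun _ => _) = (fun x => G (window x (- a%:Z) (2 * a).+1))); last exact/funext.
split.
  exact: (integrable_window hmu (fun u => complex.Re (G u)) _ _ mX (@subset_refl _ _)).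
exact: (integrable_window hmu (fun u => complex.Im (G u)) _ _ mX (@subset_refl _ _)).
Qed.

Lemma cintegral_pair_shift (k : int) (l : nat) :
  cintegral mu X (fun x => beta (x (k + l%:Z)) * (beta (x l%:Z))^*%C) =
  cintegral mu X (fun x => beta (x k) * (beta (x 0))^*%C).
Proof.
pose a := absz k.
pose G (u : seq letter) := beta (nth ord0 u (absz (k + a%:Z))) * (beta (nth ord0 u a))^*%C.
have E (j : int) (x : borel_shift n) : beta (x (k + j)) * (beta (x j))^*%C = G (window x (j - a%:Z) (2 * a).+1).
  rewrite /G /window !nth_mkseq; try by rewrite /a; lia.
  by congr (beta (x _) * (beta (x _))^*%C); rewrite /a; lia.
rewrite (_ : (fun _ => _) = (fun x => G (window x (l%:Z - a%:Z) (2 * a).+1))); last first.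
  by apply/funext => x; rewrite E.
rewrite (_ : (fun x => beta (x k) * _) = (fun x => G (window x (0 - a%:Z) (2 * a).+1))); last first.
  by apply/funext => x; rewrite -E addr0.
rewrite /cintegral; congr (_ +i* _).
  rewrite (Rintegral_window_shift hmu (fun u => complex.Re (G u))).
  by rewrite [RHS](Rintegral_window_shift hmu (fun u => complex.Re (G u))).
rewrite (Rintegral_window_shift hmu (fun u => complex.Im (G u))).
by rewrite [RHS](Rintegral_window_shift hmu (fun u => complex.Im (G u))).
Qed.

Lemma twisted_sum_window w N (x : int -> letter) :
  twisted_sum beta w (window x 0 N) = \sum_(j < N) e2 (- (w * j%:R)) * beta (x j%:Z).
Proof.
elim: N => [|N IH]; first by rewrite big_ord0.
rewrite windowS -cats1 twisted_sum_cat IH big_ord_recr /= (eqP (size_window _ _ _)).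
by rewrite add0r mulr0 addr0.
Qed.

Let norm_sqr_sum N (a : 'I_N -> R[i]) :
  ((nc (\sum_j a j)) ^+ 2)%:C = \sum_(i : 'I_N * 'I_N) a i.1 * (a i.2)^*%C.
Proof.
rewrite -conj_mul_nc rmorph_sum mulr_suml.
by under eq_bigr => j _ do rewrite mulr_sumr; rewrite pair_bigA.
Qed.

Lemma measurable_circle_ball w r : measurable (circle_ball w r : set (measurableTypeR R)).
Proof.
rewrite (_ : circle_ball w r = D `&` \bigcup_(m in [set: int]) (ball (w - m%:~R : R^o) r : set R)).
  apply: measurableI => //; apply: open_measurable; apply: bigcup_open => m _.
  exact: ball_open.
have E (t : R) (m : int) : `|w - m%:~R - t| = `|t - w + m%:~R|.
  by rewrite distrC; congr `|_|; ring.
apply/seteqP; split=> t /=.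
  move=> [t01 [m hm]]; split; first by rewrite in_itv.
  by exists m => //; rewrite /ball /= E.
move=> [t01 [m _ hm]]; split; first by move: t01; rewrite in_itv.
by exists m; move: hm; rewrite /ball /= E.
Qed.

(** The kernel [q], the squared modulus of a sum of N characters centred at [w], integrates against
    the spectral measure to the second moment of the twisted sum over a window of length N. On the
    arc each character has real part at least 1/2, since N r <= 1/8, so [q] is at least N^2/4
    there. *)
Lemma spectral_ball_le w r N M : (0 < N)%N -> N%:R * r <= 1 / 8 ->
  (forall x, X x -> nc (twisted_sum beta w (window x 0 N)) <= M) ->
  (sigma (circle_ball w r) <= (4 / N%:R ^+ 2 * M ^+ 2)%:E)%E.
Proof.
move=> N0 Nr hM.
pose I := ('I_N * 'I_N)%type.
pose k (i : I) : int := i.1%:Z - i.2%:Z.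
pose c (i : I) : R[i] := e2 (- (w * (k i)%:~R)).
pose p (t : R) : R[i] := \sum_(j < N) e2 (j%:R * (t - w)).
pose q (t : R) : R := nc (p t) ^+ 2.
have qE (t : R) : (q t)%:C = \sum_(i : I) c i * e2 ((k i)%:~R * t).
  rewrite norm_sqr_sum; apply: eq_bigr => i _.
  by rewrite -e2N -!e2D /k; congr e2; rewrite intrB -!pmulrn; ring.
have [iq cq] := cintegral_sum mD (index_enum I) c (fun i => cintegrable_e2 (k i)).
have qRe (t : R) : q t = complex.Re (\sum_(i : I) c i * e2 ((k i)%:~R * t)) by rewrite -qE.
have int_q : \int[sigma]_(t in D) q t = \int[mu]_(x in X) (nc (twisted_sum beta w (window x 0 N)) ^+ 2).
  under eq_Rintegral => t _ do rewrite qRe.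
  have := congr1 (@complex.Re R) cq; rewrite /cintegral /= => ->.
  have [ix cs] := cintegral_sum mX (index_enum I) c
    (fun i => cintegrable_pair i.1%:Z i.2%:Z).
  have <- : \sum_(i : I) c i * cintegral mu X (fun x => beta (x i.1%:Z) * (beta (x i.2%:Z))^*%C) =
     \sum_(i : I) c i * cintegral sigma D (fun t => e2 ((k i)%:~R * t)).
    apply: eq_bigr => i _; congr (_ * _); rewrite hsigma -(cintegral_pair_shift (k i) i.2).
    by rewrite /k subrK.
  rewrite -cs /cintegral /=; apply: eq_Rintegral => x _.
  suff -> : \sum_(i : I) c i * (beta (x i.1%:Z) * (beta (x i.2%:Z))^*%C) =
     (nc (twisted_sum beta w (window x 0 N)) ^+ 2)%:C by [].
  rewrite twisted_sum_window norm_sqr_sum; apply: eq_bigr => i _.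
  have conjM (y z : R[i]) : (y * z)^*%C = y^*%C * z^*%C by rewrite (rmorphM conjc).
  rewrite conjM -e2N mulrACA -e2D; congr (e2 _ * _).
  by rewrite /k intrB -!pmulrn; ring.
have iqD : sigma.-integrable D (EFin \o q).
  by have := iq.1; congr (sigma.-integrable _ _); apply/funext => t /=; rewrite qRe.
have mB := measurable_circle_ball w r.
have BD : circle_ball w r `<=` D by move=> t [t01 _]; rewrite /= in_itv.
have iqB : sigma.-integrable (circle_ball w r) (EFin \o q) by exact: (integrableS mD).
have N1 : 0 < N%:R :> R by rewrite ltr0n.
have qB t : circle_ball w r t -> N%:R ^+ 2 / 4 <= q t.
  move=> [_ [mm hmm]].
  have hp : N%:R / 2 <= nc (p t).
    apply: le_trans (le_trans (ler_norm _) (Re_le_nc _)); rewrite Re_sum.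
    apply: (@le_trans _ _ (\sum_(j < N) (1 / 2))).
      by rewrite sumr_const card_ord -[leRHS]mulr_natl mul1r.
    apply: ler_sum => j _.
    have -> : e2 (j%:R * (t - w)) = e2 (j%:R * (t - w + mm%:~R)).
      by rewrite [in RHS]mulrDr (_ : j%:R * mm%:~R = (j%:Z * mm)%:~R :> R) ?e2Dint // intrM.
    apply: cos_ge_half; rewrite normrM normr_nat (le_trans _ Nr) //.
    by apply: ler_pM => //; [rewrite ler_nat ltnW|exact: ltW].
  have -> : N%:R ^+ 2 / 4 = (N%:R / 2) ^+ 2 :> R by field.
  by rewrite /q lerXn2r ?nnegrE ?nc_ge0 // divr_ge0 // ltW.
have fB : sigma (circle_ball w r) \is a fin_num by exact: fin_num_measure.
have h1 : N%:R ^+ 2 / 4 * fine (sigma (circle_ball w r)) <= \int[sigma]_(t in circle_ball w r) q t.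
  rewrite -Rintegral_cst //; apply: le_Rintegral => //.
  apply: measurable_bounded_integrable => //; first by rewrite ltey_eq fB.
  by exists (N%:R ^+ 2 / 4); split; [exact: num_real|move=> K hK t _ /=; rewrite ger0_norm ?divr_ge0 ?exprn_ge0 // ltW].
have h2 : \int[sigma]_(t in circle_ball w r) q t <= \int[sigma]_(t in D) q t.
  have -> : D = circle_ball w r `|` (D `\` circle_ball w r) by rewrite setDUK.
  rewrite Rintegral_setU ?setDUK //; first last.
  - by apply/eqP; rewrite -subset0 => t [? []].
  - exact: measurableD.
  by rewrite lerDl Rintegral_ge0 // => t _; rewrite exprn_ge0 ?nc_ge0.
have h3 : \int[sigma]_(t in D) q t <= M ^+ 2.
  rewrite int_q -(subr0 (Rintegral _ _ _)).
  apply: le_trans (ler_norm _) _.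
  apply: (Rintegral_le_bound hmu (g := fun u => nc (twisted_sum beta w u) ^+ 2)) => x Xx.
  rewrite subr0 ger0_norm ?exprn_ge0 ?nc_ge0 //.
  by rewrite lerXn2r ?nnegrE ?nc_ge0 ?(le_trans (nc_ge0 _) (hM x Xx)) ?hM.
rewrite -(fineK fB) lee_fin.
have N2 : 0 < N%:R ^+ 2 / 4 :> R by rewrite divr_gt0 ?exprn_gt0.
rewrite -(ler_pM2l N2) (le_trans h1) // (le_trans h2) // (le_trans h3) //.
by rewrite le_eqVlt; apply/orP; left; apply/eqP; field; rewrite gt_eqF.
Qed.

End spectral_ball.

Section logarithmic_decay.
Variable R : realType.

Lemma log_scale (L q N : nat) : (2 <= L)%N -> (1 < q)%N -> (L ^ 2 <= N)%N ->
  exists t, (L ^ (2 * q ^ t) <= N < L ^ (2 * (q * q ^ t)))%N.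
Proof.
move=> L2 q1 LN.
have exN : exists t, (N < L ^ (2 * q ^ t.+1))%N.
  exists N; apply: (@leq_trans (2 ^ N)); first exact: ltn_expl.
  apply: (@leq_trans (L ^ N)).
    by rewrite leq_exp2r // (leq_trans _ LN) // expn_gt0 (ltnW L2).
  rewrite leq_pexp2l ?(ltnW L2) // (@leq_trans (q ^ N)) ?(ltnW (ltn_expl _ _)) //.
  apply: (@leq_trans (q ^ N.+1)); first by rewrite leq_pexp2l // ltnW.
  by rewrite leq_pmull.
have [t ht hmin] := ex_minnP exN; exists t; rewrite -expnS ht andbT.
case: t {ht} hmin => [_|t hmin]; first by rewrite expn0 muln1.
by rewrite leqNgt; apply/negP => /hmin; rewrite ltnn.
Qed.

(** N is the integer part of 1/(8r), and t is such that log N is comparable to q^t. The first term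
    is the share of the two incomplete tiles at the ends of the window, the second that of the
    complete tiles. *)
Lemma log_decay (q La : nat) (C th : R) : (1 < q)%N -> (0 < La)%N -> 0 <= C -> 0 < th < 1 ->
  exists C' r0 gamma : R, [/\ 0 < C', 0 < r0, 0 < gamma & forall r, 0 < r < r0 ->
    exists N t : nat, [/\ (0 < N)%N, N%:R * r <= 1 / 8 &
      4 * (2 * (La%:R ^+ (q ^ t) / N%:R) + C * th ^+ t) ^+ 2 <= C' * (ln r^-1 `^ (- gamma))]].
Proof.
move=> q1 La0 C0 /andP[th0 th1].
(* Doubling [La] makes La^k / N at most 2^-k as soon as N >= L^k, so the end pieces decay as
   well. *)
pose L := (2 * La)%N; have L2 : (2 <= L)%N by rewrite leq_pmulr.
pose th' := Num.max th (1 / 2).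
have tt' : th <= th' by rewrite /th' le_max lexx.
have ht' : 1 / 2 <= th' by rewrite /th' le_max lexx orbT.
have t'1 : th' < 1 by rewrite /th' gt_max th1; lra.
have t'0 : 0 < th' by lra.
have lq : 0 < ln (q%:R : R) by rewrite ln_gt0 // ltr1n.
have lL : 0 < ln (L%:R : R) by rewrite ln_gt0 // ltr1n.
have l16 : 0 < ln (16 : R) by rewrite ln_gt0 // ltr1n.
have lth : ln th' < 0 by rewrite ln_lt0 // t'0.
(* Solves (q^t)^gamma th'^(2t) = 1, while [K] below is such that log(1/r) <= K q^t. *)
pose gamma := - 2 * ln th' / ln q%:R.
have g0 : 0 < gamma by rewrite divr_gt0 // mulNr -mulrN mulr_gt0 // oppr_gt0.
pose K := ln (16 : R) + 2 * q%:R * ln (L%:R : R).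
have K0 : 0 < K by rewrite addr_gt0 // !mulr_gt0 // ltr0n ltnW.
pose r0 : R := (8 * L%:R ^+ 2)^-1.
have L1 : 1 <= L%:R :> R by rewrite ler1n ltnW.
have L21 : 1 <= L%:R ^+ 2 :> R by rewrite exprn_ege1.
have r00 : 0 < r0 by rewrite invr_gt0 mulr_gt0 // (lt_le_trans ltr01).
exists (4 * (2 + C) ^+ 2 * (K `^ gamma)), r0, gamma; split=> //.
  by rewrite !mulr_gt0 ?powR_gt0 ?exprn_gt0 // ltr_wpDr.
move=> r /andP[rp rr0].
have r8 : 8 * L%:R ^+ 2 < r^-1.
  by rewrite -[ltLHS]invrK ltf_pV2 ?posrE.
have r1 : 1 < r^-1 by lra.
pose x := r^-1 / 8; have x0 : 0 <= x by rewrite divr_ge0 // ltW // invr_gt0.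
have := Num.Theory.truncn_itv x0; set N := Num.truncn x => /andP[Nx xN].
have LN : (L ^ 2 <= N)%N.
  rewrite -ltnS -(ltr_nat R) natrX (le_lt_trans _ xN) // /x; lra.
have N0 : (0 < N)%N by rewrite (leq_trans _ LN) // expn_gt0 (ltnW L2).
have [t /andP[hLN hNL]] := log_scale L2 q1 LN.
have NR : 1 <= N%:R :> R by rewrite ler1n.
exists N, t; split=> //.
  apply: (@le_trans _ _ (x * r)); first by rewrite ler_wpM2r // ltW.
  by rewrite /x mulrAC mulVf ?gt_eqF.
set k := (q ^ t)%N in hLN hNL *.
have tk : (t <= k)%N by rewrite ltnW // ltn_expl.
have k0 : (0 < k)%N by rewrite expn_gt0 ltnW.
have pt : 0 < th' ^+ t by rewrite exprn_gt0.
have h1 : La%:R ^+ k / N%:R <= th' ^+ t.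
  apply: (@le_trans _ _ ((1 / 2) ^+ k)); last first.
    apply: (@le_trans _ _ (th' ^+ k)); first by rewrite lerXn2r ?nnegrE ?(ltW t'0) // divr_ge0.
    by rewrite ler_wiXn2l ?(ltW t'0) ?(ltW t'1).
  rewrite ler_pdivrMr ?(lt_le_trans ltr01) //.
  apply: (@le_trans _ _ ((1 / 2) ^+ k * L%:R ^+ k)).
    by rewrite -exprMn (_ : 1 / 2 * L%:R = La%:R) // /L natrM; field.
  rewrite ler_wpM2l ?exprn_ge0 ?divr_ge0 // -natrX ler_nat (leq_trans _ hLN) //.
  by rewrite leq_pexp2l ?(ltnW L2) // mul2n -addnn leq_addr.
have lnr : 0 < ln r^-1 by rewrite ln_gt0.
have h2 : ln r^-1 <= K * k%:R.
  have b1 : r^-1 <= 16 * L%:R ^+ (2 * (q * k)).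
    apply: (@le_trans _ _ (16 * N%:R)); last first.
      by rewrite ler_wpM2l // -natrX ler_nat ltnW.
    have : x <= 2 * N%:R.
      by rewrite (le_trans (ltW xN)) // -natr1 mulr_natl mulr2n lerD2l.
    by rewrite /x; lra.
  have Lp : 0 < L%:R ^+ (2 * (q * k)) :> R by rewrite exprn_gt0 // ltr0n ltnW.
  apply: (@le_trans _ _ (ln (16 * L%:R ^+ (2 * (q * k))))).
    by rewrite ler_ln ?posrE // ?invr_gt0 // mulr_gt0.
  rewrite lnM ?posrE // lnXn ?ltr0n ?(ltnW L2) // /K mulrDl; apply: lerD.
    by rewrite ler_peMr ?ler1n // ltW.
  by rewrite -mulr_natl !natrM; rewrite le_eqVlt; apply/orP; left; apply/eqP; ring.
have kk : k%:R `^ gamma * (th' ^+ t) ^+ 2 = 1.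
  have kp : k%:R != 0 :> R by rewrite pnatr_eq0 -lt0n.
  have -> : (th' ^+ t) ^+ 2 = expR (ln th' *+ (t * 2)).
    by rewrite -exprM -lnXn // lnK // posrE exprn_gt0.
  rewrite /powR (negPf kp) -expRD /k natrX lnXn ?ltr0n ?(ltnW q1) // /gamma.
  rewrite -[X in _ + X]mulr_natl -[X in _ * X]mulr_natl natrM.
  rewrite (_ : _ + _ = 0) ?expR0 //; field.
  by rewrite gt_eqF.
have h3 : (th' ^+ t) ^+ 2 <= K `^ gamma * (ln r^-1 `^ (- gamma)).
  have lp : 0 < ln r^-1 `^ gamma by rewrite powR_gt0.
  rewrite powRN ler_pdivlMr //.
  have -> : K `^ gamma = (K * k%:R) `^ gamma * (th' ^+ t) ^+ 2.
    by rewrite powRM ?(ltW K0) // -mulrA kk mulr1.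
  rewrite [leLHS]mulrC ler_wpM2r ?exprn_ge0 ?(ltW t'0) //.
  by apply: (ge0_ler_powR (ltW g0)) => //; rewrite nnegrE ?(ltW lnr) // mulr_ge0 // ltW.
rewrite -[leRHS]mulrA -[leRHS]mulrA ler_wpM2l //.
apply: (@le_trans _ _ (((2 + C) * th' ^+ t) ^+ 2)); last first.
  by rewrite exprMn ler_wpM2l ?exprn_ge0 ?addr_ge0.
have LaN : 0 <= La%:R ^+ k / N%:R :> R by rewrite divr_ge0 ?exprn_ge0.
have Cth : C * th ^+ t <= C * th' ^+ t.
  by rewrite ler_wpM2l // lerXn2r ?nnegrE ?(ltW th0) ?(ltW t'0).
have Cth0 : 0 <= C * th ^+ t by rewrite mulr_ge0 // exprn_ge0 // ltW.
apply: lerXn2r; rewrite ?nnegrE.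
- by rewrite addr_ge0 // mulr_ge0.
- by rewrite mulr_ge0 ?addr_ge0 // ltW.
by rewrite [leRHS]mulrDl lerD // ler_wpM2l.
Qed.

End logarithmic_decay.

Section sup_norm.
Variables (R : realType) (n : nat) (zeta : 'I_n.+1 -> seq 'I_n.+1).
Local Notation letter := 'I_n.+1.
Local Notation X := (subst_space zeta : set (borel_shift n)).

Lemma cylindrical_coefficients (f : borel_shift n -> R[i]) : X !=set0 -> cylindrical0 zeta f ->
  exists beta : letter -> R[i], [/\ forall x, X x -> f x = beta (x 0),
    0 <= sup_norm zeta f & forall a, nc (beta a) <= sup_norm zeta f].
Proof.
move=> [x1 Xx1] [b fb].
have sup_le x : X x -> nc (f x) <= sup_norm zeta f.
  move=> Xx; apply: ub_le_sup; last by exists x.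
  exists (\sum_(a : letter) nc (b a)) => _ [y Xy <-]; rewrite fb //.
  by rewrite (bigD1 (y 0)) //= lerDl sumr_ge0 // => a _; exact: nc_ge0.
have F0 : 0 <= sup_norm zeta f by rewrite (le_trans (nc_ge0 _) (sup_le x1 Xx1)).
(* A letter that is never [x 0] for a point of the space has an arbitrary coefficient not seen by
   the supremum; it is reset to 0. *)
exists (fun a => if `[< exists2 x, X x & x 0 = a >] then b a else 0); split=> //.
  move=> x Xx; rewrite fb //; case: asboolP => // h.
  by case: h; exists x.
move=> a; case: asboolP => [[x Xx <-]|_]; last by rewrite nc0.
by rewrite -fb // sup_le.
Qed.

End sup_norm.

Theorem theorem2p2 (R : realType) (n : nat) (zeta : 'I_n.+1 -> seq 'I_n.+1)
    (hd : (2 <= n.+1)%N)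
    (hsubst : is_substitution zeta)
    (hprim : primitive zeta)
    (haper : aperiodic zeta)
    (hirr : irreducible_poly
              (char_poly (map_mx intr (subst_matrix zeta) : 'M[rat]_n.+1)))
    (heig : forall z : R[i],
        eigenvalue (map_mx intr (subst_matrix zeta) : 'M[R[i]]_n.+1) z ->
        `|z| <> 1)
    (mu : probability (borel_shift n) R)
    (hmu : invariant_probability zeta mu) :
  nontrivial_discrete_spectrum zeta mu \/
  exists C r0 gamma : R, [/\ 0 < C, 0 < r0, 0 < gamma &
    forall f : borel_shift n -> R[i],
      cylindrical0 zeta f ->
      cintegral mu (subst_space zeta) f = 0 ->
      forall sigma : {finite_measure set (measurableTypeR R) -> \bar R},
        is_spectral_measure zeta mu f sigma ->
      forall w r : R, 0 <= w < 1 -> 0 < r < r0 ->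
        (sigma (circle_ball w r) <=
          (C * sup_norm zeta f ^+ 2 * ln r^-1 `^ (- gamma))%:E)%E].
Proof.
have [?|wm] := pselect (nontrivial_discrete_spectrum zeta mu); [by left|right].
have [m mP] := primitive_mem hprim.
have [q [C [th [q1 C0 thP dec]]]] := decay hsubst mP hd hmu haper hirr heig wm.
have [C' [r0 [gamma [C'0 r00 g0 hlog]]]] := log_decay q1 (maxlen_gt0 hsubst 1) C0 thP.
exists C', r0, gamma; split=> // f fcyl f0 sigma [_ hsig] w r /andP[w0 w1] hr.
have mX : measurable (subst_space zeta : set (borel_shift n)) := measurable_subst_space zeta.
have Xn0 : (subst_space zeta : set (borel_shift n)) !=set0.
  apply/set0P/eqP => X0; have := hmu.1; rewrite X0 measure0 => /eqP.
  by rewrite eq_sym onee_eq0.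
have [beta [fb F0 hF]] := cylindrical_coefficients Xn0 fcyl.
set F := sup_norm zeta f in F0 hF *.
have beta0 : cintegral mu (subst_space zeta) (fun x => beta (x 0)) = 0.
  by rewrite -f0; apply: eq_cintegral => x Xx; rewrite fb.
have hsigma (k : int) : cintegral sigma `[0, 1[ (fun t => e2 (k%:~R * t)) =
    cintegral mu (subst_space zeta) (fun x => beta (x k) * (beta (x 0))^*%C).
  rewrite hsig; apply: eq_cintegral => x Xx; rewrite !fb //; last exact: shift_subst_space.
  by rewrite /shift_seq add0r.
have [N [t [N0 Nr hN]]] := hlog r hr.
have N1 : 0 < N%:R :> R by rewrite ltr0n.
have hdec := dec beta F w t F0 hF (introT andP (conj w0 (ltW w1))) beta0.
have [th0 th1] := andP thP.
(* A window of length N is a word of complete tiles of level q^t between two pieces no longer than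
   such a tile; [A] bounds its twisted sum relative to F N, and the factors N cancel in
   [spectral_ball_le]. *)
pose A : R := 2 * ((maxlen zeta 1)%:R ^+ (q ^ t) / N%:R) + C * th ^+ t.
have hM (x : full_shift n) : subst_space zeta x -> nc (twisted_sum beta w (window x 0 N)) <= F * N%:R * A.
  move=> Xx; have [s [v [u [wE ss su]]]] := window_decompose hsubst (q ^ t) N Xx.
  have hv : (size (inflate zeta (q ^ t) v))%:R <= N%:R :> R.
    by rewrite ler_nat -(eqP (size_window x 0 N)) wE !size_cat addnCA leq_addr.
  have lmax u' : (size u' <= maxlen zeta (q ^ t))%N ->
      nc (twisted_sum beta w u') <= F * (maxlen zeta 1)%:R ^+ (q ^ t).
    move=> hu; rewrite (le_trans (twisted_sum_le hF w u')) // ler_wpM2l // -natrX ler_nat.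
    by rewrite (leq_trans hu) // maxlen_exp.
  rewrite wE (le_trans (nc_twisted_sum_cat _ _ _ _)) //.
  apply: le_trans (lerD (lmax s ss) (nc_twisted_sum_cat _ _ _ _)) _.
  have hm : nc (twisted_sum beta w (inflate zeta (q ^ t) v)) <= F * (C * th ^+ t) * N%:R.
    rewrite (le_trans (mean_le_word v hdec)) // ler_wpM2l // !mulr_ge0 ?exprn_ge0 ?(ltW th0) //.
  apply: le_trans (lerD (lexx _) (lerD hm (lmax u su))) _.
  by rewrite le_eqVlt /A; apply/orP; left; apply/eqP; field; rewrite gt_eqF.
apply: le_trans (spectral_ball_le hmu hsigma N0 Nr hM) _.
rewrite lee_fin (_ : 4 / N%:R ^+ 2 * (F * N%:R * A) ^+ 2 = F ^+ 2 * (4 * A ^+ 2)).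
  apply: le_trans (ler_wpM2l (exprn_ge0 2 F0) hN) _.
  by rewrite mulrA [F ^+ 2 * C']mulrC.
by field; rewrite gt_eqF.
Qed.
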